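(* Let $t_0\in\mathbb C\setminus\{0\}$ and let $\theta_0,\theta_1\in\mathbb C\setminus\mathbb Z$. Let $B_0^0,B_1^0$ be complex $(2\times 2)$-matrices such that $B_0^0$ has eigenvalues $\pm\frac12\theta_0$ and $B_1^0$ has eigenvalues $\pm\frac12\theta_1$. Let $$\frac{dy}{dz}=B(z,t)\,y,\qquad B(z,t)=\frac{B_0(t)}{z}+\frac{B_1(t)}{z-t}+\begin{pmatrix}1&0\\0&0\end{pmatrix},\qquad B_0(t_0)=B_0^0,\quad B_1(t_0)=B_1^0,$$ be the corresponding isomonodromic family (leading to the fifth Painlevé equation), with $B_0,B_1$ extended meromorphically to the universal cover $\mathcal D$ of $\mathbb C\setminus\{0\}$, and let $\Theta\subset\mathcal D$ be the set of poles of $B_0,B_1$ (the Malgrange $\Theta$-divisor). Then there is a global $\tau$-function of this family, i.e. a function $\tau$ holomorphic on the whole of $\mathcal D$ whose zero set coincides with $\Theta$, which satisfies on $\mathcal D\setminus\Theta$ the equality $$d\ln\tau(t)=\frac12\,\mathrm{res}_{z=t}\,\mathrm{tr}\bigl(B(z,t)\bigr)^2\,dt .$$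
   Context: Isomonodromic family: $B_0(t),B_1(t)$ are the $(2\times2)$-matrix functions, holomorphic in a neighbourhood $D(t_0)\subset\mathbb C$ of $t_0$, with $B_0(t_0)=B_0^0$, $B_1(t_0)=B_1^0$, determined by the integrability condition $d\Omega=\Omega\wedge\Omega$ for the matrix meromorphic 1-form $$\Omega=\left(\frac{B_0(t)}z+\begin{pmatrix}1&0\\0&0\end{pmatrix}\right)dz+\frac{B_1(t)}{z-t}\,d(z-t)$$ on $\overline{\mathbb C}\times D(t_0)$. Equivalently, with $E=\begin{pmatrix}1&0\\0&0\end{pmatrix}$ and $[X,Y]=XY-YX$: $\frac{dB_0}{dt}=-\frac1t[B_0,B_1]$ and $\frac{dB_1}{dt}=\frac1t[B_0,B_1]+[E,B_1]$. The eigenvalues $\pm\frac12\theta_0$ of $B_0(t)$ and $\pm\frac12\theta_1$ of $B_1(t)$ do not depend on $t$. The diagonal part of $B_0(t)+B_1(t)$ is also independent of $t$ and is written $\mathrm{diag}(-\frac12\theta_\infty,\frac12\theta_\infty)$; this defines $\theta_\infty\in\mathbb C$ and imposes no further restriction. Known fact (Miwa, Malgrange, Helminck, Palmer): $B_0,B_1$ extend meromorphically from $D(t_0)$ to the universal cover $\mathcal D\cong\mathbb C$ of $\mathbb C\setminus\{0\}$. The set $\Theta\subset\mathcal D$ (possibly empty) consists of the points at which the extended $B_0$ or $B_1$ has a pole. The letter $t$ denotes both a point of $\mathcal D$ and its projection to $\mathbb C\setminus\{0\}$, and $dt$ is the pullback to $\mathcal D$ of the coordinate differential. A function holomorphic on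 $\mathcal D$ whose zero set coincides with $\Theta$ is called a (global) $\tau$-function of the isomonodromic family, or of the fifth Painlevé equation. Here $(B(z,t))^2$ is the matrix square and $\mathrm{res}_{z=t}$ is the residue in $z$ at $z=t$. *)

(* Defs.v *)
From Stdlib Require Import Reals ZArith.
From Coquelicot Require Import Coquelicot.

Local Open Scope C_scope.

Definition Cexp (s : C) : C := (exp (Re s) * cos (Im s), exp (Re s) * sin (Im s))%R.

Definition is_Cinteger (x : C) : Prop := exists n : Z, x = RtoC (IZR n).

Definition holomorphic_at (f : C -> C) (a : C) : Prop :=
  locally a (fun z => ex_derive f z).

Definition pole_at (f : C -> C) (a : C) : Prop :=
  exists (n : nat) (g : C -> C),
    (0 < n)%nat /\ holomorphic_at g a /\ g a <> 0 /\
    locally' a (fun z => f z = g z / (z - a) ^ n).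

(* A meromorphic function is represented by a total function whose value at a
   pole is irrelevant.  Away from its poles it must be holomorphic as it stands:
   removable singularities are not allowed. *)
Definition meromorphic (f : C -> C) : Prop :=
  forall a : C, holomorphic_at f a \/ pole_at f a.

(* [c] is the coefficient of [(z - a)^-1] in the Laurent expansion of [f] at an
   (at most) polar singularity [a]; [u k] is the coefficient of [(z - a)^-(k+1)]. *)
Definition is_residue (f : C -> C) (a c : C) : Prop :=
  exists (n : nat) (u : nat -> C) (g : C -> C),
    holomorphic_at g a /\
    locally' a (fun z => f z = g z + sum_n (fun k => u k / (z - a) ^ S k) n) /\
    c = u O.

Definition is_dlog (f : C -> C) (s l : C) : Prop :=
  f s <> 0 /\ exists d : C, is_derive f s d /\ l = d / f s.

Definition mx2 : Type := @matrix C 2 2.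

Definition entry {m n : nat} (A : @matrix C m n) (i j : nat) : C := coeff_mat (RtoC 0) A i j.

Definition mxscal {m n : nat} (c : C) (A : @matrix C m n) : @matrix C m n :=
  mk_matrix m n (fun i j => c * entry A i j).

Definition mxadd (A B : mx2) : mx2 := @Mplus C_AbelianGroup 2 2 A B.

Definition mxsub (A B : mx2) : mx2 := mxadd A (@Mopp C_AbelianGroup 2 2 B).

Definition mxmul (A B : mx2) : mx2 := @Mmult C_Ring 2 2 2 A B.

Definition mxtr (A : mx2) : C := entry A 0 0 + entry A 1 1.

Definition is_eigenvalue (A : mx2) (l : C) : Prop :=
  exists v : @matrix C 2 1,
    v <> @Mzero C_AbelianGroup 2 1 /\ @Mmult C_Ring 2 2 1 A v = mxscal l v.

(* Entries with an index out of range are constantly 0, so the unbounded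
   quantifiers over indices below only concern the four actual entries. *)
Definition mx_is_derive (F : C -> mx2) (x : C) (L : mx2) : Prop :=
  forall i j : nat, is_derive (fun w => entry (F w) i j) x (entry L i j).

Definition mx_holomorphic_at (F : C -> mx2) (a : C) : Prop :=
  forall i j : nat, holomorphic_at (fun w => entry (F w) i j) a.

Definition mx_meromorphic (F : C -> mx2) : Prop :=
  forall i j : nat, meromorphic (fun w => entry (F w) i j).

Definition mx_pole_at (F : C -> mx2) (a : C) : Prop :=
  exists i j : nat, pole_at (fun w => entry (F w) i j) a.

Definition E11 : mx2 :=
  mk_matrix 2 2 (fun i j => match i, j with O, O => RtoC 1 | _, _ => RtoC 0 end).

(* The matrix 1-form [P dz + Q dt] satisfies dOmega = Omega /\ Omega at [(z, t)]:
   the two sides are [(dQ/dz - dP/dt) dz /\ dt] and [(P Q - Q P) dz /\ dt]. *)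
Definition integrable_at (P Q : C -> C -> mx2) (z t : C) : Prop :=
  exists Qz Pt : mx2,
    mx_is_derive (fun z' => Q z' t) z Qz /\
    mx_is_derive (fun t' => P z t') t Pt /\
    mxsub Qz Pt = mxsub (mxmul (P z t) (Q z t)) (mxmul (Q z t) (P z t)).

Definition coef_mx (A0 A1 : mx2) (z t : C) : mx2 :=
  mxadd (mxadd (mxscal (/ z) A0) (mxscal (/ (z - t)) A1)) E11.

(* Omega = (b0(t)/z + E11) dz + b1(t)/(z - t) d(z - t), with d(z - t) = dz - dt. *)
Definition Omega_dz (b0 b1 : C -> mx2) (z t : C) : mx2 := coef_mx (b0 t) (b1 t) z t.
Definition Omega_dt (b1 : C -> mx2) (z t : C) : mx2 := mxscal (- / (z - t)) (b1 t).

(* The local family: [b0], [b1] only matter near [t0]. *)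
Definition isomonodromic_family (t0 : C) (B00 B10 : mx2) (b0 b1 : C -> mx2) : Prop :=
  b0 t0 = B00 /\ b1 t0 = B10 /\
  mx_holomorphic_at b0 t0 /\ mx_holomorphic_at b1 t0 /\
  locally t0 (fun t : C => forall z : C, z <> 0 -> z <> t ->
    integrable_at (Omega_dz b0 b1) (Omega_dt b1) z t).

(* The universal cover of C \ {0} is C with projection [Cexp]; functions on it are
   functions of [s], with t = Cexp s and dt = Cexp s ds.  [s0] is the point over [t0]
   at which the lift of the neighbourhood of [t0] is taken. *)
Definition meromorphic_extension (t0 s0 : C) (b0 b1 B0 B1 : C -> mx2) : Prop :=
  Cexp s0 = t0 /\
  mx_meromorphic B0 /\ mx_meromorphic B1 /\
  locally s0 (fun s : C => B0 s = b0 (Cexp s) /\ B1 s = b1 (Cexp s)).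

Definition Theta (B0 B1 : C -> mx2) (s : C) : Prop :=
  mx_pole_at B0 s \/ mx_pole_at B1 s.

Definition is_tau_function (B0 B1 : C -> mx2) (tau : C -> C) : Prop :=
  (forall s : C, ex_derive tau s) /\ (forall s : C, tau s = 0 <-> Theta B0 B1 s).

Definition trB2 (B0 B1 : C -> mx2) (s z : C) : C :=
  let B := coef_mx (B0 s) (B1 s) z (Cexp s) in mxtr (mxmul B B).

(* Main.v *)
(* In the coordinate s on the universal cover, t = exp s, the integrability condition reads
   B0' = -[B0, B1], B1' = [B0, B1] + t [E, B1]; the identity theorem carries it from s0 to
   the whole cover.  Put h = tr (B0 B1) + t u with u = (B1)_11, which is half the residue
   times t.  Then h' = t u, and eliminating the off-diagonal entries gives the sigma form
   of the fifth Painleve equation, quadratic in u'.  Comparing leading terms in it, every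
   pole of h is simple with residue 1.  Where h is regular so are the diagonal entries, and
   the off-diagonal ones, which then solve linear equations with holomorphic coefficients, are
   regular too.  So Theta is exactly the set of poles of h, and exp (int h ds) is entire
   and single-valued with zero set Theta.

   Holomorphy being mere complex differentiability, the analytic facts needed rest on
   Goursat's theorem.  The Cauchy transform of a density on a contour satisfies
   T phi (w) = T phi (w0) + (w - w0) T (phi / (. - w0)) (w), which yields the local
   factorizations without power series. *)

(* The elimination uses [(q w - v r)^2 = (q w + r v)^2 - 4 (q r) (v w)]: the left side is [u'^2],
   [q w + r v] is read off from [h], and [q r], [v w] follow from the two conserved determinants
   once [p = c - u]. The exact value 1 of the residue is essential. It makes [z - a] the local
   factor of the exponential of the primitive, so no logarithm with a nontrivial monodromy and no
   pole of [tau] can appear. Functions are total, with meaningless values at poles. Therefore all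
   identities live on punctured neighbourhoods, [mero_at] is the class in which one calculates, and
   values at regular points are recovered by continuity. Since [h] has poles, its primitive cannot
   be formed globally. Local solutions of [tau' = h tau] are glued instead: on a convex overlap two
   of them differ by a constant factor, and the coordinate plane of the universal cover is exhausted
   by squares, so the constants can be normalized at one regular point. *)
Require Import Defs.
From Stdlib Require Import Reals ZArith Lra Lia Classical ClassicalEpsilon.
From Coquelicot Require Import Coquelicot.
Local Open Scope C_scope.

(** * Complex derivatives and segments *)


(* Goals coming from the hierarchy carry the type [C] in an unfolded form that
   [ring] and [field] do not recognize. *)
Ltac toC := cbv beta; match goal with |- @eq _ ?a ?b => change (@eq C a b) end.
Ltac ringC := toC; ring.
Ltac fieldC := toC; field.

Lemma locally_Cmod (P : C -> Prop) (a : C) :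
  locally a P <-> exists d : R, (0 < d)%R /\ forall z, (Cmod (z - a) < d)%R -> P z.
Proof.
  refine (iff_trans (locally_C a P) _). split.
  - intros [e He]. exists (pos e). split; [apply cond_pos|]. intros z Hz. now apply He.
  - intros [d [Hd H]]. exists (mkposreal d Hd). intros z Hz. now apply H.
Qed.

Lemma locally'_Cmod (P : C -> Prop) (a : C) :
  locally' a P <->
  exists d : R, (0 < d)%R /\ forall z, (Cmod (z - a) < d)%R -> z <> a -> P z.
Proof. exact (locally_Cmod (fun z => z <> a -> P z) a). Qed.

Lemma is_derive_Cmod (f : C -> C) (z d : C) :
  is_derive f z d <->
  forall e : R, (0 < e)%R -> exists r : R, (0 < r)%R /\
    forall y, (Cmod (y - z) < r)%R ->
      (Cmod (f y - f z - (y - z) * d) <= e * Cmod (y - z))%R.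
Proof.
  split.
  - intros [_ H] e He.
    destruct (H z (fun P HP => HP) (mkposreal e He)) as [r Hr].
    exists (pos r). split; [apply cond_pos|]. intros y Hy. exact (Hr y Hy).
  - intros H. split.
    + apply is_linear_scal_l.
    + intros x Hx e.
      assert (Hxz : z = x)
        by exact (@is_filter_lim_locally_unique C_AbsRing (AbsRing_NormedModule C_AbsRing) z x Hx).
      subst x. destruct (H e (cond_pos e)) as [r [Hr HH]].
      exists (mkposreal r Hr). intros y Hy. exact (HH y Hy).
Qed.

(* [AbsRing_NormedModule C_AbsRing] and [C_NormedModule] differ only in their
   uniform structures, which [is_derive] does not see in the codomain. *)
Lemma is_derive_AbsRing (f : C -> C) (z d : C) :
  @is_derive C_AbsRing (AbsRing_NormedModule C_AbsRing) f z d <-> is_derive f z d.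
Proof. split; intros [_ H]; (split; [apply is_linear_scal_l | exact H]). Qed.

Lemma Cmod_sub_sym (x y : C) : Cmod (x - y) = Cmod (y - x).
Proof. rewrite <- Cmod_opp. f_equal. ring. Qed.

Lemma Cmod_le_Re_Im (x : C) : (Cmod x <= Rabs (Re x) + Rabs (Im x))%R.
Proof.
  replace x with (RtoC (Re x) + Ci * RtoC (Im x)) at 1
    by (destruct x; unfold Ci, RtoC, Re, Im, Cplus, Cmult; cbn; f_equal; ring).
  eapply Rle_trans; [apply Cmod_triangle|].
  rewrite Cmod_mult, !Cmod_R, Cmod_Ci. lra.
Qed.

Lemma im_le_Cmod (x : C) : (Rabs (Im x) <= Cmod x)%R.
Proof. eapply Rle_trans; [apply Rmax_r | apply (Rmax_Cmod x)]. Qed.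

Lemma Cderive_plus (f g : C -> C) (z df dg : C) :
  is_derive f z df -> is_derive g z dg -> is_derive (fun w => f w + g w) z (df + dg).
Proof. intros Hf Hg. exact (is_derive_plus f g z df dg Hf Hg). Qed.

Lemma Cderive_mult (f g : C -> C) (z df dg : C) :
  is_derive f z df -> is_derive g z dg ->
  is_derive (fun w => f w * g w) z (df * g z + f z * dg).
Proof. intros Hf Hg. apply is_derive_AbsRing.
  apply is_derive_AbsRing in Hf; apply is_derive_AbsRing in Hg.
  exact (is_derive_mult f g z df dg Hf Hg Cmult_comm). Qed.

Lemma Cderive_const (c z : C) : is_derive (fun _ : C => c) z (RtoC 0).
Proof. exact (@is_derive_const C_AbsRing C_NormedModule c z). Qed.

Lemma Cderive_id (z : C) : is_derive (fun w : C => w) z (RtoC 1).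
Proof. apply is_derive_AbsRing. exact (@is_derive_id C_AbsRing z). Qed.

Lemma Cderive_comp (f g : C -> C) (z df dg : C) :
  is_derive f (g z) df -> is_derive g z dg -> is_derive (fun w => f (g w)) z (dg * df).
Proof. intros Hf Hg. apply is_derive_AbsRing in Hg.
  exact (@is_derive_comp C_AbsRing C_NormedModule f g z df dg Hf Hg). Qed.

Lemma Cderive_unique (f : C -> C) (z d1 d2 : C) :
  is_derive f z d1 -> is_derive f z d2 -> d1 = d2.
Proof. intros H1 H2. rewrite <- (is_C_derive_unique f z d1 H1). now apply is_C_derive_unique. Qed.

Lemma Cderive_eq (f : C -> C) (z d1 d2 : C) :
  is_derive f z d1 -> d1 = d2 -> is_derive f z d2.
Proof. now intros H <-. Qed.

Lemma Cderive_ext_loc (f g : C -> C) (z d : C) :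
  locally z (fun w => f w = g w) -> is_derive f z d -> is_derive g z d.
Proof. intros H. apply is_derive_ext_loc. now apply (proj1 (locally_C z _)). Qed.

Lemma Cderive_continuous (f : C -> C) (z : C) :
  ex_derive f z -> forall e : R, (0 < e)%R -> exists r : R, (0 < r)%R /\
    forall y, (Cmod (y - z) < r)%R -> (Cmod (f y - f z) < e)%R.
Proof.
  intros [d Hd] e He.
  destruct (proj1 (is_derive_Cmod f z d) Hd 1%R Rlt_0_1) as [r [Hr H]].
  pose proof (Cmod_ge_0 d) as Hd0.
  exists (Rmin r (e / (2 + Cmod d))). split.
  { apply Rmin_pos; [lra|]. apply Rdiv_lt_0_compat; lra. }
  intros y Hy.
  assert (H1 : (Cmod (y - z) < r)%R) by (eapply Rlt_le_trans; [exact Hy | apply Rmin_l]).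
  assert (H2 : (Cmod (y - z) < e / (2 + Cmod d))%R)
    by (eapply Rlt_le_trans; [exact Hy | apply Rmin_r]).
  specialize (H y H1).
  replace (f y - f z) with ((f y - f z - (y - z) * d) + (y - z) * d) by ring.
  eapply Rle_lt_trans; [apply Cmod_triangle|]. rewrite Cmod_mult.
  pose proof (Cmod_ge_0 (y - z)) as H0.
  apply Rlt_div_r in H2; [|lra]. nra.
Qed.

Lemma Cderive_inv (f : C -> C) (z d : C) :
  is_derive f z d -> f z <> 0 -> is_derive (fun w => / f w) z (- d / (f z * f z)).
Proof.
  intros Hf H0.
  assert (Hinv : is_derive (fun w : C => / w) (f z) (- (1) / (f z * f z))).
  { set (a := f z) in *. apply is_derive_Cmod. intros e He.
    assert (Ha : (0 < Cmod a)%R) by now apply Cmod_gt_0.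
    (* The first radius gives [|y| >= |a| / 2]. The relative error is [|y - a| / (|y| |a|^2)], at
       most [2 |y - a| / |a|^3], whence the second radius. *)
    exists (Rmin (Cmod a / 2) (e * Cmod a * Cmod a * Cmod a / 2)). split.
    { apply Rmin_pos; [lra|]. repeat apply Rmult_lt_0_compat; lra. }
    intros y Hy.
    assert (H1 : (Cmod (y - a) < Cmod a / 2)%R) by (eapply Rlt_le_trans; [exact Hy|apply Rmin_l]).
    assert (H2 : (Cmod (y - a) < e * Cmod a * Cmod a * Cmod a / 2)%R)
      by (eapply Rlt_le_trans; [exact Hy|apply Rmin_r]).
    assert (Hya : (Cmod a / 2 <= Cmod y)%R).
    { assert (Cmod a <= Cmod y + Cmod (a - y))%R
        by (replace a with (y + (a - y)) at 1 by ring; apply Cmod_triangle).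
      rewrite Cmod_sub_sym in H1. lra. }
    assert (Hy0 : y <> 0) by (apply Cmod_gt_0; lra).
    replace (/ y - / a - (y - a) * (- (1) / (a * a)))
      with ((y - a) * ((y - a) / (y * (a * a)))) by (field; tauto).
    rewrite Cmod_mult, Rmult_comm. apply Rmult_le_compat_r; [apply Cmod_ge_0|].
    rewrite Cmod_div by (repeat apply Cmult_neq_0; auto).
    rewrite !Cmod_mult. apply Rle_div_l; [apply Rmult_lt_0_compat; nra|].
    pose proof (Cmod_ge_0 (y - a)).
    assert (e * (Cmod a / 2 * (Cmod a * Cmod a)) <= e * (Cmod y * (Cmod a * Cmod a)))%R.
    { apply Rmult_le_compat_l; [lra|]. apply Rmult_le_compat_r; nra. }
    nra. }
  eapply Cderive_eq; [apply (Cderive_comp _ _ _ _ _ Hinv Hf)|]. now field.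
Qed.

Lemma Cderive_opp (f : C -> C) (z df : C) :
  is_derive f z df -> is_derive (fun w => - f w) z (- df).
Proof. intros Hf. exact (is_derive_opp f z df Hf). Qed.

Lemma Cderive_minus (f g : C -> C) (z df dg : C) :
  is_derive f z df -> is_derive g z dg -> is_derive (fun w => f w - g w) z (df - dg).
Proof. intros Hf Hg. apply Cderive_plus; [exact Hf|]. now apply Cderive_opp. Qed.

Lemma Cderive_div (f g : C -> C) (z df dg : C) :
  is_derive f z df -> is_derive g z dg -> g z <> 0 ->
  is_derive (fun w => f w / g w) z ((df * g z - f z * dg) / (g z * g z)).
Proof.
  intros Hf Hg H0.
  eapply Cderive_eq; [apply (Cderive_mult _ _ _ _ _ Hf (Cderive_inv _ _ _ Hg H0))|].
  now field.
Qed.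

Lemma ex_Cderive_plus (f g : C -> C) (z : C) :
  ex_derive f z -> ex_derive g z -> ex_derive (fun w => f w + g w) z.
Proof. intros [a Ha] [b Hb]. eexists. apply Cderive_plus; eassumption. Qed.

Lemma ex_Cderive_minus (f g : C -> C) (z : C) :
  ex_derive f z -> ex_derive g z -> ex_derive (fun w => f w - g w) z.
Proof. intros [a Ha] [b Hb]. eexists. apply Cderive_minus; eassumption. Qed.

Lemma ex_Cderive_mult (f g : C -> C) (z : C) :
  ex_derive f z -> ex_derive g z -> ex_derive (fun w => f w * g w) z.
Proof. intros [a Ha] [b Hb]. eexists. apply Cderive_mult; eassumption. Qed.

Lemma ex_Cderive_div (f g : C -> C) (z : C) :
  ex_derive f z -> ex_derive g z -> g z <> 0 -> ex_derive (fun w => f w / g w) z.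
Proof. intros [a Ha] [b Hb] H. eexists. apply Cderive_div; eassumption. Qed.

Lemma ex_Cderive_const (c z : C) : ex_derive (fun _ : C => c) z.
Proof. eexists. apply Cderive_const. Qed.

Lemma ex_Cderive_id (z : C) : ex_derive (fun w : C => w) z.
Proof. eexists. apply Cderive_id. Qed.

Lemma ex_Cderive_pow (f : C -> C) (n : nat) (z : C) :
  ex_derive f z -> ex_derive (fun w => f w ^ n) z.
Proof.
  intros H. induction n as [|n IH]; simpl; [apply ex_Cderive_const|].
  now apply ex_Cderive_mult.
Qed.

Lemma ex_Cderive_ext_loc (f g : C -> C) (z : C) :
  locally z (fun w => f w = g w) -> ex_derive f z -> ex_derive g z.
Proof. intros H [d Hd]. exists d. now apply (Cderive_ext_loc f). Qed.

(** * Integration along segments *)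

Definition path (A B : C) (t : R) : C := A + RtoC t * (B - A).

(** The scalar field changes from complex to real, so the chain rule is checked on difference
    quotients: a real increment [k] moves the path by exactly [k (B - A)]. *)
Lemma is_derive_path_Re_Im (f : C -> C) (A B d : C) (t : R) :
  is_derive f (path A B t) d ->
  is_derive (fun t => Re (f (path A B t))) t (Re (d * (B - A))) /\
  is_derive (fun t => Im (f (path A B t))) t (Im (d * (B - A))).
Proof.
  intros Hf.
  assert (key : forall e : R, (0 < e)%R -> exists r : R, (0 < r)%R /\
    forall k : R, (Rabs k < r)%R -> k <> 0%R ->
    (Cmod ((f (path A B (t + k)) - f (path A B t)) / RtoC k - d * (B - A)) < e)%R).
  { intros e He. pose proof (Cmod_ge_0 (B - A)) as HBA.
    (* The [1 +] covers [A = B], and the factor 2 leaves room for a strict inequality. *)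
    destruct (proj1 (is_derive_Cmod _ _ _) Hf (e / (2 * (1 + Cmod (B - A))))%R) as [r [Hr H]].
    { apply Rdiv_lt_0_compat; lra. }
    exists (r / (1 + Cmod (B - A)))%R. split; [apply Rdiv_lt_0_compat; lra|].
    intros k Hk Hk0. apply Rlt_div_r in Hk; [|lra].
    assert (E : path A B (t + k) - path A B t = RtoC k * (B - A))
      by (unfold path; rewrite RtoC_plus; ring).
    pose proof (Rabs_pos k) as Hak. pose proof (Rabs_pos_lt k Hk0) as Hak'.
    specialize (H (path A B (t + k))). rewrite E, Cmod_mult, Cmod_R in H.
    specialize (H ltac:(nra)).
    assert (HkC : RtoC k <> 0) by (intros Hc; apply Hk0; now apply RtoC_inj).
    replace ((f (path A B (t + k)) - f (path A B t)) / RtoC k - d * (B - A))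
      with ((f (path A B (t + k)) - f (path A B t) - RtoC k * (B - A) * d) / RtoC k)
      by (field; auto).
    rewrite Cmod_div, Cmod_R by auto. apply Rlt_div_l; [lra|].
    eapply Rle_lt_trans; [exact H|].
    replace (e / (2 * (1 + Cmod (B - A))) * (Rabs k * Cmod (B - A)))%R
      with (e * Rabs k * (Cmod (B - A) / (2 * (1 + Cmod (B - A)))))%R by (field; lra).
    rewrite <- (Rmult_1_r (e * Rabs k)) at 2. apply Rmult_lt_compat_l; [nra|].
    apply Rlt_div_l; lra. }
  assert (divRe : forall (w : C) (k : R), k <> 0%R -> Re (w / RtoC k) = (Re w / k)%R).
  { intros [x y] k Hk. unfold Cdiv, Cinv, Cmult, RtoC, Re, Im; cbn. field. nra. }
  assert (divIm : forall (w : C) (k : R), k <> 0%R -> Im (w / RtoC k) = (Im w / k)%R).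
  { intros [x y] k Hk. unfold Cdiv, Cinv, Cmult, RtoC, Re, Im; cbn. field. nra. }
  split; apply is_derive_Reals; intros e He; destruct (key e He) as [r [Hr H]];
    exists (mkposreal r Hr); intros k Hk0 Hk; cbn in Hk; eapply Rle_lt_trans; try apply (H k Hk Hk0).
  - eapply Rle_trans; [|apply re_le_Cmod]. right. f_equal.
    change (Re (?x - ?y)) with (Re x - Re y)%R. now rewrite divRe.
  - eapply Rle_trans; [|apply im_le_Cmod]. right. f_equal.
    change (Im (?x - ?y)) with (Im x - Im y)%R. now rewrite divIm.
Qed.


Ltac ringR := match goal with |- @eq _ ?a ?b => change (@eq R a b); ring end.

Lemma RInt_lincomb (g h : R -> R) (x y a b : R) :
  ex_RInt g a b -> ex_RInt h a b ->
  RInt (fun t => x * g t + y * h t)%R a b = (x * RInt g a b + y * RInt h a b)%R.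
Proof.
  intros Hg Hh.
  etransitivity;
    [apply (@RInt_plus R_CompleteNormedModule (fun t => scal x (g t)) (fun t => scal y (h t)));
     now apply (@ex_RInt_scal R_CompleteNormedModule)|].
  rewrite 2 (@RInt_scal R_CompleteNormedModule) by assumption. reflexivity.
Qed.

(** The contour integral along the segment, with [dz = (B - A) dt]; splitting into real and
    imaginary parts reduces it to real Riemann integrals. *)
Definition seg (f : C -> C) (A B : C) : C :=
  (B - A) * (RInt (fun t => Re (f (path A B t))) 0 1, RInt (fun t => Im (f (path A B t))) 0 1).

Definition seg_diff (f : C -> C) (A B : C) : Prop :=
  forall t : R, (0 <= t <= 1)%R -> ex_derive f (path A B t).

Lemma ex_RInt_seg (f : C -> C) (A B : C) (a b : R) :
  seg_diff f A B -> (0 <= a <= b)%R -> (b <= 1)%R ->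
  ex_RInt (fun t => Re (f (path A B t))) a b /\ ex_RInt (fun t => Im (f (path A B t))) a b.
Proof.
  intros H Ha Hb.
  split; apply (@ex_RInt_continuous R_CompleteNormedModule); intros t Ht;
    rewrite Rmin_left, Rmax_right in Ht by lra; destruct (H t ltac:(lra)) as [d Hd];
    destruct (is_derive_path_Re_Im _ _ _ _ _ Hd) as [H1 H2];
    apply (@ex_derive_continuous R_AbsRing R_NormedModule); eexists; eassumption.
Qed.

Lemma seg_ext (f g : C -> C) (A B : C) :
  (forall t : R, (0 <= t <= 1)%R -> f (path A B t) = g (path A B t)) -> seg f A B = seg g A B.
Proof.
  intros H. unfold seg. do 2 f_equal; apply RInt_ext; intros t Ht;
    rewrite Rmin_left, Rmax_right in Ht by lra; rewrite H; auto; lra.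
Qed.

Lemma seg_plus (f g : C -> C) (A B : C) :
  seg_diff f A B -> seg_diff g A B -> seg (fun z => f z + g z) A B = seg f A B + seg g A B.
Proof.
  intros Hf Hg. unfold seg. rewrite <- Cmult_plus_distr_l. f_equal.
  destruct (ex_RInt_seg f A B 0 1 Hf ltac:(lra) ltac:(lra)).
  destruct (ex_RInt_seg g A B 0 1 Hg ltac:(lra) ltac:(lra)).
  unfold Cplus at 3. cbn [fst snd]. f_equal; now apply (@RInt_plus R_CompleteNormedModule).
Qed.

Lemma seg_scal (c : C) (f : C -> C) (A B : C) :
  seg_diff f A B -> seg (fun z => c * f z) A B = c * seg f A B.
Proof.
  intros Hf. unfold seg. rewrite Cmult_assoc, (Cmult_comm c), <- Cmult_assoc. f_equal.
  destruct (ex_RInt_seg f A B 0 1 Hf ltac:(lra) ltac:(lra)) as [H1 H2].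
  destruct c as [x y]. unfold Cmult at 3. cbn [fst snd]. f_equal.
  - rewrite (RInt_ext _ (fun t => x * Re (f (path A B t)) + - y * Im (f (path A B t)))%R).
    + rewrite RInt_lincomb by assumption. ringR.
    + intros t _. unfold Re, Im, Cmult. cbn [fst snd]. ringR.
  - rewrite (RInt_ext _ (fun t => y * Re (f (path A B t)) + x * Im (f (path A B t)))%R).
    + rewrite RInt_lincomb by assumption. ringR.
    + intros t _. unfold Re, Im, Cmult. cbn [fst snd]. ringR.
Qed.

(** The factor 2 comes from bounding the real and imaginary parts separately; the constants chosen
    later absorb it. *)
Lemma seg_bound (f : C -> C) (A B : C) (M : R) :
  seg_diff f A B -> (forall t : R, (0 <= t <= 1)%R -> (Cmod (f (path A B t)) <= M)%R) ->
  (Cmod (seg f A B) <= 2 * Cmod (B - A) * M)%R.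
Proof.
  intros Hf HM. unfold seg. rewrite Cmod_mult.
  destruct (ex_RInt_seg f A B 0 1 Hf ltac:(lra) ltac:(lra)) as [H1 H2].
  assert (K : forall g : R -> R, ex_RInt g 0 1 ->
    (forall t : R, (0 <= t <= 1)%R -> (Rabs (g t) <= M)%R) -> (Rabs (RInt g 0 1) <= M)%R).
  { intros g Hg Hb. eapply Rle_trans; [apply abs_RInt_le_const with (M := M)|]; auto; lra. }
  rewrite (Rmult_comm 2), Rmult_assoc. apply Rmult_le_compat_l; [apply Cmod_ge_0|].
  eapply Rle_trans; [apply Cmod_le_Re_Im|]. cbn.
  replace (2 * M)%R with (M + M)%R by ring.
  apply Rplus_le_compat; apply K; auto; intros t Ht;
    (eapply Rle_trans; [|apply (HM t Ht)]); [apply re_le_Cmod | apply im_le_Cmod].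
Qed.

(** The real fundamental theorem is applied to both parts of [F] along the path. Differentiability
    of [f] on the segment provides the continuity of the integrand. *)
Lemma seg_FTC (F f : C -> C) (A B : C) :
  seg_diff f A B ->
  (forall t : R, (0 <= t <= 1)%R -> is_derive F (path A B t) (f (path A B t))) ->
  seg f A B = F B - F A.
Proof.
  intros Hf HF.
  assert (E : seg f A B =
    (RInt (fun t => Re (f (path A B t) * (B - A))) 0 1,
     RInt (fun t => Im (f (path A B t) * (B - A))) 0 1)).
  { destruct (ex_RInt_seg f A B 0 1 Hf ltac:(lra) ltac:(lra)) as [H1 H2].
    unfold seg. generalize (B - A). intros [x y].
    symmetry. apply injective_projections; cbn [fst snd Cmult].
    - rewrite (RInt_ext _ (fun t => x * Re (f (path A B t)) + - y * Im (f (path A B t)))%R).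
      + rewrite RInt_lincomb by assumption. ringR.
      + intros t _. unfold Re, Im, Cmult. cbn [fst snd]. ringR.
    - rewrite (RInt_ext _ (fun t => y * Re (f (path A B t)) + x * Im (f (path A B t)))%R).
      + rewrite RInt_lincomb by assumption. ringR.
      + intros t _. unfold Re, Im, Cmult. cbn [fst snd]. ringR. }
  rewrite E. clear E.
  assert (P0 : path A B 0 = A) by (unfold path; ring).
  assert (P1 : path A B 1 = B) by (unfold path; ring).
  assert (D : forall t : R, (0 <= t <= 1)%R ->
    is_derive (fun t => Re (f (path A B t) * (B - A))) t
      (Re (C_derive f (path A B t) * (B - A) * (B - A))) /\
    is_derive (fun t => Im (f (path A B t) * (B - A))) t
      (Im (C_derive f (path A B t) * (B - A) * (B - A)))).
  { intros t Ht. pose proof (C_derive_correct f (path A B t) 0 (Hf t Ht)) as Hd.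
    apply (is_derive_path_Re_Im (fun z => f z * (B - A))).
    eapply Cderive_eq; [apply Cderive_mult; [exact Hd|apply Cderive_const]|].
    ringC. }
  assert (FF : forall G g g' : R -> R,
    (forall t : R, (0 <= t <= 1)%R -> is_derive G t (g t)) ->
    (forall t : R, (0 <= t <= 1)%R -> is_derive g t (g' t)) -> RInt g 0 1 = (G 1 - G 0)%R).
  { intros G g g' HG Hg. apply is_RInt_unique.
    apply (is_RInt_derive G g); intros t Ht; rewrite Rmin_left, Rmax_right in Ht by lra.
    - now apply HG.
    - apply (@ex_derive_continuous R_AbsRing R_NormedModule). eexists. now apply Hg. }
  unfold Cminus at 3, Cplus, Copp. f_equal.
  - rewrite (FF (fun t => Re (F (path A B t))) _
      (fun t => Re (C_derive f (path A B t) * (B - A) * (B - A)))).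
    + rewrite P0, P1. reflexivity.
    + intros t Ht. apply is_derive_path_Re_Im. now apply HF.
    + intros t Ht. now apply D.
  - rewrite (FF (fun t => Im (F (path A B t))) _
      (fun t => Im (C_derive f (path A B t) * (B - A) * (B - A)))).
    + rewrite P0, P1. reflexivity.
    + intros t Ht. now apply is_derive_path_Re_Im, HF.
    + intros t Ht. now apply D.
Qed.

(** Under [t -> 1 - t] the integral over the parameter is unchanged; the sign comes from the factor
    [B - A]. *)
Lemma seg_rev (f : C -> C) (A B : C) :
  seg_diff f A B -> seg f B A = - seg f A B.
Proof.
  intros Hf. destruct (ex_RInt_seg f A B 0 1 Hf ltac:(lra) ltac:(lra)) as [H1 H2].
  assert (K : forall g h : R -> R, ex_RInt g 0 1 -> (forall t : R, h t = g (-1 * t + 1)%R) ->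
    RInt h 0 1 = RInt g 0 1).
  { intros g h Hg Hh.
    transitivity (opp (RInt (fun t => scal (-1)%R (g (-1 * t + 1)%R)) 0 1)).
    - rewrite <- (@RInt_opp R_CompleteNormedModule).
      + apply RInt_ext. intros t _. rewrite Hh. unfold opp, scal, mult; cbn. unfold mult; cbn. ring.
      + apply (@ex_RInt_comp_lin R_CompleteNormedModule).
        apply ex_RInt_swap. now replace (-1 * 1 + 1)%R with 0%R by ring;
          replace (-1 * 0 + 1)%R with 1%R by ring.
    - rewrite (@RInt_comp_lin R_CompleteNormedModule).
      + replace (-1 * 1 + 1)%R with 0%R by ring. replace (-1 * 0 + 1)%R with 1%R by ring.
        rewrite <- (@opp_RInt_swap R_CompleteNormedModule) by exact Hg. apply opp_opp.
      + apply ex_RInt_swap. now replace (-1 * 1 + 1)%R with 0%R by ring;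
          replace (-1 * 0 + 1)%R with 1%R by ring. }
  unfold seg.
  assert (P : forall t, path B A t = path A B (-1 * t + 1)%R)
    by (intros t; unfold path; rewrite RtoC_plus, RtoC_mult; ring).
  rewrite (K (fun t => Re (f (path A B t))) (fun t => Re (f (path B A t)))),
    (K (fun t => Im (f (path A B t))) (fun t => Im (f (path B A t)))); auto.
  - ring.
  - intros t. now rewrite P.
  - intros t. now rewrite P.
Qed.

Lemma path_mid_l (A B : C) (t : R) : path A ((A + B) / 2) t = path A B (/ 2 * t + 0)%R.
Proof.
  unfold path. rewrite Rplus_0_r, RtoC_mult, RtoC_inv by lra. field.
Qed.

Lemma path_mid_r (A B : C) (t : R) : path ((A + B) / 2) B t = path A B (/ 2 * t + / 2)%R.
Proof.
  unfold path. rewrite RtoC_plus, RtoC_mult, RtoC_inv by lra. field.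
Qed.

Lemma seg_mid (f : C -> C) (A B : C) :
  seg_diff f A B -> seg f A B = seg f A ((A + B) / 2) + seg f ((A + B) / 2) B.
Proof.
  intros Hf.
  destruct (ex_RInt_seg f A B 0 (/ 2) Hf ltac:(lra) ltac:(lra)) as [H1 H2].
  destruct (ex_RInt_seg f A B (/ 2) 1 Hf ltac:(lra) ltac:(lra)) as [H3 H4].
  assert (K : forall (g h : R -> R) (v : R), ex_RInt g v (/ 2 + v) ->
    (forall t, h t = g (/ 2 * t + v)%R) -> RInt h 0 1 = (2 * RInt g v (/ 2 + v))%R).
  { intros g h v Hg Hh.
    replace v with (/ 2 * 0 + v)%R in Hg at 1 by ring.
    replace (/ 2 + v)%R with (/ 2 * 1 + v)%R in Hg by ring.
    pose proof (@RInt_comp_lin R_CompleteNormedModule g (/ 2) v 0 1 Hg) as E.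
    replace (/ 2 * 0 + v)%R with v in E by ring.
    replace (/ 2 * 1 + v)%R with (/ 2 + v)%R in E by ring.
    rewrite <- E, (@RInt_scal R_CompleteNormedModule).
    - rewrite (RInt_ext h (fun t => g (/ 2 * t + v)%R)) by (intros; apply Hh).
      unfold scal; cbn; unfold mult; cbn. field.
    - apply (@ex_RInt_comp_lin R_CompleteNormedModule) in Hg.
      apply (ex_RInt_ext (fun t => scal 2%R (scal (/2)%R (g (/2 * t + v)%R)))).
      + intros t _. unfold scal; cbn; unfold mult; cbn. field.
      + now apply (@ex_RInt_scal R_CompleteNormedModule). }
  unfold seg.
  replace (/ 2)%R with (/ 2 + 0)%R in H1, H2 by ring.
  assert (Hh : (/ 2 + / 2 = 1)%R) by field.
  assert (H3' := H3). assert (H4' := H4). rewrite <- Hh in H3', H4'.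
  rewrite (K (fun t => Re (f (path A B t))) (fun t => Re (f (path A ((A + B) / 2) t))) 0%R);
    [|exact H1|intros t; now rewrite path_mid_l].
  rewrite (K (fun t => Im (f (path A B t))) (fun t => Im (f (path A ((A + B) / 2) t))) 0%R);
    [|exact H2|intros t; now rewrite path_mid_l].
  rewrite (K (fun t => Re (f (path A B t))) (fun t => Re (f (path ((A + B) / 2) B t))) (/ 2)%R);
    [|exact H3'|intros t; now rewrite path_mid_r].
  rewrite (K (fun t => Im (f (path A B t))) (fun t => Im (f (path ((A + B) / 2) B t))) (/ 2)%R);
    [|exact H4'|intros t; now rewrite path_mid_r].
  rewrite Hh. rewrite Rplus_0_r in *.
  rewrite <- (@RInt_Chasles R_CompleteNormedModule _ 0 (/ 2) 1 H1 H3).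
  rewrite <- (@RInt_Chasles R_CompleteNormedModule _ 0 (/ 2) 1 H2 H4).
  replace ((A + B) / 2 - A) with ((B - A) / 2) by field.
  replace (B - (A + B) / 2) with ((B - A) / 2) by field.
  generalize (RInt (fun t : R => Re (f (path A B t))) 0 (/ 2)).
  generalize (RInt (fun t : R => Re (f (path A B t))) (/ 2) 1).
  generalize (RInt (fun t : R => Im (f (path A B t))) 0 (/ 2)).
  generalize (RInt (fun t : R => Im (f (path A B t))) (/ 2) 1).
  intros x1 x2 x3 x4. unfold plus; cbn.
  replace (x4 + x3, x2 + x1)%R with ((x4, x2) + (x3, x1)) by reflexivity.
  replace (2 * x4, 2 * x2)%R with (2 * (x4, x2)) by (unfold Cmult; cbn; f_equal; ring).
  replace (2 * x3, 2 * x1)%R with (2 * (x3, x1)) by (unfold Cmult; cbn; f_equal; ring).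
  field.
Qed.

(** * Goursat's theorem and primitives *)


Definition Cconvex (S : C -> Prop) : Prop :=
  forall A B : C, S A -> S B -> forall t : R, (0 <= t <= 1)%R -> S (path A B t).

(** Ensures that the limit point of a shrinking sequence of triangles stays in the domain. *)
Definition Cclosed (S : C -> Prop) : Prop :=
  forall z : C, (forall e : R, (0 < e)%R -> exists w : C, S w /\ (Cmod (w - z) < e)%R) -> S z.

Definition tri (f : C -> C) (A B D : C) : C := seg f A B + seg f B D + seg f D A.

Definition perim (A B D : C) : R := (Cmod (B - A) + Cmod (D - B) + Cmod (A - D))%R.

Lemma Cconvex_mid (S : C -> Prop) (A B : C) : Cconvex S -> S A -> S B -> S ((A + B) / 2).
Proof.
  intros HS HA HB. replace ((A + B) / 2) with (path A B (/ 2)); [apply HS; auto; lra|].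
  unfold path. rewrite RtoC_inv by lra. field.
Qed.

Lemma tri_subdivide (S : C -> Prop) (f : C -> C) (A B D : C) :
  Cconvex S -> (forall z, S z -> ex_derive f z) -> S A -> S B -> S D ->
  tri f A B D =
    tri f A ((A + B) / 2) ((D + A) / 2) + tri f ((A + B) / 2) B ((B + D) / 2) +
    tri f ((D + A) / 2) ((B + D) / 2) D + tri f ((A + B) / 2) ((B + D) / 2) ((D + A) / 2).
Proof.
  intros HS Hf HA HB HD.
  assert (Hs : forall X Y, S X -> S Y -> seg_diff f X Y)
    by (intros X Y HX HY t Ht; apply Hf, HS; auto).
  pose proof (Cconvex_mid S A B HS HA HB). pose proof (Cconvex_mid S B D HS HB HD).
  pose proof (Cconvex_mid S D A HS HD HA).
  unfold tri.
  rewrite (seg_mid f A B), (seg_mid f B D), (seg_mid f D A) by auto.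
  rewrite (seg_rev f ((D + A) / 2) ((A + B) / 2)) by auto.
  rewrite (seg_rev f ((A + B) / 2) ((B + D) / 2)) by auto.
  rewrite (seg_rev f ((B + D) / 2) ((D + A) / 2)) by auto.
  ring.
Qed.

Lemma Cmod_half (x : C) : Cmod (x / 2) = (Cmod x / 2)%R.
Proof.
  rewrite Cmod_div by (intros H; apply RtoC_inj in H; lra).
  rewrite Cmod_R, Rabs_right; lra.
Qed.

(** Bisection by edge midpoints. Deciding the inequality makes the sequence of triangles a plain
    recursive function; the middle triangle is the default when no corner triangle is bad. *)
Definition goursat_next (f : C -> C) (e : R) (T : C * C * C) : C * C * C :=
  let '(A, B, D) := T in
  let m1 := (A + B) / 2 in let m2 := (B + D) / 2 in let m3 := (D + A) / 2 in
  let bad X Y Z := Rlt_dec (e * perim X Y Z ^ 2) (Cmod (tri f X Y Z)) in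
  if bad A m1 m3 then (A, m1, m3) else if bad m1 B m2 then (m1, B, m2)
  else if bad m3 m2 D then (m3, m2, D) else (m1, m2, m3).

Definition goursat_bad (S : C -> Prop) (f : C -> C) (e p : R) (T : C * C * C) : Prop :=
  let '(A, B, D) := T in
  S A /\ S B /\ S D /\ perim A B D = p /\ (e * p ^ 2 < Cmod (tri f A B D))%R.

(** Four quarters with integrals at most [e (p / 2)^2] would add up to at most [e p^2], so if the
    three corner triangles are harmless the middle one is bad. The bound on first vertices makes
    them a Cauchy sequence. *)
Lemma goursat_next_bad (S : C -> Prop) (f : C -> C) (e p : R) (T : C * C * C) :
  Cconvex S -> (forall z, S z -> ex_derive f z) -> goursat_bad S f e p T ->
  goursat_bad S f e (p / 2) (goursat_next f e T) /\
  (Cmod (fst (fst (goursat_next f e T)) - fst (fst T)) <= p)%R.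
Proof.
  intros HS Hf. destruct T as [[A B] D]. intros (HA & HB & HD & Hp & Hbad).
  pose proof (Cconvex_mid S A B HS HA HB) as S1.
  pose proof (Cconvex_mid S B D HS HB HD) as S2.
  pose proof (Cconvex_mid S D A HS HD HA) as S3.
  rewrite (tri_subdivide S f A B D) in Hbad by auto.
  assert (e1 : ((A + B) / 2 - A) = ((B - A) / 2)) by field.
  assert (e2 : (B - (A + B) / 2) = ((B - A) / 2)) by field.
  assert (e3 : ((B + D) / 2 - B) = ((D - B) / 2)) by field.
  assert (e4 : (D - (B + D) / 2) = ((D - B) / 2)) by field.
  assert (e5 : ((D + A) / 2 - D) = ((A - D) / 2)) by field.
  assert (e6 : (A - (D + A) / 2) = ((A - D) / 2)) by field.
  assert (e7 : ((D + A) / 2 - (A + B) / 2) = ((D - B) / 2)) by field.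
  assert (e8 : ((A + B) / 2 - (B + D) / 2) = ((A - D) / 2)) by field.
  assert (e9 : ((B + D) / 2 - (D + A) / 2) = ((B - A) / 2)) by field.
  set (m1 := (A + B) / 2) in *. set (m2 := (B + D) / 2) in *. set (m3 := (D + A) / 2) in *.
  pose proof (Cmod_ge_0 (B - A)). pose proof (Cmod_ge_0 (D - B)). pose proof (Cmod_ge_0 (A - D)).
  assert (p1 : perim A m1 m3 = (p / 2)%R).
  { unfold perim in *. rewrite e1, e6, e7, !Cmod_half. lra. }
  assert (p2 : perim m1 B m2 = (p / 2)%R).
  { unfold perim in *. rewrite e2, e3, e8, !Cmod_half. lra. }
  assert (p3 : perim m3 m2 D = (p / 2)%R).
  { unfold perim in *. rewrite e9, e4, e5, !Cmod_half. lra. }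
  assert (p4 : perim m1 m2 m3 = (p / 2)%R).
  { unfold perim in *. rewrite (Cmod_sub_sym m2 m1), (Cmod_sub_sym m3 m2), (Cmod_sub_sym m1 m3).
    rewrite e7, e8, e9, !Cmod_half. lra. }
  unfold goursat_next. fold m1 m2 m3.
  destruct (Rlt_dec (e * perim A m1 m3 ^ 2) (Cmod (tri f A m1 m3))) as [b1|b1].
  { split.
    - repeat split; auto. now rewrite <- p1.
    - cbn [fst]. replace (A - A) with (RtoC 0) by ring. rewrite Cmod_0. unfold perim in Hp. lra. }
  destruct (Rlt_dec (e * perim m1 B m2 ^ 2) (Cmod (tri f m1 B m2))) as [b2|b2].
  { split.
    - repeat split; auto. now rewrite <- p2.
    - cbn [fst]. rewrite e1, Cmod_half. unfold perim in Hp. lra. }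
  destruct (Rlt_dec (e * perim m3 m2 D ^ 2) (Cmod (tri f m3 m2 D))) as [b3|b3].
  { split.
    - repeat split; auto. now rewrite <- p3.
    - cbn [fst]. rewrite Cmod_sub_sym, e6, Cmod_half. unfold perim in Hp. lra. }
  split.
  - repeat split; auto.
    pose proof (Cmod_triangle (tri f A m1 m3 + tri f m1 B m2 + tri f m3 m2 D) (tri f m1 m2 m3)).
    pose proof (Cmod_triangle (tri f A m1 m3 + tri f m1 B m2) (tri f m3 m2 D)).
    pose proof (Cmod_triangle (tri f A m1 m3) (tri f m1 B m2)).
    rewrite p1 in b1. rewrite p2 in b2. rewrite p3 in b3. nra.
  - cbn [fst]. rewrite e1, Cmod_half. unfold perim in Hp. lra.
Qed.

(** Completeness, one coordinate at a time: the tail of the increments contributes at most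
    [2 p / 2^n] to each, and the two coordinates give the 4. *)
Lemma C_geometric_limit (a : nat -> C) (p : R) :
  (0 <= p)%R -> (forall n, (Cmod (a (S n) - a n) <= p / 2 ^ n)%R) ->
  exists L : C, forall n, (Cmod (L - a n) <= 4 * (p / 2 ^ n))%R.
Proof.
  intros Hp Ha.
  assert (Hpow : forall n, (0 < 2 ^ n)%R) by (intros; apply pow_lt; lra).
  assert (Hq : forall n, (0 <= p / 2 ^ n)%R) by (intros; apply Rdiv_le_0_compat; auto).
  assert (Hs : forall n, (p / 2 ^ S n = p / 2 ^ n / 2)%R).
  { intros n. simpl. field. specialize (Hpow n). lra. }
  assert (Hm : forall n k, (Cmod (a (n + k)%nat - a n) <= 2 * (p / 2 ^ n) - 2 * (p / 2 ^ (n + k)))%R).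
  { intros n k. induction k as [|k IH].
    - rewrite Nat.add_0_r. replace (a n - a n) with (RtoC 0) by ring. rewrite Cmod_0. lra.
    - replace (n + S k)%nat with (S (n + k)) by lia. rewrite Hs.
      replace (a (S (n + k)) - a n)
        with ((a (S (n + k)) - a (n + k)%nat) + (a (n + k)%nat - a n)) by ring.
      eapply Rle_trans; [apply Cmod_triangle|]. specialize (Ha (n + k)%nat). lra. }
  assert (Hz : is_lim_seq (fun n => p / 2 ^ n)%R 0%R).
  { apply is_lim_seq_ext with (fun n => p * (/ 2) ^ n)%R.
    - intros n. rewrite pow_inv. reflexivity.
    - replace (Finite 0) with (Rbar_mult p 0) by (simpl; f_equal; ring).
      apply is_lim_seq_scal_l. apply is_lim_seq_geom. rewrite Rabs_right; lra. }
  assert (Hc : forall g : C -> R, (forall x y, (Rabs (g x - g y) <= Cmod (x - y))%R) ->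
    exists l : R, is_lim_seq (fun n => g (a n)) l).
  { intros g Hg. apply ex_lim_seq_cauchy_corr. intros eps.
    destruct (proj2 (is_lim_seq_spec _ _) Hz 
      (mkposreal (eps / 4) ltac:(destruct eps; simpl; lra))) as [N HN].
    exists N. cbn in HN.
    assert (K : forall n, (N <= n)%nat -> (Rabs (g (a n) - g (a N)) < eps / 2)%R).
    { intros n Hn. eapply Rle_lt_trans; [apply Hg|].
      replace n with (N + (n - N))%nat by lia. eapply Rle_lt_trans; [apply Hm|].
      specialize (HN N (Nat.le_refl N)). pose proof (Hq (N + (n - N))%nat).
      rewrite Rminus_0_r, Rabs_right in HN by (specialize (Hq N); lra). lra. }
    intros n m Hn Hm'. pose proof (K n Hn) as K1. pose proof (K m Hm') as K2.
    apply Rabs_def2 in K1; apply Rabs_def2 in K2; apply Rabs_def1; lra. }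
  destruct (Hc Re) as [x Hx].
  { intros z w. apply (re_le_Cmod (z - w)). }
  destruct (Hc Im) as [y Hy].
  { intros z w. apply (im_le_Cmod (z - w)). }
  exists (x, y). intros n.
  assert (K : forall (g : C -> R) (l : R), (forall x y, (Rabs (g x - g y) <= Cmod (x - y))%R) ->
    is_lim_seq (fun n => g (a n)) l -> (Rabs (l - g (a n)) <= 2 * (p / 2 ^ n))%R).
  { intros g l Hg Hl. apply Rabs_le_between'. split.
    - apply (is_lim_seq_le_loc (fun _ => (g (a n) - 2 * (p / 2 ^ n))%R) (fun m => g (a m))
        (g (a n) - 2 * (p / 2 ^ n))%R l); auto.
      + exists n. intros m Hm'. specialize (Hm n (m - n)%nat).
        replace (n + (m - n))%nat with m in Hm by lia.
        specialize (Hg (a m) (a n)). specialize (Hq m).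
        assert (Rabs (g (a m) - g (a n)) <= 2 * (p / 2 ^ n))%R by lra.
        apply Rabs_le_between in H. lra.
      + apply is_lim_seq_const.
    - apply (is_lim_seq_le_loc (fun m => g (a m)) (fun _ => (g (a n) + 2 * (p / 2 ^ n))%R)
        l (g (a n) + 2 * (p / 2 ^ n))%R); auto.
      + exists n. intros m Hm'. specialize (Hm n (m - n)%nat).
        replace (n + (m - n))%nat with m in Hm by lia.
        specialize (Hg (a m) (a n)). specialize (Hq m).
        assert (Rabs (g (a m) - g (a n)) <= 2 * (p / 2 ^ n))%R by lra.
        apply Rabs_le_between in H. lra.
      + apply is_lim_seq_const. }
  eapply Rle_trans; [apply Cmod_le_Re_Im|].
  specialize (K Re x (fun z w => re_le_Cmod (z - w)) Hx) as K1.
  specialize (K Im y (fun z w => im_le_Cmod (z - w)) Hy) as K2.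
  change (Re ((x, y) - a n)) with (x - Re (a n))%R.
  change (Im ((x, y) - a n)) with (y - Im (a n))%R. lra.
Qed.

(** An affine function has a quadratic primitive, whose increments cancel around a closed
    triangle. *)
Lemma tri_affine (f : C -> C) (L c d : C) (A B D : C) :
  (forall z, f z = c + (z - L) * d) -> tri f A B D = 0.
Proof.
  intros Hf.
  assert (DF : forall z, is_derive (fun z => c * z + (z - L) * (z - L) * (d / 2)) z (f z)).
  { intros z. eapply Cderive_eq.
    - apply Cderive_plus.
      + apply Cderive_mult; [apply Cderive_const | apply Cderive_id].
      + apply Cderive_mult; [|apply Cderive_const].
        apply Cderive_mult; apply Cderive_minus; apply Cderive_id || apply Cderive_const.
    - cbv beta. rewrite Hf. toC. field. }
  assert (DD : forall z, ex_derive f z).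
  { intros z. apply (ex_Cderive_ext_loc (fun z => c + (z - L) * d)).
    - apply locally_Cmod. exists 1%R. split; [lra|]. intros; now rewrite Hf.
    - apply ex_Cderive_plus; [apply ex_Cderive_const|]. apply ex_Cderive_mult; [|apply ex_Cderive_const].
      apply ex_Cderive_minus; [apply ex_Cderive_id | apply ex_Cderive_const]. }
  unfold tri. rewrite !(seg_FTC _ _ _ _ (fun t _ => DD _) (fun t _ => DF _)). toC. ring.
Qed.

Lemma goursat (S : C -> Prop) (f : C -> C) (A B D : C) :
  Cconvex S -> Cclosed S -> (forall z, S z -> ex_derive f z) ->
  S A -> S B -> S D -> tri f A B D = 0.
Proof.
  intros HS HSc Hf HA HB HD.
  apply NNPP. intros Hne. apply Cmod_gt_0 in Hne.
  set (p := perim A B D).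
  assert (Hp : (0 <= p)%R).
  { unfold p, perim. pose proof (Cmod_ge_0 (B - A)). pose proof (Cmod_ge_0 (D - B)).
    pose proof (Cmod_ge_0 (A - D)). lra. }
  (* Chosen so that the initial triangle is bad; the [1 +] keeps the denominator positive for a
     degenerate triangle. *)
  set (e := (Cmod (tri f A B D) / (2 * (1 + p ^ 2)))%R).
  assert (He : (0 < e)%R) by (apply Rdiv_lt_0_compat; nra).
  set (T := fix T n := match n with O => (A, B, D) | Datatypes.S n => goursat_next f e (T n) end).
  assert (HT : forall n, goursat_bad S f e (p / 2 ^ n) (T n)).
  { induction n as [|n IH].
    - simpl T. cbn. repeat split; auto; [unfold p; simpl; field|].
      unfold e. replace (p / 1)%R with p by field.
      apply Rle_lt_trans with (Cmod (tri f A B D) * (p ^ 2 / (2 * (1 + p ^ 2))))%R.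
      + right. simpl. field. nra.
      + rewrite <- (Rmult_1_r (Cmod _)) at 2. apply Rmult_lt_compat_l; [exact Hne|].
        apply Rlt_div_l; nra.
    - replace (p / 2 ^ Datatypes.S n)%R with (p / 2 ^ n / 2)%R
        by (simpl; field; apply pow_nonzero; lra).
      apply (goursat_next_bad S f e); auto. }
  destruct (C_geometric_limit (fun n => fst (fst (T n))) p Hp) as [L HL].
  { intros n. apply (goursat_next_bad S f e); auto. }
  assert (Hz : forall r : R, (0 < r)%R -> exists n, (6 * (p / 2 ^ n) < r)%R).
  { intros r Hr.
    assert (H2 : (Rabs (/ 2) < 1)%R) by (rewrite Rabs_right; lra).
    destruct (pow_lt_1_zero (/ 2) H2 (r / (6 * (1 + p)))%R) as [N HN].
    - apply Rdiv_lt_0_compat; lra.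
    - exists N. specialize (HN N (Nat.le_refl N)).
      rewrite Rabs_right, pow_inv in HN by (apply Rle_ge, pow_le; lra).
      apply Rlt_div_r in HN; [|lra].
      assert (0 < / 2 ^ N)%R by (apply Rinv_0_lt_compat, pow_lt; lra).
      unfold Rdiv. nra. }
  assert (SL : S L).
  { apply HSc. intros r Hr. destruct (Hz r Hr) as [n Hn].
    exists (fst (fst (T n))). split.
    - specialize (HT n). destruct (T n) as [[X Y] Z]. apply HT.
    - rewrite Cmod_sub_sym. eapply Rle_lt_trans; [apply HL|].
      assert (0 <= p / 2 ^ n)%R by (apply Rdiv_le_0_compat; [auto|apply pow_lt; lra]). lra. }
  destruct (Hf L SL) as [d Hd].
  (* Points of the sides are within [q] of the first vertex, which is within [4 q] of [L]. With the
     distance [5 q] and the factor 2 of [seg_bound], the constant [e / 10] produces exactly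
     [e q^2]. *)
  destruct (proj1 (is_derive_Cmod f L d) Hd (e / 10)%R ltac:(lra)) as [r [Hr Hloc]].
  destruct (Hz r Hr) as [n Hn]. specialize (HT n). specialize (HL n).
  set (q := (p / 2 ^ n)%R) in *.
  destruct (T n) as [[X Y] Z]. cbn [fst] in HL. destruct HT as (SX & SY & SZ & Hper & Hbad).
  assert (Hs : forall X Y, S X -> S Y -> seg_diff f X Y)
    by (intros U V HU HV t Ht; apply Hf, HS; auto).
  (* The affine part integrates to zero, so the remainder of first order carries the whole integral
     of the bad triangle. *)
  set (lin := fun z => f L + (z - L) * d).
  set (rem := fun z => f z - f L - (z - L) * d).
  assert (Hlin : forall U V, seg_diff lin U V).
  { intros U V t _. unfold lin.
    apply ex_Cderive_plus; [apply ex_Cderive_const|]. apply ex_Cderive_mult; [|apply ex_Cderive_const].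
    apply ex_Cderive_minus; [apply ex_Cderive_id | apply ex_Cderive_const]. }
  assert (Hrem : forall U V, S U -> S V -> seg_diff rem U V).
  { intros U V HU HV t Ht. unfold rem. apply ex_Cderive_minus.
    - apply ex_Cderive_minus; [now apply Hs | apply ex_Cderive_const].
    - apply ex_Cderive_mult; [|apply ex_Cderive_const].
      apply ex_Cderive_minus; [apply ex_Cderive_id | apply ex_Cderive_const]. }
  assert (Hsplit : forall U V, S U -> S V -> seg f U V = seg lin U V + seg rem U V).
  { intros U V HU HV. rewrite <- seg_plus by auto. apply seg_ext. intros. unfold lin, rem. ring. }
  assert (E : tri f X Y Z = tri lin X Y Z + tri rem X Y Z).
  { unfold tri. rewrite !Hsplit by auto. ring. }
  rewrite (tri_affine lin L (f L) d) in E by reflexivity. rewrite E, Cplus_0_l in Hbad.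
  unfold perim in Hper.
  pose proof (Cmod_ge_0 (Y - X)) as g1. pose proof (Cmod_ge_0 (Z - Y)) as g2.
  pose proof (Cmod_ge_0 (X - Z)) as g3.
  assert (near : forall U V : C, (Cmod (U - X) + Cmod (V - U) <= q)%R ->
     forall t, (0 <= t <= 1)%R -> (Cmod (path U V t - L) <= 5 * q)%R).
  { intros U V HUV t Ht.
    replace (path U V t - L) with ((U - X) + RtoC t * (V - U) + (X - L)) by (unfold path; ring).
    eapply Rle_trans; [apply Cmod_triangle|]. rewrite (Cmod_sub_sym X L).
    assert (Cmod (U - X + t * (V - U)) <= q)%R.
    { eapply Rle_trans; [apply Cmod_triangle|]. rewrite Cmod_mult, Cmod_R, Rabs_right by lra.
      pose proof (Cmod_ge_0 (V - U)). nra. }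
    lra. }
  assert (bnd : forall U V : C, S U -> S V -> (Cmod (U - X) + Cmod (V - U) <= q)%R ->
     (Cmod (seg rem U V) <= 2 * Cmod (V - U) * (e / 10 * (5 * q)))%R).
  { intros U V HU HV HUV. apply seg_bound; [auto|]. intros t Ht.
    pose proof (near U V HUV t Ht).
    assert (0 <= q)%R by (pose proof (Cmod_ge_0 (U - X)); pose proof (Cmod_ge_0 (V - U)); lra).
    eapply Rle_trans; [apply Hloc; lra|]. apply Rmult_le_compat_l; lra. }
  assert (B1 := bnd X Y SX SY). assert (B2 := bnd Y Z SY SZ). assert (B3 := bnd Z X SZ SX).
  replace (X - X) with (RtoC 0) in B1 by ring. rewrite Cmod_0 in B1.
  specialize (B1 ltac:(lra)). specialize (B2 ltac:(lra)).
  assert (HZ : (Cmod (Z - X) <= Cmod (Y - X) + Cmod (Z - Y))%R).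
  { replace (Z - X) with ((Y - X) + (Z - Y)) by ring. apply Cmod_triangle. }
  rewrite (Cmod_sub_sym Z X) in *. 
  specialize (bnd X Z SX SZ). replace (X - X) with (RtoC 0) in bnd by ring.
  rewrite Cmod_0, (Cmod_sub_sym Z X) in bnd. specialize (bnd ltac:(lra)).
  unfold tri in Hbad. rewrite (seg_rev rem X Z) in Hbad by auto.
  pose proof (Cmod_triangle (seg rem X Y + seg rem Y Z) (- seg rem X Z)) as T1.
  pose proof (Cmod_triangle (seg rem X Y) (seg rem Y Z)) as T2.
  rewrite Cmod_opp in T1.
  assert (2 * (Cmod (Y - X) + Cmod (Z - Y) + Cmod (X - Z)) * (e / 10 * (5 * q)) = e * q ^ 2)%R
    by (rewrite Hper; field).
  lra.
Qed.

Lemma Cconvex_disc (a : C) (r : R) : Cconvex (fun z => (Cmod (z - a) <= r)%R).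
Proof.
  intros A B HA HB t Ht.
  replace (path A B t - a) with (RtoC (1 - t) * (A - a) + RtoC t * (B - a))
    by (unfold path; rewrite RtoC_minus; ring).
  eapply Rle_trans; [apply Cmod_triangle|].
  rewrite !Cmod_mult, !Cmod_R, !Rabs_right by lra. nra.
Qed.

Lemma Cclosed_disc (a : C) (r : R) : Cclosed (fun z => (Cmod (z - a) <= r)%R).
Proof.
  intros z Hz.
  destruct (Rle_lt_dec (Cmod (z - a)) r) as [|Hlt]; [assumption|exfalso].
  destruct (Hz (Cmod (z - a) - r)%R ltac:(lra)) as [w [Hw1 Hw2]].
  assert (Cmod (z - a) <= Cmod (w - a) + Cmod (w - z))%R.
  { rewrite (Cmod_sub_sym w z). replace (z - a) with ((w - a) + (z - w)) by ring. apply Cmod_triangle. }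
  lra.
Qed.

(** The primitive is the integral along the segment from the center; Goursat on the triangle
    [a, z, y] turns its increment into the integral from [z] to [y]. *)
Lemma primitive_disc (f : C -> C) (a : C) (r : R) :
  (forall z, (Cmod (z - a) < r)%R -> ex_derive f z) ->
  exists F : C -> C, forall z, (Cmod (z - a) < r)%R -> is_derive F z (f z).
Proof.
  intros Hf. exists (seg f a). intros z Hz.
  apply is_derive_Cmod. intros e He.
  destruct (Cderive_continuous f z (Hf z Hz) (e / 2)%R ltac:(lra)) as [r1 [Hr1 Hc]].
  exists (Rmin r1 ((r - Cmod (z - a)) / 2))%R. split; [apply Rmin_pos; lra|].
  intros y Hy.
  assert (H1 : (Cmod (y - z) < r1)%R) by (eapply Rlt_le_trans; [exact Hy|apply Rmin_l]).
  assert (H2 : (Cmod (y - z) < (r - Cmod (z - a)) / 2)%R)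
    by (eapply Rlt_le_trans; [exact Hy|apply Rmin_r]).
  (* Goursat is stated for closed sets, so a closed disc of intermediate radius containing [z] and
     [y] is used. *)
  set (r' := ((r + Cmod (z - a)) / 2)%R). pose proof (Cmod_ge_0 (z - a)).
  assert (Hy' : (Cmod (y - a) <= r')%R).
  { replace (y - a) with ((y - z) + (z - a)) by ring.
    eapply Rle_trans; [apply Cmod_triangle|]. unfold r'. lra. }
  assert (Hf' : forall z, (Cmod (z - a) <= r')%R -> ex_derive f z)
    by (intros w Hw; apply Hf; unfold r' in Hw; lra).
  assert (Ha : (Cmod (a - a) <= r')%R).
  { replace (a - a) with (RtoC 0) by ring. rewrite Cmod_0. unfold r'. lra. }
  assert (Hz' : (Cmod (z - a) <= r')%R) by (unfold r'; lra).
  pose proof (Cconvex_disc a r') as Hconv.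
  pose proof (goursat _ f a z y Hconv (Cclosed_disc a r') Hf' Ha Hz' Hy') as G.
  assert (Hs : forall X Y, (Cmod (X - a) <= r')%R -> (Cmod (Y - a) <= r')%R -> seg_diff f X Y)
    by (intros U V HU HV t Ht; apply Hf', (Hconv U V); auto).
  unfold tri in G. rewrite (seg_rev f a y) in G by auto.
  assert (Hc0 : forall X Y, seg_diff (fun _ => - f z) X Y)
    by (intros X Y t _; apply ex_Cderive_const).
  assert (E : seg f a y - seg f a z - (y - z) * f z = seg (fun w => f w + - f z) z y).
  { rewrite seg_plus by auto.
    rewrite (seg_FTC (fun w => - f z * w) (fun _ => - f z)); auto.
    - replace (seg f z y) with (seg f a y - seg f a z); [toC; ring|].
      transitivity (seg f a y - seg f a z + (seg f a z + seg f z y + - seg f a y)); [rewrite G|]; ring.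
    - intros t _. eapply Cderive_eq; [apply Cderive_mult; [apply Cderive_const|apply Cderive_id]|].
      ringC. }
  rewrite E. replace (e * Cmod (y - z))%R with (2 * Cmod (y - z) * (e / 2))%R by field.
  apply seg_bound.
  - intros t Ht. apply ex_Cderive_plus; [now apply Hs|apply ex_Cderive_const].
  - intros t Ht. left. apply Hc. eapply Rle_lt_trans; [|exact H1].
    replace (path z y t - z) with (RtoC t * (y - z)) by (unfold path; ring).
    rewrite Cmod_mult, Cmod_R, Rabs_right by lra. pose proof (Cmod_ge_0 (y - z)). nra.
Qed.

(** * Cauchy's formula on a square *)


(** The quarter turns permute the sides of a square, so each fact about sides is proved once for a
    general [u]. *)
Definition unit4 (u : C) : Prop := u = 1 \/ u = Ci \/ u = - (1) \/ u = - Ci.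

(* The square of center [a] and half side [r]; [u] is the direction from the center
   to the middle of a side, which runs from [sqv a r u] to [sqv a r (Ci * u)]. *)
Definition sqv (a : C) (r : R) (u : C) : C := a + RtoC r * (u * (1 - Ci)).

Definition side (f : C -> C) (a : C) (r : R) (u : C) : C := seg f (sqv a r u) (sqv a r (Ci * u)).

Definition cont (f : C -> C) (a : C) (r : R) : C :=
  side f a r 1 + side f a r Ci + side f a r (- (1)) + side f a r (- Ci).

Definition bd (a : C) (r : R) (z : C) : Prop :=
  exists (u : C) (t : R), unit4 u /\ (0 <= t <= 1)%R /\ z = path (sqv a r u) (sqv a r (Ci * u)) t.

Lemma Ci2 : Ci * Ci = - (1).
Proof. unfold Ci, Cmult, Copp, RtoC; cbn. f_equal; ring. Qed.

Lemma unit4_conj (u : C) : unit4 u -> exists v : C, u * v = 1 /\ Cmod v = 1 /\ Cmod u = 1.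
Proof.
  assert (H1 : Cmod Ci = 1) by apply Cmod_Ci.
  intros [-> | [-> | [-> | ->]]].
  - exists 1. rewrite Cmod_1. repeat split; ring.
  - exists (- Ci). rewrite Cmod_opp, H1. repeat split; auto. transitivity (- (Ci * Ci)); [ring|].
    rewrite Ci2. ring.
  - exists (- (1)). rewrite Cmod_m1. repeat split; ring.
  - exists Ci. rewrite Cmod_opp, H1. repeat split; auto. transitivity (- (Ci * Ci)); [ring|].
    rewrite Ci2. ring.
Qed.

Lemma sq_path (a : C) (r : R) (u : C) (t : R) :
  path (sqv a r u) (sqv a r (Ci * u)) t = a + RtoC r * (u * (1 + Ci * RtoC (2 * t - 1))).
Proof.
  unfold path, sqv. rewrite RtoC_minus, RtoC_mult.
  transitivity (a + r * (u * ((1 - Ci) + t * (Ci - 1 - (Ci * Ci - Ci))))); [ring|].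
  rewrite Ci2. ring.
Qed.

(** The square lies between its inscribed and circumscribed circles; [2 r] is a rational bound for
    the outer radius [sqrt 2 r]. *)
Lemma bd_dist (a : C) (r : R) (z : C) :
  (0 <= r)%R -> bd a r z -> (r <= Cmod (z - a) <= 2 * r)%R.
Proof.
  intros Hr (u & t & Hu & Ht & ->). rewrite sq_path.
  destruct (unit4_conj u Hu) as (v & _ & _ & Hm).
  replace (a + r * (u * (1 + Ci * (2 * t - 1)%R)) - a)
    with (r * (u * (1 + Ci * (2 * t - 1)%R))) by ring.
  rewrite !Cmod_mult, Cmod_R, Hm, Rabs_right by lra.
  assert (1 <= Cmod (1 + Ci * (2 * t - 1)%R))%R.
  { eapply Rle_trans; [|apply re_le_Cmod]. unfold Ci, RtoC, Cmult, Cplus, Re; cbn.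
    match goal with |- (_ <= Rabs ?x)%R => replace x with 1%R by ring end.
    rewrite Rabs_R1. lra. }
  assert (Cmod (1 + Ci * (2 * t - 1)%R) <= 2)%R.
  { eapply Rle_trans; [apply Cmod_triangle|]. rewrite Cmod_mult, Cmod_Ci, Cmod_1, Cmod_R.
    assert (Rabs (2 * t - 1) <= 1)%R by (apply Rabs_le; lra). lra. }
  nra.
Qed.

Lemma bd_seg (f : C -> C) (a : C) (r : R) (u : C) :
  (forall z, bd a r z -> ex_derive f z) -> unit4 u -> seg_diff f (sqv a r u) (sqv a r (Ci * u)).
Proof. intros Hf Hu t Ht. apply Hf. exists u, t. auto. Qed.

Lemma unit4_1 : unit4 1. Proof. now left. Qed.
Lemma unit4_i : unit4 Ci. Proof. now right; left. Qed.
Lemma unit4_m1 : unit4 (- (1)). Proof. now right; right; left. Qed.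
Lemma unit4_mi : unit4 (- Ci). Proof. now right; right; right. Qed.
#[local] Hint Resolve unit4_1 unit4_i unit4_m1 unit4_mi bd_seg : core.

Lemma cont_ext (f g : C -> C) (a : C) (r : R) :
  (forall z, bd a r z -> f z = g z) -> cont f a r = cont g a r.
Proof.
  intros H.
  assert (K : forall u, unit4 u -> side f a r u = side g a r u).
  { intros u Hu. apply seg_ext. intros t Ht. apply H. exists u, t. auto. }
  unfold cont. rewrite !K by auto. reflexivity.
Qed.

Lemma cont_plus (f g : C -> C) (a : C) (r : R) :
  (forall z, bd a r z -> ex_derive f z) -> (forall z, bd a r z -> ex_derive g z) ->
  cont (fun z => f z + g z) a r = cont f a r + cont g a r.
Proof. intros Hf Hg. unfold cont, side. rewrite !seg_plus by auto. ring. Qed.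

Lemma cont_scal (c : C) (f : C -> C) (a : C) (r : R) :
  (forall z, bd a r z -> ex_derive f z) -> cont (fun z => c * f z) a r = c * cont f a r.
Proof. intros Hf. unfold cont, side. rewrite !seg_scal by auto. ring. Qed.

(** Four sides of length [2 r], each with the factor 2 of [seg_bound]. *)
Lemma cont_bound (f : C -> C) (a : C) (r M : R) :
  (0 <= r)%R -> (forall z, bd a r z -> ex_derive f z) ->
  (forall z, bd a r z -> (Cmod (f z) <= M)%R) -> (Cmod (cont f a r) <= 16 * r * M)%R.
Proof.
  intros Hr Hf HM.
  assert (K : forall u, unit4 u -> (Cmod (side f a r u) <= 4 * r * M)%R).
  { intros u Hu. eapply Rle_trans; [apply (seg_bound _ _ _ M); auto|].
    - intros t Ht. apply HM. exists u, t; auto.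
    - destruct (unit4_conj u Hu) as (v & _ & _ & Hm).
      replace (sqv a r (Ci * u) - sqv a r u) with (r * (u * (2 * Ci))).
      + rewrite !Cmod_mult, Cmod_Ci, Hm, !Cmod_R, !Rabs_right by lra. lra.
      + unfold sqv. transitivity (r * (u * (Ci - Ci * Ci - 1 + Ci))); [|ring].
        rewrite Ci2. ring. }
  unfold cont.
  pose proof (K 1 ltac:(auto)). pose proof (K Ci ltac:(auto)).
  pose proof (K (- (1)) ltac:(auto)). pose proof (K (- Ci) ltac:(auto)).
  pose proof (Cmod_triangle (side f a r 1 + side f a r Ci + side f a r (- (1))) (side f a r (- Ci))).
  pose proof (Cmod_triangle (side f a r 1 + side f a r Ci) (side f a r (- (1)))).
  pose proof (Cmod_triangle (side f a r 1) (side f a r Ci)).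
  lra.
Qed.

Lemma seg_diff_bounded (f : C -> C) (A B : C) :
  seg_diff f A B -> exists M : R, forall t : R, (0 <= t <= 1)%R -> (Cmod (f (path A B t)) <= M)%R.
Proof.
  intros Hf.
  assert (K : forall g : R -> R, (forall t : R, (0 <= t <= 1)%R -> exists d : R, is_derive g t d) ->
    exists M : R, forall t : R, (0 <= t <= 1)%R -> (Rabs (g t) <= M)%R).
  { intros g Hg. destruct (bounded_continuity g 0 1) as [M HM].
    - intros t Ht. destruct (Hg t Ht) as [d Hd].
      apply (@ex_derive_continuous R_AbsRing R_NormedModule). now exists d.
    - exists M. intros t Ht. left. now apply HM. }
  destruct (K (fun t => Re (f (path A B t)))) as [M1 H1].
  { intros t Ht. destruct (Hf t Ht) as [d Hd].
    destruct (is_derive_path_Re_Im _ _ _ _ _ Hd) as [D _]. exact (ex_intro _ _ D). }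
  destruct (K (fun t => Im (f (path A B t)))) as [M2 H2].
  { intros t Ht. destruct (Hf t Ht) as [d Hd].
    destruct (is_derive_path_Re_Im _ _ _ _ _ Hd) as [_ D]. exact (ex_intro _ _ D). }
  exists (M1 + M2)%R. intros t Ht. eapply Rle_trans; [apply Cmod_le_Re_Im|].
  apply Rplus_le_compat; auto.
Qed.

Lemma bd_bounded (f : C -> C) (a : C) (r : R) :
  (forall z, bd a r z -> ex_derive f z) ->
  exists M : R, (0 <= M)%R /\ forall z, bd a r z -> (Cmod (f z) <= M)%R.
Proof.
  intros Hf.
  assert (K : forall u, unit4 u -> exists M : R, forall t : R, (0 <= t <= 1)%R ->
    (Cmod (f (path (sqv a r u) (sqv a r (Ci * u)) t)) <= M)%R).
  { intros u Hu. apply seg_diff_bounded; auto. }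
  destruct (K 1) as [M1 H1]; auto. destruct (K Ci) as [M2 H2]; auto.
  destruct (K (- (1))) as [M3 H3]; auto. destruct (K (- Ci)) as [M4 H4]; auto.
  exists (Rmax 0 (Rmax (Rmax M1 M2) (Rmax M3 M4))). split; [apply Rmax_l|].
  intros z (u & t & Hu & Ht & ->). eapply Rle_trans; [|apply Rmax_r].
  destruct Hu as [-> | [-> | [-> | ->]]].
  - eapply Rle_trans; [now apply H1|]. eapply Rle_trans; [|apply Rmax_l]. apply Rmax_l.
  - eapply Rle_trans; [now apply H2|]. eapply Rle_trans; [|apply Rmax_l]. apply Rmax_r.
  - eapply Rle_trans; [now apply H3|]. eapply Rle_trans; [|apply Rmax_r]. apply Rmax_l.
  - eapply Rle_trans; [now apply H4|]. eapply Rle_trans; [|apply Rmax_r]. apply Rmax_r.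
Qed.

(* The domain of the trapezoid between parallel sides of two nested squares. *)
Definition half_disc (a w v : C) (R0 d : R) (z : C) : Prop :=
  (Cmod (z - a) <= R0)%R /\ (d <= Re ((z - w) * v))%R.

Lemma Cconvex_half_disc (a w v : C) (R0 d : R) : Cconvex (half_disc a w v R0 d).
Proof.
  intros A B [HA1 HA2] [HB1 HB2] t Ht. split.
  - now apply (Cconvex_disc a R0 A B).
  - replace ((path A B t - w) * v)
      with (RtoC (1 - t) * ((A - w) * v) + RtoC t * ((B - w) * v))
      by (unfold path; rewrite RtoC_minus; ring).
    assert (E : forall (x y : R) (p q : C), Re (RtoC x * p + RtoC y * q) = (x * Re p + y * Re q)%R)
      by (intros x y [p1 p2] [q1 q2]; unfold RtoC, Cmult, Cplus, Re; cbn; ring).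
    rewrite E. nra.
Qed.

Lemma Cclosed_half_disc (a w v : C) (R0 d : R) : Cclosed (half_disc a w v R0 d).
Proof.
  intros z Hz. split.
  - apply (Cclosed_disc a R0). intros e He. destruct (Hz e He) as [y [[Hy _] Hd]]. now exists y.
  - destruct (Rle_lt_dec d (Re ((z - w) * v))) as [|Hlt]; [assumption|exfalso].
    pose proof (Cmod_ge_0 v) as Hv.
    destruct (Hz ((d - Re ((z - w) * v)) / (1 + Cmod v))%R) as [y [[_ Hy] Hd]].
    { apply Rdiv_lt_0_compat; lra. }
    apply Rlt_div_r in Hd; [|lra].
    assert (Re ((y - w) * v) = Re ((z - w) * v) + Re ((y - z) * v))%R.
    { replace ((y - w) * v) with ((z - w) * v + (y - z) * v) by ring. reflexivity. }
    pose proof (re_le_Cmod ((y - z) * v)) as H1. rewrite Cmod_mult in H1.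
    apply Rabs_le_between in H1. pose proof (Cmod_ge_0 (y - z)). nra.
Qed.

(** With [v] the inverse of [u], the half plane [d <= Re ((z - w) * v)] begins at the inner side and
    excludes [w]. The condition on [r] puts the outer corners into it, so the trapezoid lies in a
    closed convex set where [f] is differentiable, and a diagonal cuts it into two Goursat
    triangles. *)
Lemma trapezoid (f : C -> C) (a w : C) (r d : R) (u : C) :
  (0 < d)%R -> (Cmod (w - a) + d <= r)%R -> unit4 u ->
  (forall z, (Cmod (z - a) <= 2 * r)%R -> z <> w -> ex_derive f z) ->
  side f a r u = side f w d u
    + seg f (sqv w d (Ci * u)) (sqv a r (Ci * u)) - seg f (sqv w d u) (sqv a r u).
Proof.
  intros Hd Hr Hu Hf. destruct (unit4_conj u Hu) as (v & Huv & Hv & Hum).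
  pose proof (Cmod_ge_0 (w - a)) as Hwa.
  set (S := half_disc a w v (2 * r) d).
  assert (HS : Cconvex S) by apply Cconvex_half_disc.
  assert (HSc : Cclosed S) by apply Cclosed_half_disc.
  assert (HfS : forall z, S z -> ex_derive f z).
  { intros z [H1 H2]. apply Hf; auto. intros ->.
    replace ((w - w) * v) with (RtoC 0) in H2 by ring. unfold RtoC, Re in H2; cbn in H2. lra. }
  assert (H1i : (Cmod (1 - Ci) <= 2)%R).
  { eapply Rle_trans; [apply Cmod_triangle|]. rewrite Cmod_opp, Cmod_1, Cmod_Ci. lra. }
  assert (corner : forall s : C, s = 1 - Ci \/ s = 1 + Ci ->
    S (a + RtoC r * (u * s)) /\ S (w + RtoC d * (u * s))).
  { intros s Hs.
    assert (Hsm : (Cmod s <= 2)%R).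
    { destruct Hs as [-> | ->]; auto.
      eapply Rle_trans; [apply Cmod_triangle|]. rewrite Cmod_1, Cmod_Ci. lra. }
    assert (Hsr : forall x : R, Re (RtoC x * s) = x).
    { intros x. destruct Hs as [-> | ->]; unfold RtoC, Ci, Cmult, Cplus, Cminus, Copp, Re; cbn; ring. }
    split; split.
    - replace (a + r * (u * s) - a) with (r * (u * s)) by ring.
      rewrite !Cmod_mult, Cmod_R, Hum, Rabs_right by lra. nra.
    - replace ((a + r * (u * s) - w) * v) with ((u * v) * (r * s) + (a - w) * v) by ring.
      rewrite Huv, Cmult_1_l.
      change (Re (?x + ?y)) with (Re x + Re y)%R. rewrite Hsr.
      pose proof (re_le_Cmod ((a - w) * v)) as H. rewrite Cmod_mult, Hv, Cmod_sub_sym in H.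
      apply Rabs_le_between in H. lra.
    - replace (w + d * (u * s) - a) with ((w - a) + d * (u * s)) by ring.
      eapply Rle_trans; [apply Cmod_triangle|].
      rewrite !Cmod_mult, Cmod_R, Hum, Rabs_right by lra. nra.
    - replace ((w + d * (u * s) - w) * v) with ((u * v) * (d * s)) by ring.
      rewrite Huv, Cmult_1_l, Hsr. lra. }
  assert (Hi : forall c x, sqv c x (Ci * u) = c + RtoC x * (u * (1 + Ci))).
  { intros c x. unfold sqv. transitivity (c + x * (u * (Ci - Ci * Ci))); [ring|]. rewrite Ci2. ring. }
  destruct (corner (1 - Ci) (or_introl eq_refl)) as [SA Sa].
  destruct (corner (1 + Ci) (or_intror eq_refl)) as [SB Sb].
  rewrite <- Hi in SB, Sb. fold (sqv a r u) in SA. fold (sqv w d u) in Sa.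
  assert (Hs : forall X Y, S X -> S Y -> seg_diff f X Y)
    by (intros U V HU HV t Ht; apply HfS, HS; auto).
  unfold side. revert SA SB Sa Sb.
  generalize (sqv a r u) (sqv a r (Ci * u)) (sqv w d u) (sqv w d (Ci * u)).
  intros A B a' b SA SB Sa Sb.
  pose proof (goursat S f A B b HS HSc HfS SA SB Sb) as G1.
  pose proof (goursat S f A b a' HS HSc HfS SA Sb Sa) as G2.
  unfold tri in G1, G2.
  rewrite (seg_rev f b B), (seg_rev f A b) in G1 by auto.
  rewrite (seg_rev f a' b) in G2 by auto.
  transitivity (seg f a' b + seg f b B - seg f a' A +
    ((seg f A B + - seg f b B + - seg f A b) + (seg f A b + - seg f a' b + seg f a' A))).
  - ring.
  - rewrite G1, G2. ring.
Qed.

(** Each segment joining corresponding corners borders two of the four trapezoids and occurs with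
    opposite signs. *)
Lemma cont_deform (f : C -> C) (a w : C) (r d : R) :
  (0 < d)%R -> (Cmod (w - a) + d <= r)%R ->
  (forall z, (Cmod (z - a) <= 2 * r)%R -> z <> w -> ex_derive f z) ->
  cont f a r = cont f w d.
Proof.
  intros Hd Hr Hf. unfold cont.
  rewrite (trapezoid f a w r d 1), (trapezoid f a w r d Ci), (trapezoid f a w r d (- (1))),
    (trapezoid f a w r d (- Ci)) by auto.
  replace (Ci * 1) with Ci by ring. replace (Ci * Ci) with (- (1)) by (symmetry; apply Ci2).
  replace (Ci * - (1)) with (- Ci) by ring.
  replace (Ci * - Ci) with (RtoC 1) by (transitivity (- (Ci * Ci)); [rewrite Ci2|]; ring).
  ring.
Qed.

(** The number [2 pi i], left as an integral; only its being nonzero is established. *)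
Definition kappa : C := cont (fun z => / z) 0 1.

Lemma seg_affine (f : C -> C) (w c A B : C) :
  seg f (w + c * A) (w + c * B) = c * seg (fun z => f (w + c * z)) A B.
Proof.
  unfold seg.
  assert (E : forall t, path (w + c * A) (w + c * B) t = w + c * path A B t)
    by (intros t; unfold path; ring).
  rewrite (RInt_ext (fun t => Re (f (path (w + c * A) (w + c * B) t)))
    (fun t => Re (f (w + c * path A B t)))) by (intros t _; now rewrite E).
  rewrite (RInt_ext (fun t => Im (f (path (w + c * A) (w + c * B) t)))
    (fun t => Im (f (w + c * path A B t)))) by (intros t _; now rewrite E).
  ring.
Qed.

Lemma bd01_neq0 (z : C) : bd 0 1 z -> z <> 0.
Proof.
  intros Hz ->. apply bd_dist in Hz; [|lra].
  replace (0 - 0) with (RtoC 0) in Hz by ring. rewrite Cmod_0 in Hz. lra.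
Qed.

Lemma ex_Cderive_inv (f : C -> C) (z : C) :
  ex_derive f z -> f z <> 0 -> ex_derive (fun w => / f w) z.
Proof. intros [d Hd] H. eexists. apply Cderive_inv; eassumption. Qed.

(** The form [dz / (z - w)] is invariant under homotheties centered at [w]. *)
Lemma cont_inv_scale (w : C) (d : R) : (0 < d)%R -> cont (fun z => / (z - w)) w d = kappa.
Proof.
  intros Hd.
  assert (Hd0 : RtoC d <> 0) by (intros H; apply RtoC_inj in H; lra).
  assert (K : forall u, unit4 u -> side (fun z => / (z - w)) w d u = side (fun z => / z) 0 1 u).
  { intros u Hu. unfold side.
    replace (sqv w d u) with (w + RtoC d * sqv 0 1 u) by (unfold sqv; ring).
    replace (sqv w d (Ci * u)) with (w + RtoC d * sqv 0 1 (Ci * u)) by (unfold sqv; ring).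
    assert (Hne : forall t : R, (0 <= t <= 1)%R -> path (sqv 0 1 u) (sqv 0 1 (Ci * u)) t <> 0).
    { intros t Ht. apply bd01_neq0. exists u, t; auto. }
    rewrite seg_affine.
    rewrite (seg_ext _ (fun z => / RtoC d * / z)).
    - rewrite seg_scal.
      + change (seg (fun z => / z)) with (seg Cinv). fieldC. auto.
      + intros t Ht. apply ex_Cderive_inv; [apply ex_Cderive_id | now apply Hne].
    - intros t Ht. field. repeat split; auto.
      replace (w + d * path (sqv 0 1 u) (sqv 0 1 (Ci * u)) t - w)
        with (d * path (sqv 0 1 u) (sqv 0 1 (Ci * u)) t) by ring.
      apply Cmult_neq_0; auto. }
  unfold kappa, cont. now rewrite !K by auto.
Qed.

(** The form [dz / z] is invariant under quarter turns, so the four sides contribute equally, and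
    one side has a positive imaginary part. *)
Lemma kappa_neq0 : kappa <> 0.
Proof.
  assert (K : forall u, unit4 u -> side (fun z => / z) 0 1 u = side (fun z => / z) 0 1 1).
  { intros u Hu. destruct (unit4_conj u Hu) as (v & Huv & Hv & Hum).
    assert (Hu0 : u <> 0) by (apply Cmod_gt_0; lra).
    unfold side.
    replace (sqv 0 1 u) with (0 + u * sqv 0 1 1) by (unfold sqv; ring).
    replace (sqv 0 1 (Ci * u)) with (0 + u * sqv 0 1 (Ci * 1)) by (unfold sqv; ring).
    assert (Hne : forall t : R, (0 <= t <= 1)%R -> path (sqv 0 1 1) (sqv 0 1 (Ci * 1)) t <> 0).
    { intros t Ht. apply bd01_neq0. exists 1, t; auto. }
    rewrite seg_affine. rewrite (seg_ext _ (fun z => / u * / z)).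
    - rewrite seg_scal.
      + change (seg (fun z => / z)) with (seg Cinv). fieldC. auto.
      + intros t Ht. apply ex_Cderive_inv; [apply ex_Cderive_id | now apply Hne].
    - intros t Ht. rewrite Cplus_0_l. field. auto. }
  unfold kappa, cont. rewrite (K Ci), (K (- (1))), (K (- Ci)) by auto.
  intros H0.
  assert (H1 : side (fun z => / z) 0 1 1 = 0).
  { replace (side (fun z => / z) 0 1 1) with ((side (fun z : C => / z) 0 1 1 +
      side (fun z : C => / z) 0 1 1 + side (fun z : C => / z) 0 1 1 +
      side (fun z : C => / z) 0 1 1) / 4) by field.
    rewrite H0. field. }
  clear H0. unfold side, seg in H1.
  set (g := fun t => Re (/ path (sqv 0 1 1) (sqv 0 1 (Ci * 1)) t)) in H1.
  replace (sqv 0 1 (Ci * 1) - sqv 0 1 1) with (2 * Ci) in H1.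
  2:{ unfold sqv. transitivity (2 * Ci - (Ci * Ci + 1)); [|ring]. rewrite Ci2. ring. }
  apply (f_equal Im) in H1. unfold Ci, RtoC, Cmult, Im in H1; cbn [fst snd] in H1.
  (* On this side the point is [1 + i s] with [|s| <= 1], and its inverse has real part
     [1 / (1 + s^2) >= 1 / 2]. *)
  assert (Hg : (/ 2 <= RInt g 0 1)%R).
  { replace (/ 2)%R with (RInt (fun _ => / 2)%R 0 1).
    - apply RInt_le; [lra | apply (@ex_RInt_const R_NormedModule) | |].
      + assert (Hd : seg_diff (fun z => / z) (sqv 0 1 1) (sqv 0 1 (Ci * 1))).
        { intros t Ht. apply ex_Cderive_inv; [apply ex_Cderive_id|].
          apply bd01_neq0. exists 1, t. auto. }
        destruct (ex_RInt_seg _ _ _ 0 1 Hd ltac:(lra) ltac:(lra)) as [D _]. exact D.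
      + intros t Ht. unfold g. rewrite sq_path.
        unfold Cinv, Re, Ci, RtoC, Cmult, Cplus; cbn [fst snd].
        apply Rle_div_r; [nra|]. nra.
    - rewrite (@RInt_const R_CompleteNormedModule). unfold scal; cbn; unfold mult; cbn. field. }
  lra.
Qed.

(** After shrinking the square to [w], the integrand splits into [f w / (z - w)], which gives
    [kappa], and a difference quotient. Continuity at [w] makes the integral of the latter smaller
    than any supposed error. *)
Lemma cauchy_formula (f : C -> C) (a w : C) (r : R) :
  (forall z, (Cmod (z - a) <= 2 * r)%R -> ex_derive f z) -> (Cmod (w - a) < r)%R ->
  cont (fun z => f z / (z - w)) a r = f w * kappa.
Proof.
  intros Hf Hw. pose proof (Cmod_ge_0 (w - a)) as Hwa.
  apply NNPP. intros Hne.
  assert (Hpos : (0 < Cmod (cont (fun z => f z / (z - w))%C a r - f w * kappa)%C)%R).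
  { apply Cmod_gt_0. intros H. apply Hne.
    replace (cont (fun z => f z / (z - w)) a r)
      with (cont (fun z => f z / (z - w)) a r - f w * kappa + f w * kappa) by ring.
    rewrite H. ring. }
  set (e := Cmod (cont (fun z => f z / (z - w)) a r - f w * kappa)) in *.
  (* The 32 is twice the 16 of [cont_bound], so the error [e] turns out to be at most [e / 2]. *)
  destruct (Cderive_continuous f w (Hf w ltac:(lra)) (e / 32)%R ltac:(lra)) as [r1 [Hr1 Hc]].
  (* The first bound allows the deformation. The second keeps the small square, of outer radius
     below [2 d], inside the disc of radius [r1]. *)
  set (d := Rmin (r - Cmod (w - a)) (r1 / 3)%R).
  assert (Hd : (0 < d)%R) by (apply Rmin_pos; lra).
  assert (Hd1 : (d <= r - Cmod (w - a))%R) by apply Rmin_l.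
  assert (Hd2 : (d <= r1 / 3)%R) by apply Rmin_r.
  assert (Hin : forall z, bd w d z -> (Cmod (z - a) <= 2 * r)%R /\ z - w <> 0).
  { intros z Hz. apply bd_dist in Hz; [|lra]. split.
    - replace (z - a) with ((z - w) + (w - a)) by ring.
      eapply Rle_trans; [apply Cmod_triangle|]. lra.
    - apply Cmod_gt_0. lra. }
  assert (Hx : forall z, z <> w -> z - w <> 0).
  { intros z Hz Hc0. apply Hz. replace z with (z - w + w) by ring. rewrite Hc0. ring. }
  assert (E : cont (fun z => f z / (z - w)) a r - f w * kappa =
    cont (fun z => (f z - f w) / (z - w)) w d).
  { rewrite (cont_deform _ a w r d); auto; [|lra|].
    - rewrite (cont_ext (fun z => f z / (z - w)) (fun z => (f z - f w) / (z - w) + f w * / (z - w))).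
      + rewrite cont_plus, cont_scal, cont_inv_scale; auto.
        * toC. ring.
        * intros z Hz. destruct (Hin z Hz). apply ex_Cderive_inv; auto.
          apply ex_Cderive_minus; [apply ex_Cderive_id | apply ex_Cderive_const].
        * intros z Hz. destruct (Hin z Hz). apply ex_Cderive_div; auto.
          -- apply ex_Cderive_minus; [now apply Hf | apply ex_Cderive_const].
          -- apply ex_Cderive_minus; [apply ex_Cderive_id | apply ex_Cderive_const].
        * intros z Hz. destruct (Hin z Hz). apply ex_Cderive_mult; [apply ex_Cderive_const|].
          apply ex_Cderive_inv; auto.
          apply ex_Cderive_minus; [apply ex_Cderive_id | apply ex_Cderive_const].
      + intros z Hz. destruct (Hin z Hz). field. auto.
    - intros z Hz Hzw. apply ex_Cderive_div; auto.
      apply ex_Cderive_minus; [apply ex_Cderive_id | apply ex_Cderive_const]. }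
  assert (B : (e <= 16 * d * ((e / 32) / d))%R).
  { unfold e at 1. rewrite E. apply cont_bound; [lra| |].
    - intros z Hz. destruct (Hin z Hz). apply ex_Cderive_div; auto.
      + apply ex_Cderive_minus; [now apply Hf | apply ex_Cderive_const].
      + apply ex_Cderive_minus; [apply ex_Cderive_id | apply ex_Cderive_const].
    - intros z Hz. destruct (Hin z Hz) as [_ Hzw]. apply bd_dist in Hz; [|lra].
      rewrite Cmod_div by auto. apply Rle_div_l; [lra|].
      assert (Cmod (f z - f w) < e / 32)%R by (apply Hc; lra).
      apply Rle_trans with (e / 32)%R; [lra|].
      rewrite <- (Rmult_1_r (e / 32)) at 1. unfold Rdiv at 2. rewrite Rmult_assoc.
      apply Rmult_le_compat_l; [lra|].
      apply Rle_trans with (/ d * d)%R; [right; field; lra|].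
      apply Rmult_le_compat_l; [left; apply Rinv_0_lt_compat; lra | lra]. }
  replace (16 * d * (e / 32 / d))%R with (e / 2)%R in B by (field; lra). lra.
Qed.

(** * Cauchy transforms *)


Definition cauchy_transform (a : C) (r : R) (phi : C -> C) (w : C) : C :=
  cont (fun z => phi z / (z - w)) a r.

(** Regularity is required on the contour alone, so that dividing by [z - w0] with [w0] inside
    yields a density again. *)
Definition density (a : C) (r : R) (phi : C -> C) : Prop :=
  forall z, bd a r z -> ex_derive phi z.

Lemma Cminus_neq0 (z w : C) : z <> w -> z - w <> 0.
Proof. intros H H0. apply H. replace z with (z - w + w) by ring. rewrite H0. ring. Qed.

Lemma bd_away (a w z : C) (r : R) :
  (Cmod (w - a) < r)%R -> bd a r z -> (r - Cmod (w - a) <= Cmod (z - w))%R /\ z - w <> 0.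
Proof.
  intros Hw Hz. pose proof (Cmod_ge_0 (w - a)). apply bd_dist in Hz; [|lra].
  assert (H1 : (r - Cmod (w - a) <= Cmod (z - w))%R).
  { assert (Cmod (z - a) <= Cmod (z - w) + Cmod (w - a))%R; [|lra].
    replace (z - a) with ((z - w) + (w - a)) by ring. apply Cmod_triangle. }
  split; [exact H1|]. apply Cmod_gt_0. lra.
Qed.

Lemma ex_Cderive_shift (w z : C) : ex_derive (fun z => z - w) z.
Proof. apply ex_Cderive_minus; [apply ex_Cderive_id | apply ex_Cderive_const]. Qed.

Lemma density_div (a w : C) (r : R) (phi : C -> C) :
  (Cmod (w - a) < r)%R -> density a r phi -> density a r (fun z => phi z / (z - w)).
Proof.
  intros Hw Hphi z Hz. apply ex_Cderive_div; [now apply Hphi | apply ex_Cderive_shift |].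
  now apply (bd_away a w z r).
Qed.

(** Integrates the identity [1 / (z - w) = 1 / (z - w0) + (w - w0) / ((z - w0) (z - w))] against
    [phi]. *)
Lemma cauchy_transform_factor (a w w0 : C) (r : R) (phi : C -> C) :
  density a r phi -> (Cmod (w - a) < r)%R -> (Cmod (w0 - a) < r)%R ->
  cauchy_transform a r phi w = cauchy_transform a r phi w0 +
    (w - w0) * cauchy_transform a r (fun z => phi z / (z - w0)) w.
Proof.
  intros Hphi Hw Hw0. unfold cauchy_transform.
  rewrite <- cont_scal, <- cont_plus.
  - apply cont_ext. intros z Hz.
    destruct (bd_away a w z r Hw Hz) as [_ H1]. destruct (bd_away a w0 z r Hw0 Hz) as [_ H2].
    field. auto.
  - now apply density_div.
  - intros z Hz. apply ex_Cderive_mult; [apply ex_Cderive_const|].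
    now apply (density_div a w r (fun z => phi z / (z - w0)) Hw (density_div a w0 r phi Hw0 Hphi)).
  - now apply (density_div a w r (fun z => phi z / (z - w0)) Hw (density_div a w0 r phi Hw0 Hphi)).
Qed.

Lemma cauchy_transform_bound (a w : C) (r d M : R) (phi : C -> C) :
  density a r phi -> (forall z, bd a r z -> (Cmod (phi z) <= M)%R) -> (0 <= M)%R ->
  (0 < d)%R -> (Cmod (w - a) <= r - d)%R ->
  (Cmod (cauchy_transform a r phi w) <= 16 * r * (M / d))%R.
Proof.
  intros Hphi HM HM0 Hd Hw. pose proof (Cmod_ge_0 (w - a)).
  apply cont_bound; [lra | apply density_div; auto; lra |].
  intros z Hz. destruct (bd_away a w z r ltac:(lra) Hz) as [H1 H2].
  rewrite Cmod_div by auto. apply Rle_div_l; [lra|].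
  specialize (HM z Hz).
  apply Rle_trans with (M / d * d)%R; [replace (M / d * d)%R with M by (field; lra); exact HM|].
  apply Rmult_le_compat_l; [apply Rdiv_le_0_compat; lra | lra].
Qed.

(* The remainder in the expansion of order two at [w0] is itself a Cauchy transform. *)
Lemma cauchy_transform_derive (a w0 : C) (r : R) (phi : C -> C) :
  density a r phi -> (Cmod (w0 - a) < r)%R ->
  is_derive (cauchy_transform a r phi) w0
    (cauchy_transform a r (fun z => phi z / (z - w0)) w0).
Proof.
  intros Hphi Hw0. pose proof (Cmod_ge_0 (w0 - a)) as H0.
  set (phi1 := fun z => phi z / (z - w0)). set (phi2 := fun z => phi1 z / (z - w0)).
  assert (D1 : density a r phi1) by now apply density_div.
  assert (D2 : density a r phi2) by now apply density_div.
  destruct (bd_bounded phi2 a r D2) as [M [HM0 HM]].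
  set (d := ((r - Cmod (w0 - a)) / 2)%R). assert (Hd : (0 < d)%R) by (unfold d; lra).
  set (N := (16 * r * (M / d))%R).
  assert (HN : (0 <= N)%R).
  { unfold N. apply Rmult_le_pos; [lra|]. apply Rdiv_le_0_compat; lra. }
  apply is_derive_Cmod. intros e He.
  exists (Rmin d (e / (1 + N))). split; [apply Rmin_pos; auto; apply Rdiv_lt_0_compat; lra|].
  intros w Hw.
  assert (H1 : (Cmod (w - w0) < d)%R) by (eapply Rlt_le_trans; [exact Hw|apply Rmin_l]).
  assert (H2 : (Cmod (w - w0) < e / (1 + N))%R) by (eapply Rlt_le_trans; [exact Hw|apply Rmin_r]).
  assert (Hwa : (Cmod (w - a) <= r - d)%R).
  { replace (w - a) with ((w - w0) + (w0 - a)) by ring.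
    eapply Rle_trans; [apply Cmod_triangle|]. unfold d in *. lra. }
  rewrite (cauchy_transform_factor a w w0 r phi) by (auto; lra).
  fold phi1. rewrite (cauchy_transform_factor a w w0 r phi1) by (auto; lra). fold phi2.
  match goal with |- (Cmod ?x <= _)%R =>
    replace x with ((w - w0) * ((w - w0) * cauchy_transform a r phi2 w)) by (toC; ring) end.
  rewrite !Cmod_mult, (Rmult_comm e). apply Rmult_le_compat_l; [apply Cmod_ge_0|].
  apply Rlt_div_r in H2; [|lra].
  assert (Cmod (cauchy_transform a r phi2 w) <= N)%R by (apply cauchy_transform_bound; auto).
  pose proof (Cmod_ge_0 (w - w0)). nra.
Qed.

(** The second bounded quantity is the derivative of the transform at [w]. Both bounds are uniform
    near [w0], as the estimate of a second order remainder requires. *)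
Lemma cauchy_transform_derive_bound (a w0 : C) (r : R) (phi : C -> C) :
  density a r phi -> (Cmod (w0 - a) < r)%R ->
  exists d N : R, (0 < d)%R /\ (0 <= N)%R /\ forall w, (Cmod (w - w0) < d)%R ->
    (Cmod (w - a) < r)%R /\ (Cmod (cauchy_transform a r phi w) <= N)%R /\
    (Cmod (cauchy_transform a r (fun z => phi z / (z - w))%C w) <= N)%R.
Proof.
  intros Hphi Hw0. pose proof (Cmod_ge_0 (w0 - a)) as H0.
  destruct (bd_bounded phi a r Hphi) as [M [HM0 HM]].
  set (d := ((r - Cmod (w0 - a)) / 2)%R). assert (Hd : (0 < d)%R) by (unfold d; lra).
  assert (HMd : (0 <= M / d)%R) by (apply Rdiv_le_0_compat; lra).
  assert (HMdd : (0 <= M / d / d)%R) by (apply Rdiv_le_0_compat; lra).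
  exists d, (16 * r * (M / d) + 16 * r * (M / d / d))%R.
  split; [exact Hd|]. split; [nra|].
  intros w Hw.
  assert (Hwa : (Cmod (w - a) <= r - d)%R).
  { replace (w - a) with ((w - w0) + (w0 - a)) by ring.
    eapply Rle_trans; [apply Cmod_triangle|]. unfold d in *. lra. }
  split; [lra|]. split.
  - pose proof (cauchy_transform_bound a w r d M phi Hphi HM HM0 Hd Hwa). nra.
  - assert (B : (Cmod (cauchy_transform a r (fun z => phi z / (z - w))%C w) <= 16 * r * (M / d / d))%R).
    { apply cauchy_transform_bound; auto.
      - apply density_div; auto; lra.
      - intros z Hz. destruct (bd_away a w z r ltac:(lra) Hz) as [H1 H2].
        rewrite Cmod_div by auto. apply Rle_div_l; [lra|].
        specialize (HM z Hz).
        apply Rle_trans with (M / d * d)%R; [replace (M / d * d)%R with M by (field; lra); exact HM|].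
        apply Rmult_le_compat_l; [auto | lra]. }
    nra.
Qed.

(** The function differentiated is the derivative of the transform, in which [w] also enters the
    density. Its expansion at [w0] is obtained by differentiating the factored form of the transform
    itself. *)
Lemma cauchy_transform_derive2 (a w0 : C) (r : R) (phi : C -> C) :
  density a r phi -> (Cmod (w0 - a) < r)%R ->
  ex_derive (fun w => cauchy_transform a r (fun z => phi z / (z - w)) w) w0.
Proof.
  intros Hphi Hw0. pose proof (Cmod_ge_0 (w0 - a)) as H0.
  set (phi1 := fun z => phi z / (z - w0)). set (phi2 := fun z => phi1 z / (z - w0)).
  set (phi3 := fun z => phi2 z / (z - w0)).
  assert (D1 : density a r phi1) by now apply density_div.
  assert (D2 : density a r phi2) by now apply density_div.
  assert (D3 : density a r phi3) by now apply density_div.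
  set (T := cauchy_transform a r).
  destruct (cauchy_transform_derive_bound a w0 r phi2 D2 Hw0) as (d2 & N2 & Hd2 & HN2 & B2).
  destruct (cauchy_transform_derive_bound a w0 r phi3 D3 Hw0) as (d3 & N3 & Hd3 & HN3 & B3).
  (* Both sides are the derivative at [w] of [T phi], the right one after writing [T phi] as [T phi
     w0 + (w - w0) (T phi1 w0 + (w - w0) T phi2)]. *)
  assert (E : forall w, (Cmod (w - a) < r)%R ->
    T (fun z => phi z / (z - w)) w = T phi1 w0 + (w - w0) * (2 * T phi2 w)
      + (w - w0) * (w - w0) * T (fun z => phi2 z / (z - w)) w).
  { intros w Hw.
    pose proof (cauchy_transform_derive a w r phi2 D2 Hw) as L2.
    pose proof (cauchy_transform_derive a w r phi Hphi Hw) as L.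
    apply (Cderive_unique (fun w => T phi w0 + (w - w0) * (T phi1 w0 + (w - w0) * T phi2 w)) w).
    - apply (Cderive_ext_loc (T phi)); [|exact L].
      apply locally_Cmod. exists (r - Cmod (w - a))%R. split; [lra|]. intros y Hy.
      assert (Hya : (Cmod (y - a) < r)%R).
      { replace (y - a) with ((y - w) + (w - a)) by ring.
        eapply Rle_lt_trans; [apply Cmod_triangle|]. lra. }
      unfold T. rewrite (cauchy_transform_factor a y w0 r phi) by auto. fold phi1.
      rewrite (cauchy_transform_factor a y w0 r phi1) by auto. reflexivity.
    - eapply Cderive_eq.
      + apply Cderive_plus; [apply Cderive_const|].
        apply Cderive_mult; [apply Cderive_minus; [apply Cderive_id|apply Cderive_const]|].
        apply Cderive_plus; [apply Cderive_const|].
        apply Cderive_mult; [apply Cderive_minus; [apply Cderive_id|apply Cderive_const]|exact L2].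
      + fold T. toC. ring. }
  exists (2 * T phi2 w0). apply is_derive_Cmod. intros e He.
  set (N := (2 * N3 + N2)%R). assert (HN : (0 <= N)%R) by (unfold N; lra).
  exists (Rmin (Rmin d2 d3) (e / (1 + N))). split.
  { apply Rmin_pos; [now apply Rmin_pos|]. apply Rdiv_lt_0_compat; lra. }
  intros w Hw.
  assert (H1 : (Cmod (w - w0) < Rmin d2 d3)%R) by (eapply Rlt_le_trans; [exact Hw|apply Rmin_l]).
  assert (H2 : (Cmod (w - w0) < e / (1 + N))%R) by (eapply Rlt_le_trans; [exact Hw|apply Rmin_r]).
  destruct (B2 w) as (Ha & _ & K2). { eapply Rlt_le_trans; [exact H1|apply Rmin_l]. }
  destruct (B3 w) as (_ & K3 & _). { eapply Rlt_le_trans; [exact H1|apply Rmin_r]. }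
  fold T in K2, K3 |- *. rewrite (E w Ha).
  assert (E0 : T (fun z => phi z / (z - w0)) w0 = T phi1 w0) by reflexivity. rewrite E0.
  assert (E2 : T phi2 w = T phi2 w0 + (w - w0) * T phi3 w) by now apply cauchy_transform_factor.
  rewrite E2.
  match goal with |- (Cmod ?x <= _)%R =>
    replace x with ((w - w0) * ((w - w0) * (2 * T phi3 w + T (fun z => phi2 z / (z - w)) w)))
      by (toC; ring) end.
  rewrite !Cmod_mult, (Rmult_comm e). apply Rmult_le_compat_l; [apply Cmod_ge_0|].
  apply Rlt_div_r in H2; [|lra].
  assert (Cmod (2 * T phi3 w + T (fun z => phi2 z / (z - w))%C w)%C <= N)%R.
  { eapply Rle_trans; [apply Cmod_triangle|]. rewrite Cmod_mult, Cmod_R, Rabs_right by lra.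
    unfold N. lra. }
  pose proof (Cmod_ge_0 (w - w0)). nra.
Qed.

(** Cauchy's formula with the constant moved into the density. With half side [e / 3] the formula
    only needs the disc of radius [2 e / 3]. *)
Lemma holomorphic_cauchy (f : C -> C) (a : C) :
  holomorphic_at f a -> exists (r : R) (phi : C -> C), (0 < r)%R /\ density a r phi /\
    forall w, (Cmod (w - a) < r)%R -> f w = cauchy_transform a r phi w.
Proof.
  intros Hf. apply locally_Cmod in Hf. destruct Hf as [e [He Hf]].
  exists (e / 3)%R, (fun z => / kappa * f z). split; [lra|].
  assert (Hf' : forall z, (Cmod (z - a) <= 2 * (e / 3))%R -> ex_derive f z)
    by (intros; apply Hf; lra).
  assert (Hbd : forall z, bd a (e / 3) z -> ex_derive f z).
  { intros z Hz. apply Hf'. apply bd_dist in Hz; lra. }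
  split.
  - intros z Hz. apply ex_Cderive_mult; [apply ex_Cderive_const | auto].
  - intros w Hw. unfold cauchy_transform.
    rewrite (cont_ext _ (fun z => / kappa * (f z / (z - w)))).
    + rewrite cont_scal by now apply density_div.
      rewrite cauchy_formula by auto. field. apply kappa_neq0.
    + intros z Hz. unfold Cdiv. toC. ring.
Qed.

Lemma holomorphic_at_ex (f : C -> C) (a : C) : holomorphic_at f a -> ex_derive f a.
Proof.
  intros H. apply locally_Cmod in H. destruct H as [e [He H]]. apply H.
  replace (a - a) with (RtoC 0) by ring. now rewrite Cmod_0.
Qed.

Lemma cauchy_transform_holomorphic (a : C) (r : R) (phi : C -> C) :
  (0 < r)%R -> density a r phi -> holomorphic_at (cauchy_transform a r phi) a.
Proof.
  intros Hr Hphi. apply locally_Cmod. exists r. split; [exact Hr|].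
  intros z Hz. eexists. now apply cauchy_transform_derive.
Qed.

Lemma locally_within (P : C -> Prop) (a : C) (r : R) :
  (forall z, (Cmod (z - a) < r)%R -> P z) ->
  forall z, (Cmod (z - a) < r)%R -> locally z P.
Proof.
  intros H z Hz. apply locally_Cmod. exists (r - Cmod (z - a))%R. split; [lra|].
  intros y Hy. apply H. replace (y - a) with ((y - z) + (z - a)) by ring.
  eapply Rle_lt_trans; [apply Cmod_triangle|]. lra.
Qed.

Lemma holomorphic_at_ext (f g : C -> C) (a : C) :
  locally a (fun z => f z = g z) -> holomorphic_at f a -> holomorphic_at g a.
Proof.
  intros H Hf. apply locally_Cmod in H. apply locally_Cmod in Hf.
  destruct H as [d1 [Hd1 H]]. destruct Hf as [d2 [Hd2 Hf]].
  apply locally_Cmod. exists (Rmin d1 d2). split; [now apply Rmin_pos|]. intros z Hz.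
  apply (ex_Cderive_ext_loc f).
  - apply (locally_within _ a d1 H). eapply Rlt_le_trans; [exact Hz|apply Rmin_l].
  - apply Hf. eapply Rlt_le_trans; [exact Hz|apply Rmin_r].
Qed.

(** The derivative is again given by a Cauchy integral, which is differentiable by
    [cauchy_transform_derive2]. *)
Lemma holomorphic_at_derive (f : C -> C) (a : C) :
  holomorphic_at f a -> holomorphic_at (C_derive f) a.
Proof.
  intros Hf. destruct (holomorphic_cauchy f a Hf) as (r & phi & Hr & Hphi & E).
  apply locally_Cmod. exists r. split; [exact Hr|]. intros z Hz.
  apply (ex_Cderive_ext_loc (fun w => cauchy_transform a r (fun z => phi z / (z - w)) w)).
  - apply (locally_within _ a r); [|exact Hz]. intros w Hw. symmetry.
    apply is_C_derive_unique. apply (Cderive_ext_loc (cauchy_transform a r phi)).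
    + apply (locally_within _ a r); [|exact Hw]. intros y Hy. symmetry. now apply E.
    + now apply cauchy_transform_derive.
  - now apply cauchy_transform_derive2.
Qed.

Lemma holomorphic_at_factor (f : C -> C) (a : C) :
  holomorphic_at f a -> exists g : C -> C,
    holomorphic_at g a /\ forall z, f z = f a + (z - a) * g z.
Proof.
  intros Hf. destruct (holomorphic_cauchy f a Hf) as (r & phi & Hr & Hphi & E).
  assert (Ha : (Cmod (a - a) < r)%R) by (replace (a - a) with (RtoC 0) by ring; now rewrite Cmod_0).
  set (phi1 := fun z => phi z / (z - a)).
  assert (D1 : density a r phi1) by now apply density_div.
  (* Outside the disc the difference quotient is taken, so that the factorization holds for every
     [z] and not just near [a]. *)
  exists (fun z => if Rlt_dec (Cmod (z - a)) r then cauchy_transform a r phi1 z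
                   else (f z - f a) / (z - a)).
  split.
  - apply (holomorphic_at_ext (cauchy_transform a r phi1)).
    + apply locally_Cmod. exists r. split; [exact Hr|]. intros z Hz.
      destruct (Rlt_dec (Cmod (z - a)) r); [reflexivity | contradiction].
    + now apply cauchy_transform_holomorphic.
  - intros z. destruct (Rlt_dec (Cmod (z - a)) r) as [H|H].
    + rewrite !E by auto. now apply cauchy_transform_factor.
    + field. intros H0. apply H. rewrite H0, Cmod_0. exact Hr.
Qed.

(** The numbers [T n a] are the Taylor coefficients. The first nonzero one gives the order of the
    zero. If all vanish, [f w = (w - a)^n T n w] for every [n], and the growth of [T n] is only
    geometric. *)
Lemma holomorphic_at_zero (f : C -> C) (a : C) :
  holomorphic_at f a ->
  locally a (fun z => f z = 0) \/
  exists (n : nat) (k : C -> C), holomorphic_at k a /\ k a <> 0 /\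
    locally a (fun z => f z = (z - a) ^ n * k z).
Proof.
  intros Hf. destruct (holomorphic_cauchy f a Hf) as (r & phi & Hr & Hphi & E).
  assert (Ha : (Cmod (a - a) < r)%R) by (replace (a - a) with (RtoC 0) by ring; now rewrite Cmod_0).
  set (ph := fix ph n := match n with O => phi | S n => fun z => ph n z / (z - a) end).
  assert (D : forall n, density a r (ph n)).
  { induction n as [|n IH]; [exact Hphi | now apply (density_div a a r (ph n))]. }
  set (T := fun n => cauchy_transform a r (ph n)).
  assert (step : forall n w, (Cmod (w - a) < r)%R -> T n w = T n a + (w - a) * T (S n) w).
  { intros n w Hw. now apply (cauchy_transform_factor a w a r (ph n)). }
  assert (pow : forall n, (forall k, (k < n)%nat -> T k a = 0) ->
    forall w, (Cmod (w - a) < r)%R -> f w = (w - a) ^ n * T n w).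
  { induction n as [|n IH]; intros H0 w Hw.
    - rewrite E by auto. simpl. toC. unfold T. simpl. ring.
    - rewrite IH, (step n w Hw), (H0 n) by (auto; intros; apply H0; lia). simpl. ring. }
  destruct (classic (exists n, T n a <> 0)) as [[n Hn]|Hall].
  - right.
    assert (least : exists m, T m a <> 0 /\ forall k, (k < m)%nat -> T k a = 0).
    { induction n as [n IH] using (well_founded_induction lt_wf).
      destruct (classic (exists k, (k < n)%nat /\ T k a <> 0)) as [[k [Hk1 Hk2]]|Hno].
      - now apply (IH k).
      - exists n. split; [exact Hn|]. intros k Hk. apply NNPP. intros H. apply Hno. now exists k. }
    destruct least as [m [Hm1 Hm2]]. exists m, (T m). split; [|split; [exact Hm1|]].
    + now apply cauchy_transform_holomorphic.
    + apply locally_Cmod. exists r. split; [exact Hr|]. now apply pow.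
  - left.
    assert (H0 : forall n, T n a = 0).
    { intros n. apply NNPP. intros H. apply Hall. now exists n. }
    apply locally_Cmod. exists (r / 2)%R. split; [lra|]. intros w Hw.
    destruct (bd_bounded phi a r Hphi) as [M [HM0 HM]].
    assert (Bph : forall n z, bd a r z -> (Cmod (ph n z) <= M / r ^ n)%R).
    { induction n as [|n IH]; intros z Hz.
      - simpl. specialize (HM z Hz). lra.
      - simpl. destruct (bd_away a a z r Ha Hz) as [H1 H2].
        replace (a - a) with (RtoC 0) in H1 by ring. rewrite Cmod_0 in H1.
        rewrite Cmod_div by auto. apply Rle_div_l; [lra|].
        assert (Hrn : (0 < r ^ n)%R) by now apply pow_lt.
        eapply Rle_trans; [now apply IH|].
        replace (M / r ^ n)%R with (M / (r * r ^ n) * r)%R by (field; lra).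
        apply Rmult_le_compat_l; [|lra]. apply Rdiv_le_0_compat; nra. }
    (* On the disc of radius [r / 2] the transform of [ph n] is at most [16 r (M / r^n) / (r / 2)],
       which explains the 32; the ratio [|w - a| / r] is below 1. *)
    assert (B : forall n, (Cmod (f w) <= (Cmod (w - a) / r) ^ n * (32 * M))%R).
    { intros n. assert (Hrn : (0 < r ^ n)%R) by now apply pow_lt.
      rewrite (pow n) by (auto; lra). rewrite Cmod_mult, Cmod_pow.
      unfold Rdiv at 1. rewrite Rpow_mult_distr, pow_inv, Rmult_assoc.
      apply Rmult_le_compat_l; [apply pow_le, Cmod_ge_0|].
      eapply Rle_trans.
      - apply (cauchy_transform_bound a w r (r / 2) (M / r ^ n)); auto; try lra.
        apply Rdiv_le_0_compat; auto.
      - right. field. lra. }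
    apply Cmod_eq_0. apply Rle_antisym; [|apply Cmod_ge_0].
    apply le_epsilon. intros eps Heps. rewrite Rplus_0_l.
    assert (Hq : (Rabs (Cmod (w - a) / r) < 1)%R).
    { rewrite Rabs_right; [apply Rlt_div_l; lra|].
      apply Rle_ge, Rdiv_le_0_compat; [apply Cmod_ge_0 | lra]. }
    destruct (pow_lt_1_zero _ Hq (eps / (1 + 32 * M))%R) as [n Hn]; [apply Rdiv_lt_0_compat; lra|].
    specialize (Hn n (Nat.le_refl n)). specialize (B n).
    rewrite Rabs_right in Hn.
    2:{ apply Rle_ge, pow_le, Rdiv_le_0_compat; [apply Cmod_ge_0 | lra]. }
    apply Rlt_div_r in Hn; [|lra].
    assert (0 <= (Cmod (w - a) / r) ^ n)%R
      by (apply pow_le, Rdiv_le_0_compat; [apply Cmod_ge_0 | lra]).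
    nra.
Qed.

(** * Meromorphic functions and the identity theorem *)


Lemma locally_and (P Q : C -> Prop) (a : C) :
  locally a P -> locally a Q -> locally a (fun z => P z /\ Q z).
Proof. apply filter_and. Qed.

Lemma locally_imp (P Q : C -> Prop) (a : C) :
  (forall z, P z -> Q z) -> locally a P -> locally a Q.
Proof. apply filter_imp. Qed.

Lemma locally'_and (P Q : C -> Prop) (a : C) :
  locally' a P -> locally' a Q -> locally' a (fun z => P z /\ Q z).
Proof.
  intros HP HQ. generalize (locally_and _ _ a HP HQ). apply locally_imp.
  intros z [H1 H2] H. auto.
Qed.

Lemma locally'_imp (P Q : C -> Prop) (a : C) :
  (forall z, z <> a -> P z -> Q z) -> locally' a P -> locally' a Q.
Proof. intros H. apply locally_imp. intros z Hz Hza. auto. Qed.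

Lemma locally_locally' (P : C -> Prop) (a : C) : locally a P -> locally' a P.
Proof. apply locally_imp. auto. Qed.

Lemma locally_self (P : C -> Prop) (a : C) : locally a P -> P a.
Proof. apply locally_singleton. Qed.

Lemma locally_twice (P : C -> Prop) (a : C) : locally a P -> locally a (fun z => locally z P).
Proof.
  intros H. apply locally_Cmod in H. destruct H as [d [Hd H]].
  apply locally_Cmod. exists d. split; [exact Hd|]. now apply locally_within.
Qed.

Lemma locally_neq (a b : C) : a <> b -> locally a (fun z => z <> b).
Proof.
  intros H. apply locally_Cmod. exists (Cmod (a - b)). split.
  - apply Cmod_gt_0. now apply Cminus_neq0.
  - intros z Hz ->. rewrite Cmod_sub_sym in Hz. lra.
Qed.

Lemma locally'_twice (P : C -> Prop) (a : C) : locally' a P -> locally' a (fun z => locally z P).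
Proof.
  intros H. generalize (locally_twice _ a H). apply locally_imp. intros z Hz Hza.
  generalize (locally_and _ _ z Hz (locally_neq z a Hza)). apply locally_imp.
  intros y [H1 H2]. auto.
Qed.

Lemma locally'_open (P : C -> Prop) (a : C) :
  locally' a P -> locally a (fun z => locally' z P).
Proof.
  intros H. generalize (locally_twice _ a (locally'_twice _ a H)). apply locally_imp.
  intros z Hz. destruct (classic (z = a)) as [->|Hne]; [exact H|].
  apply locally_locally'. exact (locally_self _ z Hz Hne).
Qed.

Lemma locally'_nonempty (P : C -> Prop) (a : C) : locally' a P -> exists z, z <> a /\ P z.
Proof.
  intros H. apply locally'_Cmod in H. destruct H as [d [Hd H]].
  assert (Hne : a + RtoC (d / 2) <> a).
  { intros E. assert (E' : RtoC (d / 2) = 0)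
      by (replace (RtoC (d / 2)) with (a + RtoC (d / 2) - a) by ring; rewrite E; ring).
    apply RtoC_inj in E'. lra. }
  exists (a + RtoC (d / 2)). split; [exact Hne|]. apply H; [|exact Hne].
  replace (a + RtoC (d / 2) - a) with (RtoC (d / 2)) by ring. rewrite Cmod_R, Rabs_right; lra.
Qed.

(** Continuity of both functions at [a]. This converts identities known off the exceptional points
    into values at regular ones. *)
Lemma punctured_limit (f g : C -> C) (a : C) :
  ex_derive f a -> ex_derive g a -> locally' a (fun z => f z = g z) -> f a = g a.
Proof.
  intros Hf Hg H. apply NNPP. intros Hne.
  assert (Hpos : (0 < Cmod (f a - g a))%R) by (apply Cmod_gt_0, Cminus_neq0; auto).
  destruct (Cderive_continuous f a Hf (Cmod (f a - g a) / 2)%R ltac:(lra)) as [r1 [Hr1 H1]].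
  destruct (Cderive_continuous g a Hg (Cmod (f a - g a) / 2)%R ltac:(lra)) as [r2 [Hr2 H2]].
  assert (L1 : locally' a (fun z => (Cmod (z - a) < r1)%R)).
  { apply locally'_Cmod. exists r1. auto. }
  assert (L2 : locally' a (fun z => (Cmod (z - a) < r2)%R)).
  { apply locally'_Cmod. exists r2. auto. }
  destruct (locally'_nonempty _ a (locally'_and _ _ a H (locally'_and _ _ a L1 L2)))
    as (z & _ & E & K1 & K2).
  specialize (H1 z K1). specialize (H2 z K2). rewrite E in H1.
  assert (Cmod (f a - g a) <= Cmod (g z - f a) + Cmod (g z - g a))%R; [|lra].
  replace (f a - g a) with (- (g z - f a) + (g z - g a)) by ring.
  eapply Rle_trans; [apply Cmod_triangle|]. rewrite Cmod_opp. lra.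
Qed.

Lemma locally_nonzero (f : C -> C) (a : C) :
  ex_derive f a -> f a <> 0 -> locally a (fun z => f z <> 0).
Proof.
  intros Hf H0. assert (Hpos : (0 < Cmod (f a))%R) by now apply Cmod_gt_0.
  destruct (Cderive_continuous f a Hf (Cmod (f a)) Hpos) as [r [Hr H]].
  apply locally_Cmod. exists r. split; [exact Hr|]. intros z Hz E. specialize (H z Hz).
  rewrite E in H. replace (0 - f a) with (- f a) in H by ring. rewrite Cmod_opp in H. lra.
Qed.

Lemma holomorphic_at_of_ex (f : C -> C) (a : C) : (forall z, ex_derive f z) -> holomorphic_at f a.
Proof. intros H. apply locally_Cmod. exists 1%R. split; [lra | auto]. Qed.

Lemma holomorphic_at_const (c a : C) : holomorphic_at (fun _ => c) a.
Proof. apply holomorphic_at_of_ex. intros; apply ex_Cderive_const. Qed.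

Lemma holomorphic_at_shift (c a : C) : holomorphic_at (fun z => z - c) a.
Proof. apply holomorphic_at_of_ex. intros; apply ex_Cderive_shift. Qed.

Lemma holomorphic_at_plus (f g : C -> C) (a : C) :
  holomorphic_at f a -> holomorphic_at g a -> holomorphic_at (fun z => f z + g z) a.
Proof.
  intros Hf Hg. generalize (locally_and _ _ a Hf Hg). apply locally_imp.
  intros z [H1 H2]. now apply ex_Cderive_plus.
Qed.

Lemma holomorphic_at_minus (f g : C -> C) (a : C) :
  holomorphic_at f a -> holomorphic_at g a -> holomorphic_at (fun z => f z - g z) a.
Proof.
  intros Hf Hg. generalize (locally_and _ _ a Hf Hg). apply locally_imp.
  intros z [H1 H2]. now apply ex_Cderive_minus.
Qed.

Lemma holomorphic_at_mult (f g : C -> C) (a : C) :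
  holomorphic_at f a -> holomorphic_at g a -> holomorphic_at (fun z => f z * g z) a.
Proof.
  intros Hf Hg. generalize (locally_and _ _ a Hf Hg). apply locally_imp.
  intros z [H1 H2]. now apply ex_Cderive_mult.
Qed.

Lemma holomorphic_at_div (f g : C -> C) (a : C) :
  holomorphic_at f a -> holomorphic_at g a -> g a <> 0 -> holomorphic_at (fun z => f z / g z) a.
Proof.
  intros Hf Hg H0.
  generalize (locally_and _ _ a Hf (locally_and _ _ a Hg
    (locally_nonzero g a (holomorphic_at_ex g a Hg) H0))).
  apply locally_imp. intros z (H1 & H2 & H3). now apply ex_Cderive_div.
Qed.

Lemma holomorphic_at_pow (f : C -> C) (n : nat) (a : C) :
  holomorphic_at f a -> holomorphic_at (fun z => f z ^ n) a.
Proof. apply locally_imp. intros z H. now apply ex_Cderive_pow. Qed.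

Lemma Cpow_neq0 (z : C) (n : nat) : z <> 0 -> z ^ n <> 0.
Proof.
  intros H. induction n as [|n IH]; simpl.
  - intros E. apply RtoC_inj in E. lra.
  - now apply Cmult_neq_0.
Qed.

Lemma Cinv_neq0 (z : C) : z <> 0 -> / z <> 0.
Proof.
  intros H E. pose proof (Cinv_r z H) as E1. rewrite E, Cmult_0_r in E1.
  apply RtoC_inj in E1. lra.
Qed.

(** Weaker than [meromorphic]: [g a] may be zero and the value [f a] is arbitrary. This makes the
    class stable under sums, products and derivatives, where poles may cancel. *)
Definition mero_at (f : C -> C) (a : C) : Prop :=
  exists (n : nat) (g : C -> C),
    holomorphic_at g a /\ locally' a (fun z => f z = g z / (z - a) ^ n).

Lemma holomorphic_mero (f : C -> C) (a : C) : holomorphic_at f a -> mero_at f a.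
Proof.
  intros H. exists O, f. split; [exact H|]. apply locally'_Cmod. exists 1%R. split; [lra|].
  intros z _ _. simpl. field.
Qed.

Lemma meromorphic_mero (f : C -> C) (a : C) : meromorphic f -> mero_at f a.
Proof.
  intros H. destruct (H a) as [Hf | (n & g & _ & Hg & _ & E)]; [now apply holomorphic_mero|].
  now exists n, g.
Qed.

Lemma mero_at_ext (f g : C -> C) (a : C) :
  locally' a (fun z => f z = g z) -> mero_at f a -> mero_at g a.
Proof.
  intros H (n & k & Hk & E). exists n, k. split; [exact Hk|].
  generalize (locally'_and _ _ a H E). apply locally'_imp.
  intros z _ [E1 E2]. congruence.
Qed.

Lemma mero_at_plus (f g : C -> C) (a : C) :
  mero_at f a -> mero_at g a -> mero_at (fun z => f z + g z) a.
Proof.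
  intros (n & f1 & Hf & Ef) (m & g1 & Hg & Eg).
  exists (n + m)%nat, (fun z => f1 z * (z - a) ^ m + g1 z * (z - a) ^ n). split.
  - apply holomorphic_at_plus; apply holomorphic_at_mult; auto;
      apply holomorphic_at_pow, holomorphic_at_shift.
  - generalize (locally'_and _ _ a Ef Eg). apply locally'_imp. intros z Hz [-> ->].
    apply Cminus_neq0 in Hz. rewrite Cpow_add_r. field. split; now apply Cpow_neq0.
Qed.

Lemma mero_at_mult (f g : C -> C) (a : C) :
  mero_at f a -> mero_at g a -> mero_at (fun z => f z * g z) a.
Proof.
  intros (n & f1 & Hf & Ef) (m & g1 & Hg & Eg).
  exists (n + m)%nat, (fun z => f1 z * g1 z). split.
  - now apply holomorphic_at_mult.
  - generalize (locally'_and _ _ a Ef Eg). apply locally'_imp. intros z Hz [-> ->].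
    apply Cminus_neq0 in Hz. rewrite Cpow_add_r. field. split; now apply Cpow_neq0.
Qed.

Lemma mero_at_const (c a : C) : mero_at (fun _ => c) a.
Proof. apply holomorphic_mero, holomorphic_at_const. Qed.

Lemma mero_at_minus (f g : C -> C) (a : C) :
  mero_at f a -> mero_at g a -> mero_at (fun z => f z - g z) a.
Proof.
  intros Hf Hg. apply (mero_at_ext (fun z => f z + - (1) * g z)).
  - apply locally'_Cmod. exists 1%R. split; [lra|]. intros. ring.
  - apply mero_at_plus; auto. apply mero_at_mult; auto. apply mero_at_const.
Qed.

Lemma is_derive_shift_pow (a z : C) (n : nat) :
  is_derive (fun w => (w - a) ^ n) z (INR n * (z - a) ^ pred n).
Proof.
  induction n as [|n IH].
  - simpl. eapply Cderive_eq; [apply Cderive_const|]. ringC.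
  - simpl Cpow. eapply Cderive_eq.
    + apply Cderive_mult; [|exact IH]. apply Cderive_minus; [apply Cderive_id|apply Cderive_const].
    + rewrite S_INR, RtoC_plus. destruct n as [|n]; simpl; ringC.
Qed.

(* [f = g / x ^ n] gives [f' = (x g' - n g) / x ^ (n + 1)] with [x = z - a]. *)
Lemma is_derive_laurent (f g : C -> C) (a : C) (n : nat) :
  holomorphic_at g a -> locally' a (fun z => f z = g z / (z - a) ^ n) ->
  locally' a (fun z => is_derive f z
    (((z - a) * C_derive g z - INR n * g z) / (z - a) ^ S n)).
Proof.
  intros Hg E.
  generalize (locally'_and _ _ a (locally_locally' _ a Hg) (locally'_twice _ a E)).
  apply locally'_imp. intros z Hz [Hgz Ez]. apply Cminus_neq0 in Hz.
  apply (Cderive_ext_loc (fun z => g z / (z - a) ^ n)).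
  - generalize Ez. apply locally_imp. auto.
  - eapply Cderive_eq.
    + apply Cderive_div; [apply (C_derive_correct g z 0 Hgz)| apply is_derive_shift_pow |].
      now apply Cpow_neq0.
    + toC. destruct n as [|n]; simpl.
      * field. auto.
      * assert ((z - a) ^ n <> 0) by now apply Cpow_neq0. field. auto.
Qed.

Lemma holomorphic_at_laurent_derive (g : C -> C) (a : C) (n : nat) :
  holomorphic_at g a -> holomorphic_at (fun z => (z - a) * C_derive g z - INR n * g z) a.
Proof.
  intros Hg. apply holomorphic_at_minus; apply holomorphic_at_mult; auto.
  - apply holomorphic_at_shift.
  - now apply holomorphic_at_derive.
  - apply holomorphic_at_const.
Qed.

Lemma mero_at_derive (f : C -> C) (a : C) : mero_at f a -> mero_at (C_derive f) a.
Proof.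
  intros (n & g & Hg & E). exists (S n), (fun z => (z - a) * C_derive g z - INR n * g z). split.
  - now apply holomorphic_at_laurent_derive.
  - generalize (is_derive_laurent f g a n Hg E). apply locally'_imp.
    intros z _ H. now apply is_C_derive_unique.
Qed.

(** Compares the order [m] of the zero of the numerator with the exponent [n] of the denominator. *)
Lemma mero_at_cases (f : C -> C) (a : C) :
  mero_at f a ->
  (exists g : C -> C, holomorphic_at g a /\ locally' a (fun z => f z = g z)) \/ pole_at f a.
Proof.
  intros (n & g & Hg & E). destruct (holomorphic_at_zero g a Hg) as [H0 | (m & k & Hk & Hka & Ek)].
  - left. exists (fun _ => 0). split; [apply holomorphic_at_const|].
    generalize (locally'_and _ _ a E (locally_locally' _ a H0)). apply locally'_imp.
    intros z Hz [-> ->]. apply Cminus_neq0 in Hz. field. now apply Cpow_neq0.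
  - destruct (le_lt_dec n m) as [Hle|Hlt].
    + left. exists (fun z => (z - a) ^ (m - n) * k z). split.
      * apply holomorphic_at_mult; [|exact Hk]. apply holomorphic_at_pow, holomorphic_at_shift.
      * generalize (locally'_and _ _ a E (locally_locally' _ a Ek)). apply locally'_imp.
        intros z Hz [-> ->]. apply Cminus_neq0 in Hz.
        replace m with (m - n + n)%nat at 1 by lia. rewrite Cpow_add_r. field. now apply Cpow_neq0.
    + right. exists (n - m)%nat, k. split; [lia|]. split; [exact Hk|]. split; [exact Hka|].
      generalize (locally'_and _ _ a E (locally_locally' _ a Ek)). apply locally'_imp.
      intros z Hz [-> ->]. apply Cminus_neq0 in Hz.
      replace n with (n - m + m)%nat at 1 by lia. rewrite Cpow_add_r.
      field. split; now apply Cpow_neq0.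
Qed.

Lemma pole_not_removable (f g : C -> C) (a : C) :
  pole_at f a -> holomorphic_at g a -> locally' a (fun z => f z = g z) -> False.
Proof.
  intros (n & k & Hn & Hk & Hka & E) Hg Eg. apply Hka.
  assert (H : k a = (a - a) ^ n * g a).
  { apply (punctured_limit k (fun z => (z - a) ^ n * g z)).
    - now apply holomorphic_at_ex.
    - apply holomorphic_at_ex, holomorphic_at_mult; [|exact Hg].
      apply holomorphic_at_pow, holomorphic_at_shift.
    - generalize (locally'_and _ _ a E Eg). apply locally'_imp. intros z Hz [E1 E2].
      apply Cminus_neq0 in Hz. rewrite <- E2, E1. field. now apply Cpow_neq0. }
  rewrite H. destruct n as [|n]; [lia|]. simpl. ring.
Qed.

Lemma mero_at_dichotomy (f : C -> C) (a : C) :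
  mero_at f a -> locally' a (fun z => f z = 0) \/ locally' a (fun z => f z <> 0).
Proof.
  intros (n & g & Hg & E). destruct (holomorphic_at_zero g a Hg) as [H0 | (m & k & Hk & Hka & Ek)].
  - left. generalize (locally'_and _ _ a E (locally_locally' _ a H0)). apply locally'_imp.
    intros z Hz [-> ->]. apply Cminus_neq0 in Hz. field. now apply Cpow_neq0.
  - right. pose proof (locally_nonzero k a (holomorphic_at_ex k a Hk) Hka) as Hnz.
    generalize (locally'_and _ _ a E (locally_locally' _ a (locally_and _ _ a Ek Hnz))).
    apply locally'_imp. intros z Hz (-> & -> & Hkz). apply Cminus_neq0 in Hz.
    apply Cmult_neq_0; [apply Cmult_neq_0; auto; now apply Cpow_neq0|].
    now apply Cinv_neq0, Cpow_neq0.
Qed.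

(** Compactness of the interval in the form of a supremum argument: an additive property of
    intervals that holds for small intervals around each point holds globally. *)
Lemma cousin (Q : R -> R -> Prop) (a b : R) :
  (a <= b)%R ->
  (forall u v w : R, (u <= v <= w)%R -> Q u v -> Q v w -> Q u w) ->
  (forall x : R, (a <= x <= b)%R -> exists d : R, (0 < d)%R /\
     forall u v : R, (x - d < u <= x)%R -> (x <= v < x + d)%R -> Q u v) ->
  Q a b.
Proof.
  intros Hab Hglue Hloc.
  set (E := fun t : R => (a <= t <= b)%R /\ Q a t).
  destruct (completeness E) as [s [Hs1 Hs2]].
  - exists b. intros t [Ht _]. lra.
  - exists a. split; [lra|]. destruct (Hloc a ltac:(lra)) as [d [Hd H]]. apply H; lra.
  - assert (Ha : (a <= s)%R).
    { apply Hs1. split; [lra|]. destruct (Hloc a ltac:(lra)) as [d [Hd H]]. apply H; lra. }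
    assert (Hb : (s <= b)%R) by (apply Hs2; intros t [Ht _]; lra).
    destruct (Hloc s ltac:(lra)) as [d [Hd H]].
    assert (Ht : exists t, E t /\ (s - d < t)%R).
    { apply NNPP. intros Hno. assert (s <= s - d)%R; [|lra]. apply Hs2. intros t Et.
      destruct (Rle_lt_dec t (s - d)); [assumption|]. exfalso. apply Hno. now exists t. }
    destruct Ht as [t [[Ht Qt] Hts]]. pose proof (Hs1 t (conj Ht Qt)) as Hts'.
    assert (K : forall v, (s <= v < s + d)%R -> Q a v).
    { intros v Hv. apply (Hglue a t v); [lra|exact Qt|]. apply H; lra. }
    destruct (Req_dec s b) as [->|Hne]; [apply K; lra|].
    exfalso. set (v := Rmin b (s + d / 2)).
    assert (Hv : (s < v <= b)%R /\ (v < s + d)%R).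
    { unfold v. pose proof (Rmin_l b (s + d / 2)). pose proof (Rmin_r b (s + d / 2)).
      assert (s < Rmin b (s + d / 2))%R by (apply Rmin_glb_lt; lra). lra. }
    assert (v <= s)%R; [|lra]. apply Hs1. split; [lra|]. apply K. lra.
Qed.

Lemma path_close (A B : C) (t : R) (P : C -> Prop) :
  locally (path A B t) P -> exists d : R, (0 < d)%R /\
    forall t', (Rabs (t' - t) < d)%R -> P (path A B t').
Proof.
  intros H. apply locally_Cmod in H. destruct H as [e [He H]].
  pose proof (Cmod_ge_0 (B - A)).
  exists (e / (1 + Cmod (B - A)))%R. split; [apply Rdiv_lt_0_compat; lra|].
  intros t' Ht. apply H. apply Rlt_div_r in Ht; [|lra].
  replace (path A B t' - path A B t) with (RtoC (t' - t) * (B - A))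
    by (unfold path; rewrite RtoC_minus; ring).
  rewrite Cmod_mult, Cmod_R. pose proof (Rabs_pos (t' - t)). nra.
Qed.

(** Cousin's principle along the segment from [a] to [b], applied to the implication from vanishing
    near one point to vanishing near a later one. Around each point the dichotomy makes the
    conclusion true or the premise false. *)
Lemma identity_theorem (S : C -> Prop) (f : C -> C) (a b : C) :
  Cconvex S -> S a -> S b -> (forall z, S z -> mero_at f z) ->
  locally' a (fun z => f z = 0) -> locally' b (fun z => f z = 0).
Proof.
  intros HS Ha Hb Hf H0.
  set (P := fun t : R => locally' (path a b t) (fun z => f z = 0)).
  assert (K : P 0%R -> P 1%R).
  { apply (cousin (fun u v => P u -> P v)); [lra|auto|]. intros x Hx.
    assert (Hp : S (path a b x)) by now apply HS.
    destruct (mero_at_dichotomy f _ (Hf _ Hp)) as [Hz|Hz];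
      destruct (path_close a b x _ (locally'_open _ _ Hz)) as [d [Hd Hn]];
      exists d; (split; [exact Hd|]); intros u v Hu Hv HPu.
    - exact (Hn v ltac:(rewrite Rabs_right; lra)).
    - exfalso. assert (Hnu : locally' (path a b u) (fun z => f z <> 0)).
      { exact (Hn u ltac:(rewrite Rabs_left1; lra)). }
      destruct (locally'_nonempty _ _ (locally'_and _ _ _ HPu Hnu)) as (z & _ & E1 & E2). auto. }
  unfold P in K. replace (path a b 0) with a in K by (unfold path; ring).
  replace (path a b 1) with b in K by (unfold path; ring). auto.
Qed.

Lemma derive_zero_const (f : C -> C) (a : C) (r : R) :
  (forall z, (Cmod (z - a) < r)%R -> is_derive f z (RtoC 0)) ->
  forall z, (Cmod (z - a) < r)%R -> f z = f a.
Proof.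
  intros Hf z Hz. pose proof (Cmod_ge_0 (z - a)).
  assert (H0 : seg_diff (fun _ => 0) a z) by (intros t _; apply ex_Cderive_const).
  (* The integral of zero is evaluated twice, once with the primitive [f] and once with the
     primitive zero. *)
  pose proof (seg_FTC f (fun _ => 0) a z H0) as E1.
  pose proof (seg_FTC (fun _ => 0) (fun _ => 0) a z H0) as E2.
  rewrite E2 in E1 by (intros t _; apply Cderive_const).
  replace (f z) with (f z - f a + f a) by ring. rewrite <- E1; [ring|].
  intros t Ht. apply Hf.
  replace (path a z t - a) with (RtoC t * (z - a)) by (unfold path; ring).
  rewrite Cmod_mult, Cmod_R, Rabs_right by lra. nra.
Qed.

(** * The system at a pole *)


Lemma Cexp_plus (x y : C) : Cexp (x + y) = Cexp x * Cexp y.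
Proof.
  unfold Cexp, Cmult, Cplus, Re, Im; cbn [fst snd].
  rewrite exp_plus, cos_plus, sin_plus. f_equal; ring.
Qed.

Lemma Cexp_0 : Cexp 0 = 1.
Proof. unfold Cexp, RtoC, Re, Im; cbn [fst snd]. rewrite exp_0, cos_0, sin_0. f_equal; ring. Qed.

Lemma Cexp_neq0 (z : C) : Cexp z <> 0.
Proof.
  intros H. assert (E : Cexp (z + - z) = 1) by (rewrite Cplus_opp_r; apply Cexp_0).
  rewrite Cexp_plus, H, Cmult_0_l in E. apply RtoC_inj in E. lra.
Qed.

Lemma small_o_R (f : R -> R) (l : R) :
  derivable_pt_lim f 0 l -> forall e : R, (0 < e)%R -> exists d : R, (0 < d)%R /\
    forall k, (Rabs k < d)%R -> (Rabs (f k - f 0 - l * k) <= e * Rabs k)%R.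
Proof.
  intros Hf e He. destruct (Hf e He) as [d Hd]. exists (pos d). split; [apply cond_pos|].
  intros k Hk. destruct (Req_dec k 0) as [->|Hk0].
  - replace (f 0 - f 0 - l * 0)%R with 0%R by ring. rewrite Rabs_R0. lra.
  - specialize (Hd k Hk0 Hk). rewrite Rplus_0_l in Hd.
    replace (f k - f 0 - l * k)%R with (((f k - f 0) / k - l) * k)%R by (field; auto).
    rewrite Rabs_mult. apply Rmult_le_compat_r; [apply Rabs_pos | lra].
Qed.

(** Assembled from the real derivatives of [exp], [cos] and [sin] at 0; the functional equation then
    carries it to all points. *)
Lemma is_derive_Cexp_0 : is_derive Cexp (RtoC 0) (RtoC 1).
Proof.
  apply is_derive_Cmod. intros e He. rewrite Cexp_0.
  set (e' := Rmin (e / 16) (1 / 2)).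
  assert (He' : (0 < e')%R) by (apply Rmin_pos; lra).
  assert (He1 : (e' <= e / 16)%R) by apply Rmin_l.
  assert (He2 : (e' <= 1 / 2)%R) by apply Rmin_r.
  destruct (small_o_R exp 1 derivable_pt_lim_exp_0 e' He') as [d1 [Hd1 H1]].
  pose proof (derivable_pt_lim_cos 0) as Dcos. rewrite sin_0, Ropp_0 in Dcos.
  pose proof (derivable_pt_lim_sin 0) as Dsin. rewrite cos_0 in Dsin.
  destruct (small_o_R cos 0 Dcos e' He') as [d2 [Hd2 H2]].
  destruct (small_o_R sin 1 Dsin e' He') as [d3 [Hd3 H3]].
  exists (Rmin (Rmin d1 d2) (Rmin d3 e')). split.
  { apply Rmin_pos; apply Rmin_pos; auto. }
  intros y Hy. replace (y - 0) with y in * by ring.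
  assert (Hyd1 : (Cmod y < d1)%R).
  { eapply Rlt_le_trans; [exact Hy|]. eapply Rle_trans; [apply Rmin_l|apply Rmin_l]. }
  assert (Hyd2 : (Cmod y < d2)%R).
  { eapply Rlt_le_trans; [exact Hy|]. eapply Rle_trans; [apply Rmin_l|apply Rmin_r]. }
  assert (Hyd3 : (Cmod y < d3)%R).
  { eapply Rlt_le_trans; [exact Hy|]. eapply Rle_trans; [apply Rmin_r|apply Rmin_l]. }
  assert (Hye : (Cmod y < e')%R).
  { eapply Rlt_le_trans; [exact Hy|]. eapply Rle_trans; [apply Rmin_r|apply Rmin_r]. }
  pose proof (re_le_Cmod y) as Hre. pose proof (im_le_Cmod y) as Him.
  destruct y as [x b]. unfold Re, Im in Hre, Him; cbn [fst snd] in Hre, Him.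
  set (m := Cmod (x, b)) in *.
  specialize (H1 x ltac:(lra)). specialize (H2 b ltac:(lra)). specialize (H3 b ltac:(lra)).
  rewrite exp_0 in H1. rewrite cos_0 in H2. rewrite sin_0 in H3.
  set (E := (exp x - 1 - 1 * x)%R) in H1. set (G := (cos b - 1 - 0 * b)%R) in H2.
  set (F := (sin b - 0 - 1 * b)%R) in H3.
  assert (Hm : (0 <= m)%R) by apply Cmod_ge_0.
  assert (h1 : (Rabs E <= e' * m)%R) by nra.
  assert (h2 : (Rabs G <= e' * m)%R) by nra.
  assert (h3 : (Rabs F <= e' * m)%R) by nra.
  eapply Rle_trans; [apply Cmod_le_Re_Im|].
  (* Substitute [exp x = 1 + x + E], [cos b = 1 + G], [sin b = b + F]. The two parts are then
     bounded by [3 e' m] and [5 e' m], which the choice [e' <= e / 16] covers. *)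
  replace (Re (Cexp (x, b) - 1 - (x, b) * 1)) with (E + (1 + x + E) * G)%R.
  2:{ unfold Cexp, Cminus, Cplus, Copp, Cmult, RtoC, Re, Im, E, G; cbn [fst snd]. ring. }
  replace (Im (Cexp (x, b) - 1 - (x, b) * 1)) with (F + (x + E) * (b + F))%R.
  2:{ unfold Cexp, Cminus, Cplus, Copp, Cmult, RtoC, Re, Im, E, F; cbn [fst snd]. ring. }
  assert (A1 : (Rabs (1 + x + E) <= 2)%R).
  { eapply Rle_trans; [apply Rabs_triang|].
    eapply Rle_trans; [apply Rplus_le_compat_r, Rabs_triang|]. rewrite Rabs_R1. nra. }
  assert (A2 : (Rabs (x + E) <= 2 * e')%R).
  { eapply Rle_trans; [apply Rabs_triang|]. nra. }
  assert (A3 : (Rabs (b + F) <= 2 * m)%R).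
  { eapply Rle_trans; [apply Rabs_triang|]. nra. }
  assert (B1 : (Rabs (E + (1 + x + E) * G) <= 3 * (e' * m))%R).
  { eapply Rle_trans; [apply Rabs_triang|]. rewrite Rabs_mult.
    pose proof (Rabs_pos G). pose proof (Rabs_pos (1 + x + E)). nra. }
  assert (B2 : (Rabs (F + (x + E) * (b + F)) <= 5 * (e' * m))%R).
  { eapply Rle_trans; [apply Rabs_triang|]. rewrite Rabs_mult.
    pose proof (Rabs_pos (b + F)). pose proof (Rabs_pos (x + E)).
    assert (Rabs (x + E) * Rabs (b + F) <= (2 * e') * (2 * m))%R by (apply Rmult_le_compat; auto).
    lra. }
  nra.
Qed.

Lemma is_derive_Cexp (z : C) : is_derive Cexp z (Cexp z).
Proof.
  apply (Cderive_ext_loc (fun w => Cexp z * Cexp (w - z))).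
  - apply locally_Cmod. exists 1%R. split; [lra|]. intros w _. rewrite <- Cexp_plus. f_equal. ring.
  - eapply Cderive_eq.
    + apply Cderive_mult; [apply Cderive_const|].
      apply (Cderive_comp Cexp (fun w => w - z) z 1 1).
      * replace (z - z) with (RtoC 0) by ring. apply is_derive_Cexp_0.
      * eapply Cderive_eq; [apply Cderive_minus; [apply Cderive_id|apply Cderive_const]|]. ringC.
    + ringC.
Qed.

Lemma holomorphic_at_Cexp (a : C) : holomorphic_at Cexp a.
Proof. apply holomorphic_at_of_ex. intros z. eexists. apply is_derive_Cexp. Qed.

Ltac holo :=
  match goal with
  | |- holomorphic_at (fun _ => ?c) _ => apply holomorphic_at_const
  | |- holomorphic_at (fun x => x - ?c) _ => apply holomorphic_at_shift
  | |- holomorphic_at (fun x => _ + _) _ => apply holomorphic_at_plus; holo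
  | |- holomorphic_at (fun x => _ - _) _ => apply holomorphic_at_minus; holo
  | |- holomorphic_at (fun x => _ * _) _ => apply holomorphic_at_mult; holo
  | |- holomorphic_at (fun x => _ ^ ?n) _ => apply holomorphic_at_pow; holo
  | |- holomorphic_at Cexp _ => apply holomorphic_at_Cexp
  | _ => assumption
  end.

Lemma RtoC_INR_neq0 (n : nat) : (0 < n)%nat -> RtoC (INR n) <> 0.
Proof. intros Hn H. apply RtoC_inj in H. apply (not_0_INR n); [lia | exact H]. Qed.

(** At [a] everything carrying the factor [z - a] vanishes, and the remaining coefficient [S n] is
    nonzero. *)
Lemma laurent_linear_value (g : C -> C) (a : C) (n : nat) (k : C -> C) :
  holomorphic_at g a -> holomorphic_at k a ->
  locally' a (fun z => (z - a) * C_derive g z - INR (S n) * g z = (z - a) * k z) -> g a = 0.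
Proof.
  intros Hg Hk H.
  assert (E : (a - a) * C_derive g a - INR (S n) * g a = (a - a) * k a).
  { apply (punctured_limit (fun z => (z - a) * C_derive g z - INR (S n) * g z)
      (fun z => (z - a) * k z)); [| |exact H].
    - now apply holomorphic_at_ex, holomorphic_at_laurent_derive.
    - apply holomorphic_at_ex, holomorphic_at_mult; [apply holomorphic_at_shift | exact Hk]. }
  pose proof (RtoC_INR_neq0 (S n) ltac:(lia)) as Hn.
  replace (g a) with (- ((a - a) * C_derive g a - INR (S n) * g a) / INR (S n)) by (field; auto).
  rewrite E. field. auto.
Qed.

(* The pole order drops by one as long as it is positive: multiplied by [x ^ (n + 1)],
   the equation [y' = M y] forces the leading coefficient [n y] to vanish. *)
Lemma linear_ode_removable (m11 m12 m21 m22 y1 y2 : C -> C) (a : C) :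
  holomorphic_at m11 a -> holomorphic_at m12 a -> holomorphic_at m21 a -> holomorphic_at m22 a ->
  mero_at y1 a -> mero_at y2 a ->
  locally' a (fun z => is_derive y1 z (m11 z * y1 z + m12 z * y2 z) /\
                       is_derive y2 z (m21 z * y1 z + m22 z * y2 z)) ->
  exists g1 g2 : C -> C, holomorphic_at g1 a /\ holomorphic_at g2 a /\
    locally' a (fun z => y1 z = g1 z /\ y2 z = g2 z).
Proof.
  intros H11 H12 H21 H22 (n1 & f1 & Hf1 & E1) (n2 & f2 & Hf2 & E2) Hode.
  assert (K : forall n g1 g2, holomorphic_at g1 a -> holomorphic_at g2 a ->
    locally' a (fun z => y1 z = g1 z / (z - a) ^ n) ->
    locally' a (fun z => y2 z = g2 z / (z - a) ^ n) ->
    exists g1 g2 : C -> C, holomorphic_at g1 a /\ holomorphic_at g2 a /\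
      locally' a (fun z => y1 z = g1 z /\ y2 z = g2 z)).
  { induction n as [|n IH]; intros g1 g2 Hg1 Hg2 L1 L2.
    - exists g1, g2. split; [exact Hg1|]. split; [exact Hg2|].
      generalize (locally'_and _ _ a L1 L2). apply locally'_imp. intros z _ [-> ->].
      simpl. split; field.
    - pose proof (is_derive_laurent y1 g1 a (S n) Hg1 L1) as D1.
      pose proof (is_derive_laurent y2 g2 a (S n) Hg2 L2) as D2.
      assert (Z1 : g1 a = 0).
      { apply (laurent_linear_value g1 a n (fun z => m11 z * g1 z + m12 z * g2 z)); auto.
        { apply holomorphic_at_plus; now apply holomorphic_at_mult. }
        generalize (locally'_and _ _ a (locally'_and _ _ a L1 L2) (locally'_and _ _ a D1 Hode)).
        apply locally'_imp. intros z Hz ((e1 & e2) & d1 & d2 & _).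
        pose proof (Cderive_unique _ _ _ _ d1 d2) as Eq. rewrite e1, e2 in Eq.
        apply Cminus_neq0 in Hz. assert (Hp : (z - a) ^ S n <> 0) by now apply Cpow_neq0.
        change ((z - a) ^ S (S n)) with ((z - a) * (z - a) ^ S n) in Eq.
        apply (f_equal (fun x => x * ((z - a) * (z - a) ^ S n))) in Eq.
        transitivity (((z - a) * C_derive g1 z - INR (S n) * g1 z) / ((z - a) * (z - a) ^ S n) *
          ((z - a) * (z - a) ^ S n)); [field; auto|]. rewrite Eq. field. auto. }
      assert (Z2 : g2 a = 0).
      { apply (laurent_linear_value g2 a n (fun z => m21 z * g1 z + m22 z * g2 z)); auto.
        { apply holomorphic_at_plus; now apply holomorphic_at_mult. }
        generalize (locally'_and _ _ a (locally'_and _ _ a L1 L2) (locally'_and _ _ a D2 Hode)).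
        apply locally'_imp. intros z Hz ((e1 & e2) & d1 & _ & d2).
        pose proof (Cderive_unique _ _ _ _ d1 d2) as Eq. rewrite e1, e2 in Eq.
        apply Cminus_neq0 in Hz. assert (Hp : (z - a) ^ S n <> 0) by now apply Cpow_neq0.
        change ((z - a) ^ S (S n)) with ((z - a) * (z - a) ^ S n) in Eq.
        apply (f_equal (fun x => x * ((z - a) * (z - a) ^ S n))) in Eq.
        transitivity (((z - a) * C_derive g2 z - INR (S n) * g2 z) / ((z - a) * (z - a) ^ S n) *
          ((z - a) * (z - a) ^ S n)); [field; auto|]. rewrite Eq. field. auto. }
      destruct (holomorphic_at_factor g1 a Hg1) as [k1 [Hk1 F1]].
      destruct (holomorphic_at_factor g2 a Hg2) as [k2 [Hk2 F2]].
      apply (IH k1 k2 Hk1 Hk2).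
      + generalize L1. apply locally'_imp. intros z Hz ->. rewrite F1, Z1.
        apply Cminus_neq0 in Hz. simpl. field. split; auto. now apply Cpow_neq0.
      + generalize L2. apply locally'_imp. intros z Hz ->. rewrite F2, Z2.
        apply Cminus_neq0 in Hz. simpl. field. split; auto. now apply Cpow_neq0. }
  apply (K (n1 + n2)%nat (fun z => f1 z * (z - a) ^ n2) (fun z => f2 z * (z - a) ^ n1)).
  - apply holomorphic_at_mult; auto. apply holomorphic_at_pow, holomorphic_at_shift.
  - apply holomorphic_at_mult; auto. apply holomorphic_at_pow, holomorphic_at_shift.
  - generalize E1. apply locally'_imp. intros z Hz ->. apply Cminus_neq0 in Hz.
    rewrite Cpow_add_r. field. split; now apply Cpow_neq0.
  - generalize E2. apply locally'_imp. intros z Hz ->. apply Cminus_neq0 in Hz.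
    rewrite Cpow_add_r. field. split; now apply Cpow_neq0.
Qed.

(* [B0 = (p, q; r, -p)], [B1 = (u, v; w, -u)] in the coordinate [z = ln t]. *)
Definition pv_system (c e0 e1 : C) (p q r u v w : C -> C) (z : C) : Prop :=
  p z + u z = c /\ p z * p z + q z * r z = e0 /\ u z * u z + v z * w z = e1 /\
  is_derive p z (- (q z * w z - v z * r z)) /\
  is_derive q z (- 2 * (p z * v z - q z * u z)) /\
  is_derive r z (- 2 * (r z * u z - p z * w z)) /\
  is_derive u z (q z * w z - v z * r z) /\
  is_derive v z (2 * (p z * v z - q z * u z) + Cexp z * v z) /\
  is_derive w z (2 * (r z * u z - p z * w z) - Cexp z * w z).

(** The first three terms are [tr (B0 B1)] for trace-free matrices, so this is the [h] of the
    overview. *)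
Definition pv_ham (p q r u v w : C -> C) (z : C) : C :=
  2 * (p z * u z) + q z * w z + r z * v z + Cexp z * u z.

(** In [tr (B0 B1)'] the terms with [[B0, B1]] vanish under the trace, leaving [t tr (B0 [E, B1]) =
    - t u'], which cancels against [(t u)' = t u + t u']. *)
Lemma pv_ham_derive (c e0 e1 : C) (p q r u v w : C -> C) (z : C) :
  pv_system c e0 e1 p q r u v w z -> is_derive (pv_ham p q r u v w) z (Cexp z * u z).
Proof.
  intros (_ & _ & _ & Dp & Dq & Dr & Du & Dv & Dw). unfold pv_ham.
  eapply Cderive_eq.
  - apply Cderive_plus; [apply Cderive_plus; [apply Cderive_plus|]|].
    + apply Cderive_mult; [apply Cderive_const|]. apply Cderive_mult; eassumption.
    + apply Cderive_mult; eassumption.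
    + apply Cderive_mult; eassumption.
    + apply Cderive_mult; [apply is_derive_Cexp | eassumption].
  - ringC.
Qed.

(* The sigma form of the fifth Painleve equation, with [h = pv_ham] and [u = h' / t];
   the quartic terms in [u] cancel. *)
Lemma pv_sigma_form (c e0 e1 : C) (p q r u v w : C -> C) (z : C) :
  pv_system c e0 e1 p q r u v w z ->
  let D := q z * w z - v z * r z in let U := u z in let h := pv_ham p q r u v w z in
  let t := Cexp z in
  D * D = - (4) * t * (U * U * U) + 4 * h * (U * U)
    + ((2 * c + t) * (2 * c + t) + 4 * (e0 - c * c) + 4 * e1) * (U * U)
    - 2 * h * (2 * c + t) * U - 8 * c * e1 * U + h * h - 4 * (e0 - c * c) * e1.
Proof.
  intros (Hc & H0 & H1 & _). cbv zeta. unfold pv_ham.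
  rewrite <- H0, <- H1, <- Hc. ring.
Qed.

Lemma Cmult_eq0_reg (x y : C) : x * y = 0 -> x <> 0 -> y = 0.
Proof. intros H Hx. apply NNPP. intros Hy. now apply (Cmult_neq_0 x y). Qed.

Section PoleAnalysis.

Variables (c e0 e1 : C) (p q r u v w : C -> C) (a : C).
Hypothesis Hsys : locally' a (pv_system c e0 e1 p q r u v w).
Let h := pv_ham p q r u v w.

(** For a pole of order [N + 1] of [h], the terms [u'^2], [t u^3] and [h u^2] have pole orders
    [2 N + 6], [3 N + 6] and [3 N + 5]. If [N > 0] the cubic term is alone at the top, which is
    impossible; if [N = 0] it balances [u'^2] and this fixes the residue. *)
Lemma pv_ham_pole :
  pole_at h a -> exists k : C -> C,
    holomorphic_at k a /\ locally' a (fun z => h z = / (z - a) + k z).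
Proof.
  intros (N & k & HN & Hk & Hka & E).
  destruct N as [|N]; [lia|]. clear HN.
  set (U := fun z => ((z - a) * C_derive k z - INR (S N) * k z) / Cexp z).
  assert (HU : holomorphic_at U a).
  { apply holomorphic_at_div; [now apply holomorphic_at_laurent_derive | apply holomorphic_at_Cexp |].
    apply Cexp_neq0. }
  (* Numerator of [u'], just as [U] is the numerator of [u = h' / t]. *)
  set (V := fun z => (z - a) * C_derive U z - INR (S (S N)) * U z).
  assert (HV : holomorphic_at V a) by now apply holomorphic_at_laurent_derive.
  assert (EU : locally' a (fun z => u z = U z / (z - a) ^ S (S N))).
  { generalize (locally'_and _ _ a Hsys (is_derive_laurent h k a (S N) Hk E)).
    apply locally'_imp. intros z Hz [Hs D].
    pose proof (Cderive_unique _ _ _ _ (pv_ham_derive _ _ _ _ _ _ _ _ _ _ Hs) D) as Eq.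
    unfold U. apply Cminus_neq0 in Hz. pose proof (Cexp_neq0 z) as Ht.
    assert (Hp : (z - a) ^ S (S N) <> 0) by now apply Cpow_neq0.
    replace (u z) with (Cexp z * u z / Cexp z) by (field; auto). rewrite Eq.
    field. auto. }
  assert (Ua : U a = - (INR (S N) * k a) / Cexp a).
  { unfold U. pose proof (Cexp_neq0 a). field. auto. }
  assert (Ua0 : U a <> 0).
  { rewrite Ua. pose proof (Cexp_neq0 a). pose proof (RtoC_INR_neq0 (S N) ltac:(lia)).
    intros H1. apply (Cmult_neq_0 (INR (S N)) (k a)); auto.
    replace (INR (S N) * k a) with (- (- (INR (S N) * k a) / Cexp a * Cexp a)) by (field; auto).
    rewrite H1. ring. }
  set (X := fun z : C => z - a).
  (* The right side of the sigma form times [x^(3 (N + 2))], the pole order of the cubic term. All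
     other terms keep a positive power of [x], and the left side becomes [V^2 x^N]. *)
  set (W := fun z => - (4) * Cexp z * (U z * U z * U z) + X z * (4 * k z * (U z * U z))
    + ((2 * c + Cexp z) * (2 * c + Cexp z) + 4 * (e0 - c * c) + 4 * e1)
        * (U z * U z) * X z ^ (N + 2)
    - 2 * k z * (2 * c + Cexp z) * U z * X z ^ (N + 3) - 8 * c * e1 * U z * X z ^ (2 * (N + 2))
    + k z * k z * X z ^ (N + 4) - 4 * (e0 - c * c) * e1 * X z ^ (3 * (N + 2))).
  assert (EW : locally' a (fun z => V z * V z * X z ^ N = W z)).
  { generalize (locally'_and _ _ a (locally'_and _ _ a Hsys (is_derive_laurent u U a _ HU EU))
      (locally'_and _ _ a E EU)).
    apply locally'_imp. intros z Hz ((Hs & D) & Eh & Eu).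
    pose proof (pv_sigma_form _ _ _ _ _ _ _ _ _ _ Hs) as G. cbv zeta in G.
    assert (Du := Hs). destruct Du as (_ & _ & _ & _ & _ & _ & Du & _).
    rewrite (Cderive_unique _ _ _ _ Du D) in G. fold (V z) in G. fold h in G.
    rewrite Eh, Eu in G. apply Cminus_neq0 in Hz. fold (X z) in G, Hz |- *.
    unfold W. revert G Hz. generalize (X z) (V z) (U z) (k z) (Cexp z). clear.
    intros x V U k t G Hx.
    assert (Hn : x ^ N <> 0) by now apply Cpow_neq0.
    replace (3 * (N + 2))%nat with (N + N + N + 6)%nat by lia.
    replace (2 * (N + 2))%nat with (N + N + 4)%nat by lia.
    rewrite !Cpow_add_r. simpl Cpow in *. revert G Hn. generalize (x ^ N). intros y G Hn.
    apply (f_equal (fun g => g * (y * y * y * (x * x * x * x * x * x)))) in G.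
    transitivity (V / (x * (x * (x * y))) * (V / (x * (x * (x * y)))) *
      (y * y * y * (x * x * x * x * x * x))); [field; auto|].
    rewrite G. field. auto. }
  assert (HW : ex_derive W a).
  { apply holomorphic_at_ex. unfold W, X.
    holo. }
  assert (HL : ex_derive (fun z => V z * V z * X z ^ N) a).
  { apply holomorphic_at_ex. unfold X.
    holo. }
  pose proof (punctured_limit _ _ a HL HW EW) as G. cbv beta in G. unfold W in G.
  assert (X0 : X a = 0) by (unfold X; ring). rewrite X0 in G.
  assert (P0 : forall n, RtoC 0 ^ (n + 1) = 0) by (intros n; rewrite Cpow_add_r; simpl; ring).
  (* Each exponent is displayed as a successor, so that the power of 0 visibly vanishes. *)
  replace (N + 2)%nat with (N + 1 + 1)%nat in G by lia.
  replace (N + 3)%nat with (N + 2 + 1)%nat in G by lia.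
  replace (N + 4)%nat with (N + 3 + 1)%nat in G by lia.
  replace (2 * (N + 1 + 1))%nat with (2 * N + 3 + 1)%nat in G by lia.
  replace (3 * (N + 1 + 1))%nat with (3 * N + 5 + 1)%nat in G by lia.
  rewrite !P0 in G.
  pose proof (Cexp_neq0 a) as Ht.
  assert (four : RtoC 4 <> 0) by (intros H; apply RtoC_inj in H; lra).
  assert (G' : V a * V a * 0 ^ N = - (4) * Cexp a * (U a * U a * U a)) by (rewrite G; ring).
  (* For [N = 0] the factor [0 ^ 0] is 1 and [V a = - 2 U a], so [t U a = -1]; since
     [t U a = - k a], the residue [k a] is 1. Otherwise the left side is 0 and forces [U a = 0]. *)
  clear G. destruct N as [|N].
  - assert (Va : V a = - (2) * U a).
    { unfold V. replace (RtoC (INR 2)) with (RtoC 2) by (f_equal; simpl; ring). ring. }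
    rewrite Va in G'.
    assert (G2 : 4 * U a * U a * (1 + Cexp a * U a) = 0).
    { transitivity (- (2) * U a * (- (2) * U a) * 0 ^ 0 - - (4) * Cexp a * (U a * U a * U a)).
      - simpl. ring.
      - rewrite G'. ring. }
    assert (G3 : 1 + Cexp a * U a = 0).
    { apply (Cmult_eq0_reg _ _ G2). apply Cmult_neq_0; [apply Cmult_neq_0|]; auto. }
    clear G2. rename G3 into G2. rewrite Ua in G2.
    replace (RtoC (INR 1)) with (RtoC 1) in G2 by (f_equal; simpl; ring).
    assert (k1 : k a = 1).
    { replace (k a) with (1 - (1 + Cexp a * (- (1 * k a) / Cexp a))) by (field; auto).
      rewrite G2. ring. }
    destruct (holomorphic_at_factor k a Hk) as [k' [Hk' F]].
    exists k'. split; [exact Hk'|]. generalize E. apply locally'_imp. intros z Hz ->.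
    apply Cminus_neq0 in Hz. rewrite F, k1. simpl. field. auto.
  - exfalso. simpl in G'.
    assert (G2 : 4 * Cexp a * (U a * U a) * U a = 0).
    { transitivity (- (- (4) * Cexp a * (U a * U a * U a))); [ring|]. rewrite <- G'. ring. }
    apply Ua0. apply (Cmult_eq0_reg _ _ G2). apply Cmult_neq_0; apply Cmult_neq_0; auto.
Qed.

Hypotheses (Mq : mero_at q a) (Mr : mero_at r a) (Mv : mero_at v a) (Mw : mero_at w a).

(** The functions [u = h' / t] and [p = c - u] come first. The remaining equations split into linear
    systems for the pairs [q, v] and [r, w]. Only removability is claimed, because the values of the
    entries at [a] are arbitrary. *)
Lemma pv_ham_regular (H : C -> C) :
  holomorphic_at H a -> locally' a (fun z => h z = H z) ->
  exists p' q' r' u' v' w' : C -> C,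
    (holomorphic_at p' a /\ locally' a (fun z => p z = p' z)) /\
    (holomorphic_at q' a /\ locally' a (fun z => q z = q' z)) /\
    (holomorphic_at r' a /\ locally' a (fun z => r z = r' z)) /\
    (holomorphic_at u' a /\ locally' a (fun z => u z = u' z)) /\
    (holomorphic_at v' a /\ locally' a (fun z => v z = v' z)) /\
    (holomorphic_at w' a /\ locally' a (fun z => w z = w' z)).
Proof.
  intros HH E.
  set (U := fun z => C_derive H z / Cexp z). set (P := fun z => c - U z).
  assert (HU : holomorphic_at U a).
  { apply holomorphic_at_div; [now apply holomorphic_at_derive | apply holomorphic_at_Cexp |].
    apply Cexp_neq0. }
  assert (HP : holomorphic_at P a).
  { apply holomorphic_at_minus; [apply holomorphic_at_const | exact HU]. }
  assert (EU : locally' a (fun z => u z = U z)).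
  { generalize (locally'_and _ _ a (locally'_and _ _ a Hsys (locally_locally' _ a HH))
      (locally'_twice _ a E)).
    apply locally'_imp. intros z _ ((Hs & Hz) & Ez).
    assert (D : is_derive h z (C_derive H z)).
    { apply (Cderive_ext_loc H); [|exact (C_derive_correct H z 0 Hz)].
      generalize Ez. apply locally_imp. auto. }
    pose proof (Cderive_unique _ _ _ _ (pv_ham_derive _ _ _ _ _ _ _ _ _ _ Hs) D) as Eq.
    unfold U. rewrite <- Eq. pose proof (Cexp_neq0 z). field. auto. }
  assert (EP : locally' a (fun z => p z = P z)).
  { generalize (locally'_and _ _ a Hsys EU). apply locally'_imp. intros z _ [(Hc & _) Eu].
    unfold P. rewrite <- Eu, <- Hc. ring. }
  assert (EUP := locally'_and _ _ a Hsys (locally'_and _ _ a EU EP)).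
  destruct (linear_ode_removable (fun z => 2 * U z) (fun z => - 2 * P z)
    (fun z => - 2 * U z) (fun z => 2 * P z + Cexp z) q v a) as (q' & v' & Hq & Hv & Eqv); auto;
    try holo.
  { generalize EUP. apply locally'_imp.
    intros z _ ((_ & _ & _ & _ & Dq & _ & _ & Dv & _) & <- & <-).
    split; eapply Cderive_eq; try eassumption; ringC. }
  destruct (linear_ode_removable (fun z => - 2 * U z) (fun z => 2 * P z)
    (fun z => 2 * U z) (fun z => - 2 * P z - Cexp z) r w a) as (r' & w' & Hr & Hw & Erw); auto;
    try holo.
  { generalize EUP. apply locally'_imp.
    intros z _ ((_ & _ & _ & _ & _ & Dr & _ & _ & Dw) & <- & <-).
    split; eapply Cderive_eq; try eassumption; ringC. }
  exists P, q', r', U, v', w'. repeat split; auto.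
  - generalize Eqv. apply locally'_imp. now intros z _ [E1 _].
  - generalize Erw. apply locally'_imp. now intros z _ [E1 _].
  - generalize Eqv. apply locally'_imp. now intros z _ [_ E1].
  - generalize Erw. apply locally'_imp. now intros z _ [_ E1].
Qed.

End PoleAnalysis.

(** * Integrating a logarithmic derivative *)


Section LogarithmicPrimitive.

Variables (h : C -> C) (Th : C -> Prop).
Hypothesis h_holo : forall s, ~ Th s -> holomorphic_at h s.
Hypothesis h_pole : forall s, Th s ->
  exists k : C -> C, holomorphic_at k s /\ locally' s (fun z => h z = / (z - s) + k z).
Hypothesis Th_isolated : forall s, locally' s (fun z => ~ Th z).

(** The equation [tau' = h tau] is used without division, and only off [Th], where the value of [h]
    is meaningful. Asking for a derivative everywhere makes [tau] holomorphic across [Th] as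
    well. *)
Definition tau_on (U : C -> Prop) (tau : C -> C) : Prop :=
  forall z, U z -> exists d : C, is_derive tau z d /\ (Th z -> tau z = 0) /\
    (~ Th z -> tau z <> 0 /\ d = h z * tau z).

Lemma tau_on_sub (U V : C -> Prop) (tau : C -> C) :
  (forall z, V z -> U z) -> tau_on U tau -> tau_on V tau.
Proof. intros H Ht z Hz. apply Ht. auto. Qed.

(** Near a pole, [h = 1 / (z - a) + k] integrates to [(z - a)] times the exponential of a primitive
    of [k]: residue 1 gives a single-valued factor with a zero. Elsewhere the exponential of a
    primitive of [h] suffices. *)
Lemma tau_local (a : C) :
  exists (r : R) (tau : C -> C), (0 < r)%R /\ tau_on (fun z => (Cmod (z - a) < r)%R) tau.
Proof.
  destruct (classic (Th a)) as [Ha|Ha].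
  - destruct (h_pole a Ha) as (k & Hk & E).
    pose proof (locally_and _ _ a Hk (locally_and _ _ a E (Th_isolated a))) as L.
    apply locally_Cmod in L. destruct L as [r [Hr L]].
    destruct (primitive_disc k a r) as [K HK]. { intros z Hz. now apply L. }
    exists r, (fun z => (z - a) * Cexp (K z)). split; [exact Hr|]. intros z Hz.
    assert (D : is_derive (fun z => (z - a) * Cexp (K z)) z
      (Cexp (K z) + (z - a) * (k z * Cexp (K z)))).
    { eapply Cderive_eq.
      - apply Cderive_mult; [apply Cderive_minus; [apply Cderive_id|apply Cderive_const]|].
        apply (Cderive_comp Cexp K z _ _ (is_derive_Cexp _) (HK z Hz)).
      - ringC. }
    eexists. split; [exact D|]. destruct (L z Hz) as (_ & L1 & L2).
    destruct (classic (z = a)) as [->|Hza].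
    + split; [intros _; ring | contradiction].
    + pose proof (Cminus_neq0 z a Hza) as Hx. split.
      * intros HT. exfalso. now apply L2.
      * intros _. split.
        -- apply Cmult_neq_0; [exact Hx | apply Cexp_neq0].
        -- rewrite L1 by exact Hza. field. exact Hx.
  - assert (Hn : locally a (fun z => ~ Th z)).
    { generalize (Th_isolated a). apply locally_imp. intros z Hz.
      destruct (classic (z = a)) as [->|Hne]; auto. }
    pose proof (locally_and _ _ a (h_holo a Ha) Hn) as L.
    apply locally_Cmod in L. destruct L as [r [Hr L]].
    destruct (primitive_disc h a r) as [K HK]. { intros z Hz. now apply L. }
    exists r, (fun z => Cexp (K z)). split; [exact Hr|]. intros z Hz.
    eexists. split; [exact (Cderive_comp Cexp K z _ _ (is_derive_Cexp _) (HK z Hz))|].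
    split; [intros HT; exfalso; now apply (L z Hz)|]. intros _. split; [apply Cexp_neq0|reflexivity].
Qed.

Definition Copen (U : C -> Prop) : Prop := forall z, U z -> locally z U.

Lemma tau_on_holomorphic (U : C -> Prop) (tau : C -> C) (z : C) :
  Copen U -> tau_on U tau -> U z -> holomorphic_at tau z.
Proof.
  intros HU Ht Hz. generalize (HU z Hz). apply locally_imp. intros y Hy.
  destruct (Ht y Hy) as (d & D & _). now exists d.
Qed.

(** Near [b] the quotient has derivative zero. It is undefined on [Th], so the difference, which is
    holomorphic, carries the equality to the rest of [U] by the identity theorem. *)
Lemma tau_unique (U : C -> Prop) (tau1 tau2 : C -> C) (b : C) :
  Cconvex U -> Copen U -> tau_on U tau1 -> tau_on U tau2 ->
  U b -> ~ Th b -> tau1 b = tau2 b -> forall z, U z -> tau1 z = tau2 z.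
Proof.
  intros HU HO H1 H2 Hb HTb Eb z Hz.
  assert (Hn : locally b (fun z => U z /\ ~ Th z)).
  { apply locally_and; [now apply HO|]. generalize (Th_isolated b). apply locally_imp.
    intros y Hy. destruct (classic (y = b)) as [->|Hne]; auto. }
  apply locally_Cmod in Hn. destruct Hn as [r [Hr Hn]].
  assert (Hq : forall y, (Cmod (y - b) < r)%R -> tau1 y / tau2 y = tau1 b / tau2 b).
  { apply (derive_zero_const (fun y => tau1 y / tau2 y)). intros y Hy.
    destruct (Hn y Hy) as [Uy Ty].
    destruct (H1 y Uy) as (d1 & D1 & _ & K1). destruct (H2 y Uy) as (d2 & D2 & _ & K2).
    destruct (K1 Ty) as [N1 ->]. destruct (K2 Ty) as [N2 ->].
    eapply Cderive_eq; [apply (Cderive_div _ _ _ _ _ D1 D2 N2)|]. toC. field. exact N2. }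
  assert (L0 : locally' b (fun y => tau1 y - tau2 y = 0)).
  { apply locally_locally', locally_Cmod. exists r. split; [exact Hr|]. intros y Hy.
    destruct (Hn y Hy) as [Uy Ty].
    destruct (H2 y Uy) as (? & _ & _ & K2). destruct (K2 Ty) as [N2 _].
    destruct (H2 b Hb) as (? & _ & _ & K3). destruct (K3 HTb) as [N3 _].
    specialize (Hq y Hy). rewrite Eb in Hq.
    replace (tau1 y) with (tau1 y / tau2 y * tau2 y) by (field; exact N2).
    rewrite Hq. field. exact N3. }
  assert (M : forall y, U y -> mero_at (fun y => tau1 y - tau2 y) y).
  { intros y Hy. apply holomorphic_mero, holomorphic_at_minus; now apply (tau_on_holomorphic U). }
  pose proof (identity_theorem U _ b z HU Hb Hz M L0) as Lz.
  apply punctured_limit.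
  - now apply holomorphic_at_ex, (tau_on_holomorphic U).
  - now apply holomorphic_at_ex, (tau_on_holomorphic U).
  - generalize Lz. apply locally'_imp. intros y _ E.
    replace (tau1 y) with (tau1 y - tau2 y + tau2 y) by ring. rewrite E. ring.
Qed.

Lemma tau_on_scale (U : C -> Prop) (tau : C -> C) (c : C) :
  c <> 0 -> tau_on U tau -> tau_on U (fun z => c * tau z).
Proof.
  intros Hc H z Hz. destruct (H z Hz) as (d & D & K1 & K2). exists (c * d). split.
  - eapply Cderive_eq; [apply Cderive_mult; [apply Cderive_const | exact D]|]. ringC.
  - split.
    + intros HT. rewrite K1 by exact HT. ring.
    + intros HT. destruct (K2 HT) as [K3 ->]. split; [now apply Cmult_neq_0 | ring].
Qed.

(** Locality of the conditions, expressed by restricting [tau_on] to a single point; needed for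
    functions defined by cases. *)
Lemma tau_on_ext_loc (tau tau' : C -> C) (z : C) :
  locally z (fun y => tau y = tau' y) ->
  tau_on (fun y => y = z) tau -> tau_on (fun y => y = z) tau'.
Proof.
  intros E H y ->. destruct (H z eq_refl) as (d & D & K). exists d. split.
  - now apply (Cderive_ext_loc tau).
  - rewrite <- (locally_self _ z E). exact K.
Qed.

(** Solutions are compared and normalized at such a point, since they vanish on [Th]. *)
Lemma exists_regular (U : C -> Prop) (b : C) : Copen U -> U b -> exists c, U c /\ ~ Th c.
Proof.
  intros HO Hb.
  destruct (locally'_nonempty _ b (locally'_and _ _ b (locally_locally' _ b (HO b Hb)) (Th_isolated b)))
    as (c & _ & H). now exists c.
Qed.

(** Two solutions on a convex open overlap differ by a constant factor, read off at a regular point;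
    rescaling the second makes them agree. *)
Lemma tau_glue (U1 U2 : C -> Prop) (tau1 tau2 : C -> C) (b : C) :
  Copen U1 -> Copen U2 -> Cconvex (fun z => U1 z /\ U2 z) -> U1 b -> U2 b ->
  tau_on U1 tau1 -> tau_on U2 tau2 ->
  exists tau : C -> C, tau_on (fun z => U1 z \/ U2 z) tau.
Proof.
  intros HO1 HO2 HC Hb1 Hb2 H1 H2.
  assert (HO : Copen (fun z => U1 z /\ U2 z)).
  { intros z [Hz1 Hz2]. apply locally_and; auto. }
  destruct (exists_regular _ b HO (conj Hb1 Hb2)) as (c & [Hc1 Hc2] & HTc).
  destruct (H1 c Hc1) as (? & _ & _ & K1). destruct (K1 HTc) as [N1 _].
  destruct (H2 c Hc2) as (? & _ & _ & K2). destruct (K2 HTc) as [N2 _].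
  set (m := tau1 c / tau2 c).
  assert (Hm : m <> 0) by (apply Cmult_neq_0; [exact N1 | now apply Cinv_neq0]).
  pose proof (tau_on_scale U2 tau2 m Hm H2) as H3.
  assert (Eq : forall z, U1 z /\ U2 z -> tau1 z = m * tau2 z).
  { apply (tau_unique _ tau1 (fun z => m * tau2 z) c HC HO); auto.
    - apply (tau_on_sub U1); [now intros z [Hz _] | exact H1].
    - apply (tau_on_sub U2); [now intros z [_ Hz] | exact H3].
    - unfold m. field. exact N2. }
  exists (fun z => if excluded_middle_informative (U1 z) then tau1 z else m * tau2 z).
  intros z Hz.
  refine (tau_on_ext_loc _ _ z _ _ z eq_refl); destruct (classic (U1 z)) as [Hz1|Hz1].
  - instantiate (1 := if excluded_middle_informative (U1 z) then tau1 else fun z => m * tau2 z).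
    destruct (excluded_middle_informative (U1 z)) as [_|Hn]; [|contradiction].
    generalize (HO1 z Hz1). apply locally_imp. intros y Hy.
    destruct (excluded_middle_informative (U1 y)); [reflexivity | contradiction].
  - destruct (excluded_middle_informative (U1 z)) as [Hn|_]; [contradiction|].
    destruct Hz as [Hz|Hz]; [contradiction|].
    generalize (HO2 z Hz). apply locally_imp. intros y Hy.
    destruct (excluded_middle_informative (U1 y)); [symmetry; auto | reflexivity].
  - destruct (excluded_middle_informative (U1 z)) as [_|Hn]; [|contradiction].
    intros y ->. auto.
  - destruct (excluded_middle_informative (U1 z)) as [Hn|_]; [contradiction|].
    destruct Hz as [Hz|Hz]; [contradiction|]. intros y ->. auto.
Qed.

(** * Covering the plane by rectangles *)

Definition rect (x1 x2 y1 y2 : R) (z : C) : Prop :=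
  (x1 < Re z < x2)%R /\ (y1 < Im z < y2)%R.

Lemma Re_path (A B : C) (t : R) : Re (path A B t) = ((1 - t) * Re A + t * Re B)%R.
Proof.
  destruct A as [a1 a2]; destruct B as [b1 b2].
  unfold path, Cminus, RtoC, Cmult, Cplus, Copp, Re; cbn [fst snd]. ring.
Qed.

Lemma Im_path (A B : C) (t : R) : Im (path A B t) = ((1 - t) * Im A + t * Im B)%R.
Proof.
  destruct A as [a1 a2]; destruct B as [b1 b2].
  unfold path, Cminus, RtoC, Cmult, Cplus, Copp, Im; cbn [fst snd]. ring.
Qed.

Lemma Cconvex_rect (x1 x2 y1 y2 : R) : Cconvex (rect x1 x2 y1 y2).
Proof.
  intros A B [HA1 HA2] [HB1 HB2] t Ht. unfold rect. rewrite Re_path, Im_path.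
  assert (K : forall l h x y : R, (l < x < h)%R -> (l < y < h)%R -> (l < (1 - t) * x + t * y < h)%R).
  { intros l k x y Hx Hy. destruct (Req_dec t 0) as [->|Ht0]; [lra|].
    assert (0 <= (1 - t) * (x - l))%R by (apply Rmult_le_pos; lra).
    assert (0 <= (1 - t) * (k - x))%R by (apply Rmult_le_pos; lra).
    assert (0 < t * (y - l))%R by (apply Rmult_lt_0_compat; lra).
    assert (0 < t * (k - y))%R by (apply Rmult_lt_0_compat; lra). lra. }
  split; now apply K.
Qed.

Lemma Copen_rect (x1 x2 y1 y2 : R) : Copen (rect x1 x2 y1 y2).
Proof.
  intros z [H1 H2].
  set (d := Rmin (Rmin (Re z - x1) (x2 - Re z)) (Rmin (Im z - y1) (y2 - Im z))).
  assert (Hd : (0 < d)%R) by (repeat apply Rmin_pos; lra).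
  assert (D1 : (d <= Re z - x1)%R) by (eapply Rle_trans; [apply Rmin_l|apply Rmin_l]).
  assert (D2 : (d <= x2 - Re z)%R) by (eapply Rle_trans; [apply Rmin_l|apply Rmin_r]).
  assert (D3 : (d <= Im z - y1)%R) by (eapply Rle_trans; [apply Rmin_r|apply Rmin_l]).
  assert (D4 : (d <= y2 - Im z)%R) by (eapply Rle_trans; [apply Rmin_r|apply Rmin_r]).
  apply locally_Cmod. exists d. split; [exact Hd|]. intros y Hy.
  pose proof (re_le_Cmod (y - z)) as A1. pose proof (im_le_Cmod (y - z)) as A2.
  change (Re (y - z)) with (Re y - Re z)%R in A1. change (Im (y - z)) with (Im y - Im z)%R in A2.
  apply Rabs_le_between in A1. apply Rabs_le_between in A2.
  unfold rect. lra.
Qed.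

(** A closed, possibly degenerate rectangle together with an open margin: closed rectangles sharing
    an edge then have overlapping neighbourhoods. *)
Definition tau_near (x1 x2 y1 y2 : R) : Prop :=
  exists (d : R) (tau : C -> C), (0 < d)%R /\ tau_on (rect (x1 - d) (x2 + d) (y1 - d) (y2 + d)) tau.

Lemma tau_near_sub (x1 x2 y1 y2 x1' x2' y1' y2' : R) :
  (x1 <= x1')%R -> (x2' <= x2)%R -> (y1 <= y1')%R -> (y2' <= y2)%R ->
  tau_near x1 x2 y1 y2 -> tau_near x1' x2' y1' y2'.
Proof.
  intros H1 H2 H3 H4 (d & tau & Hd & H). exists d, tau. split; [exact Hd|].
  apply (tau_on_sub (rect (x1 - d) (x2 + d) (y1 - d) (y2 + d))); [|exact H].
  intros z [Hz1 Hz2]. unfold rect. lra.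
Qed.

(** With a common margin the two open rectangles meet in a rectangle around the shared edge, and
    this overlap is convex. *)
Lemma tau_near_glue_x (x1 x2 x3 y1 y2 : R) :
  (x1 <= x2 <= x3)%R -> (y1 <= y2)%R ->
  tau_near x1 x2 y1 y2 -> tau_near x2 x3 y1 y2 -> tau_near x1 x3 y1 y2.
Proof.
  intros Hx Hy (d1 & t1 & Hd1 & H1) (d2 & t2 & Hd2 & H2).
  set (d := Rmin d1 d2). assert (Hd : (0 < d)%R) by now apply Rmin_pos.
  assert (L1 : (d <= d1)%R) by apply Rmin_l. assert (L2 : (d <= d2)%R) by apply Rmin_r.
  destruct (tau_glue (rect (x1 - d) (x2 + d) (y1 - d) (y2 + d))
    (rect (x2 - d) (x3 + d) (y1 - d) (y2 + d)) t1 t2 (x2, y1)) as [t Ht].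
  - apply Copen_rect.
  - apply Copen_rect.
  - intros A B [A1 A2] [B1 B2] s Hs. split; now apply Cconvex_rect.
  - unfold rect, Re, Im; cbn [fst snd]. lra.
  - unfold rect, Re, Im; cbn [fst snd]. lra.
  - eapply tau_on_sub; [|exact H1]. intros z [Hz1 Hz2]. unfold rect. lra.
  - eapply tau_on_sub; [|exact H2]. intros z [Hz1 Hz2]. unfold rect. lra.
  - exists d, t. split; [exact Hd|]. eapply tau_on_sub; [|exact Ht].
    intros z [Hz1 Hz2]. unfold rect.
    destruct (Rlt_dec (Re z) (x2 + d)); [left | right]; lra.
Qed.

Lemma tau_near_glue_y (x1 x2 y1 y2 y3 : R) :
  (x1 <= x2)%R -> (y1 <= y2 <= y3)%R ->
  tau_near x1 x2 y1 y2 -> tau_near x1 x2 y2 y3 -> tau_near x1 x2 y1 y3.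
Proof.
  intros Hx Hy (d1 & t1 & Hd1 & H1) (d2 & t2 & Hd2 & H2).
  set (d := Rmin d1 d2). assert (Hd : (0 < d)%R) by now apply Rmin_pos.
  assert (L1 : (d <= d1)%R) by apply Rmin_l. assert (L2 : (d <= d2)%R) by apply Rmin_r.
  destruct (tau_glue (rect (x1 - d) (x2 + d) (y1 - d) (y2 + d))
    (rect (x1 - d) (x2 + d) (y2 - d) (y3 + d)) t1 t2 (x1, y2)) as [t Ht].
  - apply Copen_rect.
  - apply Copen_rect.
  - intros A B [A1 A2] [B1 B2] s Hs. split; now apply Cconvex_rect.
  - unfold rect, Re, Im; cbn [fst snd]. lra.
  - unfold rect, Re, Im; cbn [fst snd]. lra.
  - eapply tau_on_sub; [|exact H1]. intros z [Hz1 Hz2]. unfold rect. lra.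
  - eapply tau_on_sub; [|exact H2]. intros z [Hz1 Hz2]. unfold rect. lra.
  - exists d, t. split; [exact Hd|]. eapply tau_on_sub; [|exact Ht].
    intros z [Hz1 Hz2]. unfold rect.
    destruct (Rlt_dec (Im z) (y2 + d)); [left | right]; lra.
Qed.

(** Cousin's principle twice: vertically to obtain a thin strip over each abscissa, then
    horizontally to join the strips. *)
Lemma tau_near_all (x1 x2 y1 y2 : R) : (x1 <= x2)%R -> (y1 <= y2)%R -> tau_near x1 x2 y1 y2.
Proof.
  intros Hx Hy.
  assert (strip : forall x, exists d : R, (0 < d)%R /\ tau_near (x - d) (x + d) y1 y2).
  { intros x.
    apply (cousin (fun u v => exists d : R, (0 < d)%R /\ tau_near (x - d) (x + d) u v)); [exact Hy| |].
    (* The half width of the strip is part of the property, since it may shrink at each gluing. *)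
    - intros u v w Huvw (d1 & Hd1 & H1) (d2 & Hd2 & H2).
      assert (Hd : (0 < Rmin d1 d2)%R) by now apply Rmin_pos.
      pose proof (Rmin_l d1 d2). pose proof (Rmin_r d1 d2).
      exists (Rmin d1 d2). split; [exact Hd|]. apply (tau_near_glue_y _ _ u v w); [lra|lra| |].
      + eapply tau_near_sub; [| | | |exact H1]; lra.
      + eapply tau_near_sub; [| | | |exact H2]; lra.
    - intros y _. destruct (tau_local (x, y)) as (r & t & Hr & Ht).
      (* Interval and margin together stay within [r / 4] of the center in each coordinate, hence
         inside the disc of radius [r]. *)
      exists (r / 8)%R. split; [lra|]. intros u v Hu Hv. exists (r / 8)%R. split; [lra|].
      exists (r / 8)%R, t. split; [lra|]. eapply tau_on_sub; [|exact Ht].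
      intros z [Hz1 Hz2]. eapply Rle_lt_trans; [apply Cmod_le_Re_Im|].
      change (Re (z - (x, y))) with (Re z - x)%R. change (Im (z - (x, y))) with (Im z - y)%R.
      assert (Rabs (Re z - x) < r / 3)%R by (apply Rabs_def1; lra).
      assert (Rabs (Im z - y) < r / 3)%R by (apply Rabs_def1; lra). lra. }
  apply (cousin (fun u v => tau_near u v y1 y2)); [exact Hx| |].
  - intros u v w Huvw. now apply tau_near_glue_x.
  - intros x _. destruct (strip x) as (d & Hd & H). exists d. split; [exact Hd|].
    intros u v Hu Hv. eapply tau_near_sub; [| | | |exact H]; lra.
Qed.

(** The squares [Sq n] increase and all contain the regular point [b]. Solutions normalized to 1 at
    [b] agree on smaller squares, so the value at [z] may be taken from any square containing
    [z]. *)
Lemma tau_global : exists tau : C -> C, tau_on (fun _ => True) tau.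
Proof.
  destruct (exists_regular (fun _ => True) 0) as (b & _ & HTb); [|exact I|].
  { intros z _. apply locally_Cmod. exists 1%R. split; [lra|auto]. }
  set (L := fun n : nat => (Rabs (Re b) + Rabs (Im b) + 1 + INR n)%R).
  set (Sq := fun n => rect (- L n) (L n) (- L n) (L n)).
  assert (bSq : forall n, Sq n b).
  { intros n. unfold Sq, rect, L. pose proof (pos_INR n).
    pose proof (Rle_abs (Re b)). pose proof (Rle_abs (Im b)).
    pose proof (Rle_abs (- Re b)). pose proof (Rle_abs (- Im b)).
    rewrite !Rabs_Ropp in *.
    pose proof (Rabs_pos (Re b)). pose proof (Rabs_pos (Im b)). lra. }
  assert (ex : forall n, exists tau, tau_on (Sq n) tau /\ tau b = 1).
  { intros n. assert (HL : (0 <= L n)%R).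
    { unfold L. pose proof (pos_INR n).
      pose proof (Rabs_pos (Re b)). pose proof (Rabs_pos (Im b)). lra. }
    destruct (tau_near_all (- L n) (L n) (- L n) (L n)) as (d & t & Hd & Ht); [lra|lra|].
    assert (Ht' : tau_on (Sq n) t).
    { eapply tau_on_sub; [|exact Ht]. intros z [Hz1 Hz2]. unfold rect. lra. }
    destruct (Ht' b (bSq n)) as (? & _ & _ & K). destruct (K HTb) as [K1 _].
    exists (fun z => / t b * t z). split.
    - apply tau_on_scale; [now apply Cinv_neq0 | exact Ht'].
    - field. exact K1. }
  set (T := fun n => proj1_sig (constructive_indefinite_description _ (ex n))).
  assert (HT : forall n, tau_on (Sq n) (T n) /\ T n b = 1).
  { intros n. unfold T. now destruct (constructive_indefinite_description _ (ex n)). }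
  set (N := fun z : C => Z.to_nat (up (Rabs (Re z) + Rabs (Im z)))).
  assert (HN : forall z, Sq (N z) z).
  { intros z. destruct (archimed (Rabs (Re z) + Rabs (Im z))) as [Ha _].
    pose proof (Rabs_pos (Re z)) as P1. pose proof (Rabs_pos (Im z)) as P2.
    assert (E : (Rabs (Re z) + Rabs (Im z) < INR (N z))%R).
    { unfold N. rewrite INR_IZR_INZ, Z2Nat.id; [lra|]. apply le_IZR. lra. }
    unfold Sq, rect, L. pose proof (Rabs_pos (Re b)). pose proof (Rabs_pos (Im b)).
    assert (K1 : (Rabs (Re z) < Rabs (Re b) + Rabs (Im b) + 1 + INR (N z))%R) by lra.
    assert (K2 : (Rabs (Im z) < Rabs (Re b) + Rabs (Im b) + 1 + INR (N z))%R) by lra.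
    apply Rabs_def2 in K1. apply Rabs_def2 in K2. lra. }
  assert (agree : forall n m z, (n <= m)%nat -> Sq n z -> T n z = T m z).
  { intros n m z Hnm Hz. destruct (HT n) as [A1 A2]. destruct (HT m) as [B1 B2].
    apply (tau_unique (Sq n) (T n) (T m) b); auto.
    - apply Cconvex_rect.
    - apply Copen_rect.
    - eapply tau_on_sub; [|exact B1]. intros y [Y1 Y2]. apply le_INR in Hnm.
      unfold Sq, rect, L in *. lra.
    - congruence. }
  exists (fun z => T (N z) z). intros z _.
  apply (tau_on_ext_loc (T (N z)) (fun z => T (N z) z) z); [|intros y ->; now apply HT|reflexivity].
  (* Nearby points may select another index; whichever is larger, [agree] identifies the two
     solutions there. *)
  generalize (Copen_rect _ _ _ _ z (HN z)). apply locally_imp. intros y Hy.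
  destruct (le_lt_dec (N z) (N y)) as [Hle|Hlt].
  - now apply agree.
  - symmetry. apply agree; [lia|]. apply HN.
Qed.

End LogarithmicPrimitive.

(** * The isomonodromic family *)


Lemma entry_mxadd (A B : mx2) (i j : nat) :
  (i < 2)%nat -> (j < 2)%nat -> entry (mxadd A B) i j = entry A i j + entry B i j.
Proof.
  intros Hi Hj. destruct i as [|[|i]]; [| |lia]; (destruct j as [|[|j]]; [| |lia]); reflexivity.
Qed.

Lemma entry_mxscal (c : C) (A : mx2) (i j : nat) :
  (i < 2)%nat -> (j < 2)%nat -> entry (mxscal c A) i j = c * entry A i j.
Proof.
  intros Hi Hj. destruct i as [|[|i]]; [| |lia]; (destruct j as [|[|j]]; [| |lia]); reflexivity.
Qed.

Lemma entry_mxsub (A B : mx2) (i j : nat) :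
  (i < 2)%nat -> (j < 2)%nat -> entry (mxsub A B) i j = entry A i j - entry B i j.
Proof.
  intros Hi Hj. destruct i as [|[|i]]; [| |lia]; (destruct j as [|[|j]]; [| |lia]); reflexivity.
Qed.

Lemma entry_mxmul (A B : mx2) (i j : nat) :
  (i < 2)%nat -> (j < 2)%nat ->
  entry (mxmul A B) i j = entry A i 0 * entry B 0 j + entry A i 1 * entry B 1 j.
Proof.
  intros Hi Hj.
  assert (E : entry (mxmul A B) i j =
    sum_n (fun l => mult (entry A i l) (entry B l j)) 1).
  { destruct i as [|[|i]]; [| |lia]; (destruct j as [|[|j]]; [| |lia]); reflexivity. }
  rewrite E, sum_Sn, sum_O. reflexivity.
Qed.

Lemma entry_out (A : mx2) (i j : nat) : ~ ((i < 2)%nat /\ (j < 2)%nat) -> entry A i j = 0.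
Proof.
  intros H. destruct i as [|[|i]]; [| |now destruct j as [|[|j]]];
    (destruct j as [|[|j]]; [exfalso; lia | exfalso; lia | reflexivity]).
Qed.

(** Multiplying [(A - l) x = 0] by the adjugate gives [det (A - l) x = 0], and [x] has a nonzero
    entry. *)
Lemma eigenvalue_charpoly (A : mx2) (l : C) :
  is_eigenvalue A l ->
  (entry A 0 0 - l) * (entry A 1 1 - l) - entry A 0 1 * entry A 1 0 = 0.
Proof.
  intros [x [Hx E]].
  assert (K : forall i, (i < 2)%nat ->
    entry A i 0 * entry x 0 0 + entry A i 1 * entry x 1 0 = l * entry x i 0).
  { intros i Hi. transitivity (entry (@Mmult C_Ring 2 2 1 A x) i 0).
    - assert (E' : entry (@Mmult C_Ring 2 2 1 A x) i 0 =
        sum_n (fun k => mult (entry A i k) (entry x k 0)) 1).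
      { destruct i as [|[|i]]; [| |lia]; reflexivity. }
      rewrite E', sum_Sn, sum_O. reflexivity.
    - rewrite E. destruct i as [|[|i]]; [| |lia]; reflexivity. }
  pose proof (K 0%nat ltac:(lia)) as K0. pose proof (K 1%nat ltac:(lia)) as K1.
  set (D := (entry A 0 0 - l) * (entry A 1 1 - l) - entry A 0 1 * entry A 1 0).
  assert (D0 : D * entry x 0 0 = 0).
  { transitivity ((entry A 1 1 - l) * (entry A 0 0 * entry x 0 0 + entry A 0 1 * entry x 1 0
      - l * entry x 0 0) - entry A 0 1 * (entry A 1 0 * entry x 0 0 + entry A 1 1 * entry x 1 0
      - l * entry x 1 0)); [unfold D; ring|]. rewrite K0, K1. ring. }
  assert (D1 : D * entry x 1 0 = 0).
  { transitivity ((entry A 0 0 - l) * (entry A 1 0 * entry x 0 0 + entry A 1 1 * entry x 1 0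
      - l * entry x 1 0) - entry A 1 0 * (entry A 0 0 * entry x 0 0 + entry A 0 1 * entry x 1 0
      - l * entry x 0 0)); [unfold D; ring|]. rewrite K0, K1. ring. }
  apply NNPP. intros HD. apply Hx.
  apply Cmult_eq0_reg in D0; [|exact HD]. apply Cmult_eq0_reg in D1; [|exact HD].
  destruct x as [[x0 []] [[x1 []] []]]. unfold entry in D0, D1. cbn in D0, D1. subst. reflexivity.
Qed.

Lemma two_neq0 : RtoC 2 <> 0.
Proof. intros H. apply RtoC_inj in H. lra. Qed.

(** The characteristic polynomial at [- l] minus its value at [l] is [2 l] times the trace. *)
Lemma opposite_eigenvalues_trace (A : mx2) (l : C) :
  l <> 0 -> is_eigenvalue A l -> is_eigenvalue A (- l) -> entry A 0 0 + entry A 1 1 = 0.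
Proof.
  intros Hl H1 H2. apply eigenvalue_charpoly in H1. apply eigenvalue_charpoly in H2.
  apply (Cmult_eq0_reg (2 * l)); [|apply Cmult_neq_0; [apply two_neq0 | exact Hl]].
  transitivity (((entry A 0 0 - - l) * (entry A 1 1 - - l) - entry A 0 1 * entry A 1 0) -
    ((entry A 0 0 - l) * (entry A 1 1 - l) - entry A 0 1 * entry A 1 0)); [ring|].
  rewrite H1, H2. ring.
Qed.

Lemma half_noninteger_neq0 (x : C) : ~ is_Cinteger x -> x / 2 <> 0.
Proof.
  intros H E. apply H. exists 0%Z. replace x with (x / 2 * 2) by field. rewrite E.
  ring.
Qed.

Definition comm_entry (A B : mx2) (i j : nat) : C :=
  entry A i 0 * entry B 0 j + entry A i 1 * entry B 1 j
  - (entry B i 0 * entry A 0 j + entry B i 1 * entry A 1 j).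

(** The double pole [b1 / (z - t)^2] appears both in [dQ/dz] and in [dP/dt] and cancels; the rest is
    multiplied by [- z (z - t)]. *)
Lemma integrable_entry (b0 b1 : C -> mx2) (z t : C) (i j : nat) (x y : C) :
  (i < 2)%nat -> (j < 2)%nat -> z <> 0 -> z <> t ->
  integrable_at (Omega_dz b0 b1) (Omega_dt b1) z t ->
  is_derive (fun t => entry (b0 t) i j) t x -> is_derive (fun t => entry (b1 t) i j) t y ->
  x * (z - t) + y * z = comm_entry (b0 t) (b1 t) i j + z * comm_entry E11 (b1 t) i j.
Proof.
  intros Hi Hj Hz Hzt (Qz & Pt & HQ & HP & E) Dx Dy.
  pose proof (Cminus_neq0 z t Hzt) as Hd.
  assert (EQ : entry Qz i j = entry (b1 t) i j / ((z - t) * (z - t))).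
  { apply (Cderive_unique (fun z' => entry (Omega_dt b1 z' t) i j) z); [apply HQ|].
    apply (Cderive_ext_loc (fun z' => - / (z' - t) * entry (b1 t) i j)).
    - apply locally_Cmod. exists 1%R. split; [lra|]. intros w _. symmetry. now apply entry_mxscal.
    - eapply Cderive_eq.
      + apply Cderive_mult; [|apply Cderive_const]. apply Cderive_opp, Cderive_inv; [|exact Hd].
        apply Cderive_minus; [apply Cderive_id|apply Cderive_const].
      + toC. field. exact Hd. }
  assert (EP : entry Pt i j = x / z + y / (z - t) + entry (b1 t) i j / ((z - t) * (z - t))).
  { apply (Cderive_unique (fun t' => entry (Omega_dz b0 b1 z t') i j) t); [apply HP|].
    apply (Cderive_ext_loc (fun t' => / z * entry (b0 t') i j + / (z - t') * entry (b1 t') i j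
      + entry E11 i j)).
    - apply locally_Cmod. exists 1%R. split; [lra|]. intros w _. symmetry.
      unfold Omega_dz, coef_mx. rewrite !entry_mxadd, !entry_mxscal by assumption. reflexivity.
    - eapply Cderive_eq.
      + apply Cderive_plus; [|apply Cderive_const]. apply Cderive_plus.
        * apply Cderive_mult; [apply Cderive_const | exact Dx].
        * apply Cderive_mult; [|exact Dy]. apply Cderive_inv; [|exact Hd].
          apply Cderive_minus; [apply Cderive_const|apply Cderive_id].
      + toC. field. auto. }
  apply (f_equal (fun M => entry M i j)) in E.
  rewrite !entry_mxsub, !entry_mxmul, EQ, EP in E by assumption.
  unfold Omega_dz, Omega_dt, coef_mx in E.
  rewrite !entry_mxadd, !entry_mxscal in E by (assumption || lia).
  unfold comm_entry. revert E.
  generalize (entry (b0 t)) (entry (b1 t)) (entry E11). intros f g e E.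
  transitivity (- (g i j / ((z - t) * (z - t)) - (x / z + y / (z - t) + g i j / ((z - t) * (z - t))))
    * (z * (z - t))); [field; auto|].
  rewrite E. field. auto.
Qed.

Lemma isomonodromic_ode (t0 : C) (B00 B10 : mx2) (b0 b1 : C -> mx2) :
  t0 <> 0 -> isomonodromic_family t0 B00 B10 b0 b1 ->
  locally t0 (fun t : C => t <> 0 /\ forall i j, (i < 2)%nat -> (j < 2)%nat ->
    is_derive (fun t => entry (b0 t) i j) t (- comm_entry (b0 t) (b1 t) i j / t) /\
    is_derive (fun t => entry (b1 t) i j) t
      (comm_entry (b0 t) (b1 t) i j / t + comm_entry E11 (b1 t) i j)).
Proof.
  intros Ht0 (_ & _ & Hb0 & Hb1 & HI).
  assert (L : forall b : C -> mx2, mx_holomorphic_at b t0 ->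
    locally t0 (fun t => forall i j, (i < 2)%nat -> (j < 2)%nat ->
      ex_derive (fun t => entry (b t) i j) t)).
  { intros b Hb.
    generalize (locally_and _ _ _ (locally_and _ _ _ (Hb 0%nat 0%nat) (Hb 0%nat 1%nat))
      (locally_and _ _ _ (Hb 1%nat 0%nat) (Hb 1%nat 1%nat))).
    apply locally_imp. intros t ((H1 & H2) & H3 & H4) i j Hi Hj.
    destruct i as [|[|i]]; [| |lia]; (destruct j as [|[|j]]; [| |lia]); assumption. }
  generalize (locally_and _ _ _ (locally_and _ _ _ (L b0 Hb0) (L b1 Hb1))
    (locally_and _ _ _ HI (locally_neq t0 0 Ht0))).
  apply locally_imp. intros t ((D0 & D1) & HIt & Ht). split; [exact Ht|]. intros i j Hi Hj.
  destruct (D0 i j Hi Hj) as [x Dx]. destruct (D1 i j Hi Hj) as [y Dy].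
  pose proof two_neq0 as H2.
  (* The relation of [integrable_entry] is affine in [z]. The values [2 t] and [- t] avoid both 0
     and [t], and together they determine the two derivatives. *)
  assert (N1 : 2 * t <> 0) by now apply Cmult_neq_0.
  assert (N2 : 2 * t <> t).
  { intros E. apply Ht. replace t with (2 * t - t) by ringC. rewrite E. ringC. }
  assert (N3 : - t <> 0).
  { intros E. apply Ht. replace t with (- - t) by ringC. rewrite E. ringC. }
  assert (N4 : - t <> t).
  { intros E. apply N1. replace (2 * t) with (t - - t) by ringC. rewrite E. ringC. }
  pose proof (integrable_entry b0 b1 _ t i j x y Hi Hj N1 N2 (HIt _ N1 N2) Dx Dy) as E1.
  pose proof (integrable_entry b0 b1 _ t i j x y Hi Hj N3 N4 (HIt _ N3 N4) Dx Dy) as E2.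
  revert E1 E2. generalize (comm_entry (b0 t) (b1 t) i j) (comm_entry E11 (b1 t) i j).
  intros c e E1 E2.
  assert (three : RtoC 3 <> 0) by (intros H; apply RtoC_inj in H; lra).
  split.
  - replace (- c / t) with x; [exact Dx|].
    replace x with (((x * (2 * t - t) + y * (2 * t)) + 2 * (x * (- t - t) + y * - t)) / (- (3) * t))
      by (fieldC; auto).
    rewrite E1, E2. fieldC. auto.
  - replace (c / t + e) with y; [exact Dy|].
    replace y with ((2 * (x * (2 * t - t) + y * (2 * t)) + (x * (- t - t) + y * - t)) / (3 * t))
      by (fieldC; auto).
    rewrite E1, E2. fieldC. auto.
Qed.

Lemma mero_ex_derive (f : C -> C) (a : C) : mero_at f a -> locally' a (fun z => ex_derive f z).
Proof.
  intros (n & g & Hg & E). generalize (is_derive_laurent f g a n Hg E).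
  apply locally'_imp. intros z _ D. eexists. exact D.
Qed.

Lemma mero_holomorphic (f : C -> C) (a : C) : mero_at f a -> locally' a (holomorphic_at f).
Proof. intros H. exact (locally'_twice _ a (mero_ex_derive f a H)). Qed.

Lemma mero_eq_extend (f g : C -> C) (s0 : C) :
  (forall a, mero_at f a) -> (forall a, mero_at g a) ->
  locally s0 (fun z => f z = g z) -> forall a : C, locally' a (fun z : C => f z = g z).
Proof.
  intros Hf Hg H a.
  assert (K : locally' a (fun z => f z - g z = 0)).
  { apply (identity_theorem (fun _ => True) _ s0 a); auto.
    - intros A B _ _ t _. exact I.
    - intros z _. now apply mero_at_minus.
    - apply locally_locally'. generalize H. apply locally_imp. intros z ->. ring. }
  generalize K. apply locally'_imp. intros z _ E.
  replace (f z) with (f z - g z + g z) by ring. rewrite E. ring.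
Qed.

(** The equation becomes an equality of the meromorphic functions [C_derive f] and [g]. As
    [C_derive] is total, differentiability on the punctured neighbourhood is supplied separately. *)
Lemma mero_ode_extend (f g : C -> C) (s0 : C) :
  (forall a, mero_at f a) -> (forall a, mero_at g a) ->
  locally s0 (fun z => is_derive f z (g z)) ->
  forall a : C, locally' a (fun z : C => is_derive f z (g z)).
Proof.
  intros Hf Hg H a.
  assert (K : locally' a (fun z => C_derive f z = g z)).
  { apply (mero_eq_extend _ _ s0); auto.
    - intros z. now apply mero_at_derive.
    - generalize H. apply locally_imp. intros z D. now apply is_C_derive_unique. }
  generalize (locally'_and _ _ a K (mero_ex_derive f a (Hf a))). apply locally'_imp.
  intros z _ [<- D]. exact (C_derive_correct f z 0 D).
Qed.

Lemma locally_const (f : C -> C) (s0 : C) :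
  locally s0 (fun z => is_derive f z (RtoC 0)) -> locally s0 (fun z => f z = f s0).
Proof.
  intros H. apply locally_Cmod in H. destruct H as [r [Hr H]].
  apply locally_Cmod. exists r. split; [exact Hr|]. now apply derive_zero_const.
Qed.

Ltac mero :=
  match goal with
  | |- mero_at (fun _ => ?c) _ => apply mero_at_const
  | |- mero_at (fun x => _ + _) _ => apply mero_at_plus; mero
  | |- mero_at (fun x => _ - _) _ => apply mero_at_minus; mero
  | |- mero_at (fun x => _ * _) _ => apply mero_at_mult; mero
  | |- mero_at Cexp _ => apply holomorphic_mero, holomorphic_at_Cexp
  | _ => auto
  end.

(** * Continuation of the system over the universal cover *)

Section Extension.

Variables (t0 : C) (B00 B10 : mx2) (b0 b1 : C -> mx2) (s0 : C) (B0 B1 : C -> mx2).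
Hypothesis Ht0 : t0 <> 0.
Hypothesis tr0 : entry B00 0 0 + entry B00 1 1 = 0.
Hypothesis tr1 : entry B10 0 0 + entry B10 1 1 = 0.
Hypothesis Hiso : isomonodromic_family t0 B00 B10 b0 b1.
Hypothesis Hext : meromorphic_extension t0 s0 b0 b1 B0 B1.

Let p s := entry (B0 s) 0 0.
Let q s := entry (B0 s) 0 1.
Let r s := entry (B0 s) 1 0.
Let p' s := entry (B0 s) 1 1.
Let u s := entry (B1 s) 0 0.
Let v s := entry (B1 s) 0 1.
Let w s := entry (B1 s) 1 0.
Let u' s := entry (B1 s) 1 1.
(** The conserved quantities, read off at [s0]: [c] is the first diagonal entry
    [- theta_infinity / 2] of [B0 + B1], while [e0] and [e1] are minus the determinants of the
    trace-free [B0] and [B1]. *)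
Let c := p s0 + u s0.
Let e0 := p s0 * p s0 + q s0 * r s0.
Let e1 := u s0 * u s0 + v s0 * w s0.

Lemma entry0_mero (i j : nat) (a : C) : mero_at (fun s => entry (B0 s) i j) a.
Proof. destruct Hext as (_ & H & _). apply meromorphic_mero, H. Qed.

Lemma entry1_mero (i j : nat) (a : C) : mero_at (fun s => entry (B1 s) i j) a.
Proof. destruct Hext as (_ & _ & H & _). apply meromorphic_mero, H. Qed.

(** The chain rule for [Cexp] multiplies the equations in [t] by [t], which removes the pole
    [1 / t]. *)
Lemma lifted_ode :
  locally s0 (fun s => forall i j, (i < 2)%nat -> (j < 2)%nat ->
    is_derive (fun s => entry (B0 s) i j) s (- comm_entry (B0 s) (B1 s) i j) /\
    is_derive (fun s => entry (B1 s) i j) s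
      (comm_entry (B0 s) (B1 s) i j + Cexp s * comm_entry E11 (B1 s) i j)).
Proof.
  destruct Hext as (Es0 & _ & _ & EB).
  pose proof (isomonodromic_ode t0 B00 B10 b0 b1 Ht0 Hiso) as L.
  assert (L' : locally s0 (fun s => (fun t : C => t <> 0 /\ forall i j, (i < 2)%nat -> (j < 2)%nat ->
    is_derive (fun t => entry (b0 t) i j) t (- comm_entry (b0 t) (b1 t) i j / t) /\
    is_derive (fun t => entry (b1 t) i j) t
      (comm_entry (b0 t) (b1 t) i j / t + comm_entry E11 (b1 t) i j)) (Cexp s))).
  { apply locally_Cmod in L. destruct L as [d [Hd L]].
    destruct (Cderive_continuous Cexp s0 (ex_intro _ _ (is_derive_Cexp s0)) d Hd) as [d' [Hd' K]].
    apply locally_Cmod. exists d'. split; [exact Hd'|]. intros s Hs. apply L.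
    rewrite <- Es0. now apply K. }
  generalize (locally_and _ _ _ L' (locally_twice _ _ EB)). apply locally_imp.
  intros s [(Hs & D) E] i j Hi Hj. destruct (D i j Hi Hj) as [D0 D1].
  destruct (locally_self _ _ E) as [-> ->].
  split.
  - apply (Cderive_ext_loc (fun s => entry (b0 (Cexp s)) i j)).
    + generalize E. apply locally_imp. now intros y [-> _].
    + eapply Cderive_eq; [apply (Cderive_comp _ Cexp s _ _ D0 (is_derive_Cexp s))|].
      toC. field. exact Hs.
  - apply (Cderive_ext_loc (fun s => entry (b1 (Cexp s)) i j)).
    + generalize E. apply locally_imp. now intros y [_ ->].
    + eapply Cderive_eq; [apply (Cderive_comp _ Cexp s _ _ D1 (is_derive_Cexp s))|].
      toC. field. exact Hs.
Qed.

Lemma initial_values : B0 s0 = B00 /\ B1 s0 = B10.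
Proof.
  destruct Hext as (Es0 & _ & _ & EB). destruct Hiso as (<- & <- & _).
  rewrite <- Es0. exact (locally_self _ _ EB).
Qed.

(** Commutators have trace zero, so both traces keep their initial value 0. The factor [- (1)]
    replaces the opposite so that the closure rules for products apply directly. *)
Lemma traces_near :
  locally s0 (fun s => p' s = - (1) * p s) /\ locally s0 (fun s => u' s = - (1) * u s).
Proof.
  destruct initial_values as [I0 I1].
  assert (T0 : p s0 + p' s0 = 0) by (unfold p, p'; now rewrite I0).
  assert (T1 : u s0 + u' s0 = 0) by (unfold u, u'; now rewrite I1).
  assert (K0 : locally s0 (fun s => p s + p' s = p s0 + p' s0)).
  { apply (locally_const (fun s => p s + p' s)). generalize lifted_ode. apply locally_imp.
    intros s D. destruct (D 0%nat 0%nat ltac:(lia) ltac:(lia)) as [D1 _].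
    destruct (D 1%nat 1%nat ltac:(lia) ltac:(lia)) as [D2 _].
    eapply Cderive_eq; [exact (Cderive_plus _ _ _ _ _ D1 D2)|].
    unfold comm_entry. toC. ring. }
  assert (K1 : locally s0 (fun s => u s + u' s = u s0 + u' s0)).
  { apply (locally_const (fun s => u s + u' s)). generalize lifted_ode. apply locally_imp.
    intros s D. destruct (D 0%nat 0%nat ltac:(lia) ltac:(lia)) as [_ D1].
    destruct (D 1%nat 1%nat ltac:(lia) ltac:(lia)) as [_ D2].
    eapply Cderive_eq; [exact (Cderive_plus _ _ _ _ _ D1 D2)|].
    unfold comm_entry. toC. ring. }
  rewrite T0 in K0. rewrite T1 in K1. split.
  - generalize K0. apply locally_imp. intros s E. replace (p' s) with (p s + p' s - p s) by ring.
    rewrite E. ring.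
  - generalize K1. apply locally_imp. intros s E. replace (u' s) with (u s + u' s - u s) by ring.
    rewrite E. ring.
Qed.

Lemma system_near : locally s0 (fun s =>
  is_derive p s (- (q s * w s - v s * r s)) /\
  is_derive q s (- 2 * (p s * v s - q s * u s)) /\
  is_derive r s (- 2 * (r s * u s - p s * w s)) /\
  is_derive u s (q s * w s - v s * r s) /\
  is_derive v s (2 * (p s * v s - q s * u s) + Cexp s * v s) /\
  is_derive w s (2 * (r s * u s - p s * w s) - Cexp s * w s)).
Proof.
  destruct traces_near as [T0 T1].
  generalize (locally_and _ _ _ lifted_ode (locally_and _ _ _ T0 T1)). apply locally_imp.
  intros s (D & E0 & E1).
  destruct (D 0%nat 0%nat ltac:(lia) ltac:(lia)) as [Dp Du].
  destruct (D 0%nat 1%nat ltac:(lia) ltac:(lia)) as [Dq Dv].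
  destruct (D 1%nat 0%nat ltac:(lia) ltac:(lia)) as [Dr Dw].
  unfold comm_entry in *.
  change (entry E11 0 0) with (RtoC 1) in *. change (entry E11 0 1) with (RtoC 0) in *.
  change (entry E11 1 0) with (RtoC 0) in *. change (entry E11 1 1) with (RtoC 0) in *.
  fold (p s) (q s) (r s) (p' s) (u s) (v s) (w s) (u' s) in *. rewrite E0, E1 in *.
  split; [eapply Cderive_eq; [exact Dp|]; ringC|].
  split; [eapply Cderive_eq; [exact Dq|]; ringC|].
  split; [eapply Cderive_eq; [exact Dr|]; ringC|].
  split; [eapply Cderive_eq; [exact Du|]; ringC|].
  split; [eapply Cderive_eq; [exact Dv|]; ringC|].
  eapply Cderive_eq; [exact Dw|]. ringC.
Qed.

Lemma conserved_near : locally s0 (fun s =>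
  p s + u s = c /\ p s * p s + q s * r s = e0 /\ u s * u s + v s * w s = e1).
Proof.
  apply locally_and; [|apply locally_and].
  - apply (locally_const (fun s => p s + u s)). generalize system_near. apply locally_imp.
    intros s (Dp & Dq & Dr & Du & Dv & Dw).
    eapply Cderive_eq; [exact (Cderive_plus _ _ _ _ _ Dp Du)|]. toC. ring.
  - apply (locally_const (fun s => p s * p s + q s * r s)). generalize system_near. apply locally_imp.
    intros s (Dp & Dq & Dr & Du & Dv & Dw).
    eapply Cderive_eq; [exact (Cderive_plus _ _ _ _ _ (Cderive_mult _ _ _ _ _ Dp Dp)
      (Cderive_mult _ _ _ _ _ Dq Dr))|]. toC. ring.
  - apply (locally_const (fun s => u s * u s + v s * w s)). generalize system_near. apply locally_imp.
    intros s (Dp & Dq & Dr & Du & Dv & Dw).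
    eapply Cderive_eq; [exact (Cderive_plus _ _ _ _ _ (Cderive_mult _ _ _ _ _ Du Du)
      (Cderive_mult _ _ _ _ _ Dv Dw))|]. toC. ring.
Qed.

Let Mp : forall a, mero_at p a := entry0_mero 0 0.
Let Mq : forall a, mero_at q a := entry0_mero 0 1.
Let Mr : forall a, mero_at r a := entry0_mero 1 0.
Let Mp' : forall a, mero_at p' a := entry0_mero 1 1.
Let Mu : forall a, mero_at u a := entry1_mero 0 0.
Let Mv : forall a, mero_at v a := entry1_mero 0 1.
Let Mw : forall a, mero_at w a := entry1_mero 1 0.
Let Mu' : forall a, mero_at u' a := entry1_mero 1 1.

Lemma traces_extend (a : C) :
  locally' a (fun s => p' s = - (1) * p s) /\ locally' a (fun s => u' s = - (1) * u s).
Proof.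
  destruct traces_near as [T0 T1].
  split; apply (mero_eq_extend _ _ s0); auto; intros b; mero.
Qed.

Lemma system_extend (a : C) : locally' a (pv_system c e0 e1 p q r u v w).
Proof.
  pose proof conserved_near as K. pose proof system_near as L. unfold pv_system.
  apply locally'_and; [|apply locally'_and; [|apply locally'_and; [|apply locally'_and;
    [|apply locally'_and; [|apply locally'_and; [|apply locally'_and; [|apply locally'_and]]]]]]].
  - apply (mero_eq_extend (fun s => p s + u s) (fun _ => c) s0); try (intros b; mero).
    generalize K. apply locally_imp. tauto.
  - apply (mero_eq_extend (fun s => p s * p s + q s * r s) (fun _ => e0) s0); try (intros b; mero).
    generalize K. apply locally_imp. tauto.
  - apply (mero_eq_extend (fun s => u s * u s + v s * w s) (fun _ => e1) s0); try (intros b; mero).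
    generalize K. apply locally_imp. tauto.
  - apply (mero_ode_extend p (fun s => - (q s * w s - v s * r s)) s0); auto.
    + intros b. apply (mero_at_ext (fun s => - (1) * (q s * w s - v s * r s))); [|mero].
      apply locally'_Cmod. exists 1%R. split; [lra|]. intros; ring.
    + generalize L. apply locally_imp. tauto.
  - apply (mero_ode_extend q (fun s => - 2 * (p s * v s - q s * u s)) s0); try (intros b; mero).
    generalize L. apply locally_imp. tauto.
  - apply (mero_ode_extend r (fun s => - 2 * (r s * u s - p s * w s)) s0); try (intros b; mero).
    generalize L. apply locally_imp. tauto.
  - apply (mero_ode_extend u (fun s => q s * w s - v s * r s) s0); try (intros b; mero).
    generalize L. apply locally_imp. tauto.
  - apply (mero_ode_extend v (fun s => 2 * (p s * v s - q s * u s) + Cexp s * v s) s0);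
      try (intros b; mero).
    generalize L. apply locally_imp. tauto.
  - apply (mero_ode_extend w (fun s => 2 * (r s * u s - p s * w s) - Cexp s * w s) s0);
      try (intros b; mero).
    generalize L. apply locally_imp. tauto.
Qed.

Let h := pv_ham p q r u v w.

(** An entry with an index out of range is constantly 0 and has no pole. *)
Lemma pole_entry (F : C -> mx2) (a : C) :
  mx_pole_at F a -> exists i j, (i < 2)%nat /\ (j < 2)%nat /\ pole_at (fun s => entry (F s) i j) a.
Proof.
  intros (i & j & H). exists i, j.
  assert (Hij : (i < 2)%nat /\ (j < 2)%nat); [|tauto].
  apply NNPP. intros Hn.
  apply (pole_not_removable _ (fun _ => 0) a H (holomorphic_at_const 0 a)).
  apply locally'_Cmod. exists 1%R. split; [lra|]. intros z _ _. now apply entry_out.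
Qed.

(** Here the convention that a meromorphic function is holomorphic as it stands at every point other
    than a pole is used: values off [Theta] are genuine. *)
Lemma regular_entries (s : C) : ~ Theta B0 B1 s -> forall i j,
  holomorphic_at (fun s => entry (B0 s) i j) s /\ holomorphic_at (fun s => entry (B1 s) i j) s.
Proof.
  intros H i j. destruct Hext as (_ & H0 & H1 & _). split.
  - destruct (H0 i j s) as [K|K]; [exact K|]. exfalso. apply H. left. now exists i, j.
  - destruct (H1 i j s) as [K|K]; [exact K|]. exfalso. apply H. right. now exists i, j.
Qed.

Lemma ham_regular (s : C) : ~ Theta B0 B1 s -> holomorphic_at h s.
Proof.
  intros H. pose proof (regular_entries s H) as K.
  pose proof (proj1 (K 0%nat 0%nat)) as Hp. pose proof (proj1 (K 0%nat 1%nat)) as Hq.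
  pose proof (proj1 (K 1%nat 0%nat)) as Hr. pose proof (proj2 (K 0%nat 0%nat)) as Hu.
  pose proof (proj2 (K 0%nat 1%nat)) as Hv. pose proof (proj2 (K 1%nat 0%nat)) as Hw.
  unfold h, pv_ham, p, q, r, u, v, w. holo.
Qed.

(** If [h] had a removable singularity, all entries would have one too, those at [(1, 1)] through
    the traces; this contradicts a pole of [B0] or [B1]. So [h] has a pole, and the sigma form
    determines its shape. *)
Lemma ham_pole (s : C) : Theta B0 B1 s ->
  exists k : C -> C, holomorphic_at k s /\ locally' s (fun z => h z = / (z - s) + k z).
Proof.
  intros HT. pose proof (system_extend s) as Hs.
  assert (Mh : mero_at h s) by (unfold h, pv_ham; mero).
  destruct (mero_at_cases h s Mh) as [(H & HH & E) | Hpole].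
  - exfalso.
    destruct (pv_ham_regular c e0 e1 p q r u v w s Hs (Mq s) (Mr s) (Mv s) (Mw s) H HH E)
      as (gp & gq & gr & gu & gv & gw & (Hp & Ep) & (Hq & Eq) & (Hr & Er) &
          (Hu & Eu) & (Hv & Ev) & (Hw & Ew)).
    destruct (traces_extend s) as [T0 T1].
    destruct HT as [HT|HT]; apply pole_entry in HT; destruct HT as (i & j & Hi & Hj & HP).
    + destruct i as [|[|i]]; [| |lia]; (destruct j as [|[|j]]; [| |lia]).
      * exact (pole_not_removable _ gp s HP Hp Ep).
      * exact (pole_not_removable _ gq s HP Hq Eq).
      * exact (pole_not_removable _ gr s HP Hr Er).
      * apply (pole_not_removable _ (fun z => - (1) * gp z) s HP); [holo|].
        generalize (locally'_and _ _ s T0 Ep). apply locally'_imp. intros z _ [E1 E2].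
        rewrite <- E2. exact E1.
    + destruct i as [|[|i]]; [| |lia]; (destruct j as [|[|j]]; [| |lia]).
      * exact (pole_not_removable _ gu s HP Hu Eu).
      * exact (pole_not_removable _ gv s HP Hv Ev).
      * exact (pole_not_removable _ gw s HP Hw Ew).
      * apply (pole_not_removable _ (fun z => - (1) * gu z) s HP); [holo|].
        generalize (locally'_and _ _ s T1 Eu). apply locally'_imp. intros z _ [E1 E2].
        rewrite <- E2. exact E1.
  - exact (pv_ham_pole c e0 e1 p q r u v w s Hs Hpole).
Qed.

Lemma Theta_isolated (s : C) : locally' s (fun z => ~ Theta B0 B1 z).
Proof.
  assert (L : forall F : C -> mx2, (forall i j a, mero_at (fun s => entry (F s) i j) a) ->
    locally' s (fun z => ~ mx_pole_at F z)).
  { intros F HF.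
    generalize (locally'_and _ _ s
      (locally'_and _ _ s (mero_holomorphic _ s (HF 0%nat 0%nat s)) (mero_holomorphic _ s (HF 0%nat 1%nat s)))
      (locally'_and _ _ s (mero_holomorphic _ s (HF 1%nat 0%nat s)) (mero_holomorphic _ s (HF 1%nat 1%nat s)))).
    apply locally'_imp. intros z _ ((K1 & K2) & K3 & K4) HP.
    apply pole_entry in HP. destruct HP as (i & j & Hi & Hj & HP).
    assert (HK : holomorphic_at (fun s => entry (F s) i j) z).
    { destruct i as [|[|i]]; [| |lia]; (destruct j as [|[|j]]; [| |lia]); assumption. }
    apply (pole_not_removable _ _ z HP HK).
    apply locally'_Cmod. exists 1%R. split; [lra|]. auto. }
  generalize (locally'_and _ _ s (L B0 entry0_mero) (L B1 entry1_mero)). apply locally'_imp.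
  intros z _ [H0 H1] [H|H]; auto.
Qed.

(** Expanding the square, the mixed term [2 tr (B0 B1) / (z (z - t))] contributes [2 tr (B0 B1) / t]
    to the residue and the product of [B1] with the constant matrix contributes [2 u]. Since [s] is
    regular, the trace conditions hold at [s] itself by continuity. *)
Lemma residue_ham (s : C) : ~ Theta B0 B1 s ->
  exists x : C, is_residue (trB2 B0 B1 s) (Cexp s) x /\ 1 / 2 * x * Cexp s = h s.
Proof.
  intros H. pose proof (regular_entries s H) as K.
  destruct (traces_extend s) as [T0 T1].
  assert (E0 : p' s = - (1) * p s).
  { apply (punctured_limit p' (fun s => - (1) * p s)); [| |exact T0].
    - apply holomorphic_at_ex, (K 1%nat 1%nat).
    - apply holomorphic_at_ex. pose proof (proj1 (K 0%nat 0%nat)) as Hp. unfold p. holo. }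
  assert (E1 : u' s = - (1) * u s).
  { apply (punctured_limit u' (fun s => - (1) * u s)); [| |exact T1].
    - apply holomorphic_at_ex, (K 1%nat 1%nat).
    - apply holomorphic_at_ex. pose proof (proj2 (K 0%nat 0%nat)) as Hu. unfold u. holo. }
  set (t := Cexp s). pose proof (Cexp_neq0 s) as Ht. fold t in Ht.
  set (tr01 := 2 * (p s * u s) + q s * w s + r s * v s).
  exists (2 * tr01 / t + 2 * u s). split.
  (* The bound of [sum_n] is inclusive: index 0 is the simple pole and index 1 the double pole from
     [tr B1^2]. The regular part collects the poles at 0, with the other half of the partial
     fraction of [1 / (z (z - t))], and [tr E^2 = 1]. *)
  - exists 1%nat,
      (fun k => match k with O => 2 * tr01 / t + 2 * u s | _ => 2 * (u s * u s + v s * w s) end),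
      (fun z => 2 * (p s * p s + q s * r s) / (z * z) + 2 * (p s - tr01 / t) / z + 1).
    split; [|split; [|reflexivity]].
    + assert (Hid : holomorphic_at (fun z => z) t) by (apply holomorphic_at_of_ex; apply ex_Cderive_id).
      apply holomorphic_at_plus; [|apply holomorphic_at_const].
      apply holomorphic_at_plus.
      * apply (holomorphic_at_div (fun _ => _) (fun z => z * z)).
        -- apply holomorphic_at_const.
        -- apply holomorphic_at_mult; exact Hid.
        -- now apply Cmult_neq_0.
      * apply (holomorphic_at_div (fun _ => _) (fun z => z)).
        -- apply holomorphic_at_const.
        -- exact Hid.
        -- exact Ht.
    + generalize (locally_locally' _ t (locally_neq t 0 Ht)). apply locally'_imp.
      intros z Hzt Hz. pose proof (Cminus_neq0 z t Hzt) as Hd.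
      rewrite sum_Sn, sum_O. change (plus ?x ?y) with (Cplus x y).
      unfold trB2, mxtr. fold t. cbv zeta.
      rewrite !entry_mxmul by lia. unfold coef_mx.
      rewrite !entry_mxadd, !entry_mxscal by lia.
      change (entry E11 0 0) with (RtoC 1). change (entry E11 0 1) with (RtoC 0).
      change (entry E11 1 0) with (RtoC 0). change (entry E11 1 1) with (RtoC 0).
      fold (p s) (q s) (r s) (p' s) (u s) (v s) (w s) (u' s). rewrite E0, E1.
      unfold tr01. simpl Cpow. toC. field. auto.
  - unfold h, pv_ham. fold t. unfold tr01. field. exact Ht.
Qed.

End Extension.

Theorem theorem1 (t0 theta0 theta1 : C) (B00 B10 : mx2)
    (b0 b1 : C -> mx2) (s0 : C) (B0 B1 : C -> mx2) :
  t0 <> 0 ->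
  ~ is_Cinteger theta0 -> ~ is_Cinteger theta1 ->
  is_eigenvalue B00 (theta0 / 2) -> is_eigenvalue B00 (- (theta0 / 2)) ->
  is_eigenvalue B10 (theta1 / 2) -> is_eigenvalue B10 (- (theta1 / 2)) ->
  isomonodromic_family t0 B00 B10 b0 b1 ->
  meromorphic_extension t0 s0 b0 b1 B0 B1 ->
  exists tau : C -> C,
    is_tau_function B0 B1 tau /\
    forall s : C, ~ Theta B0 B1 s ->
      exists r : C,
        is_residue (trB2 B0 B1 s) (Cexp s) r /\
        is_dlog tau s (1 / 2 * r * Cexp s).
Proof.
  intros Ht0 Hth0 Hth1 E00 E01 E10 E11' Hiso Hext.
  (* Nonintegrality makes [theta0 / 2] and [theta1 / 2] nonzero, so the two opposite eigenvalues are
     distinct and the initial matrices are trace-free. *)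
  pose proof (opposite_eigenvalues_trace B00 _ (half_noninteger_neq0 _ Hth0) E00 E01) as tr0.
  pose proof (opposite_eigenvalues_trace B10 _ (half_noninteger_neq0 _ Hth1) E10 E11') as tr1.
  pose proof (fun s => ham_regular t0 b0 b1 s0 B0 B1 Hext s) as Hreg.
  pose proof (fun s => ham_pole t0 B00 B10 b0 b1 s0 B0 B1 Ht0 tr0 tr1 Hiso Hext s) as Hpole.
  destruct (tau_global _ _ Hreg Hpole (Theta_isolated t0 b0 b1 s0 B0 B1 Hext)) as [tau Htau].
  exists tau. split; [split|].
  - intros s. destruct (Htau s I) as (d & D & _). now exists d.
  - intros s. destruct (Htau s I) as (d & _ & K1 & K2). split; [|exact K1].
    intros E. apply NNPP. intros HT. now apply (K2 HT).
  - intros s Hs.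
    destruct (residue_ham t0 B00 B10 b0 b1 s0 B0 B1 Ht0 tr0 tr1 Hiso Hext s Hs) as (x & Hx & Ex).
    exists x. split; [exact Hx|]. destruct (Htau s I) as (d & D & _ & K2).
    destruct (K2 Hs) as [N ->]. split; [exact N|]. eexists. split; [exact D|].
    rewrite Ex. field. exact N.
Qed.
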